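(* Let $E$ be a regular biordered set satisfying the following conditions. (E1) There exists an element $0\in E$ such that $0\,\omega\,e$ for every $e\in E$. (E2) There exists a map $E\to E$, $e\mapsto e'$, such that for all $e,f\in E$: (i) $(e')'=e$; (ii) $f\,\omega^l\,e$ if and only if $e'\,\omega^r\,f'$; (iii) $f\,\omega^l\,e'$ if and only if $M(f,e)=\{0\}$. (E3) For all $e,f\in E$, if $f\,\omega\,e'$ then $S(e',f')\cap S(f',e')\neq\emptyset$. (E4) There exist elements $e_1,e_2,\dots,e_n\in E$, where $n\ge 4$, such that: (i) $M(e_i,e_j)=\{0\}$ for all $i\neq j$; (ii) if $e\in E$ satisfies $e_i\,\omega\,e$ for all $i=1,\dots,n$, then $e=1$, where $1:=0'$; (iii) $d_l(e_i,e_j)=3$ for all $i\ne j$. Then there exists a (von Neumann) regular ring $R$ such that the biordered set of idempotents of the ring $R_n$ of $n\times n$ matrices over $R$ is isomorphic to $E$.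
   Context: For a semigroup $S$, its biordered set $E(S)$ is the set of idempotents of $S$ regarded as a partial algebra: for $e,f\in E(S)$ the product $ef$ (computed in $S$) is defined exactly when $\{ef,fe\}\cap\{e,f\}\neq\emptyset$. A regular biordered set is a partial algebra isomorphic to $E(S)$ for some regular semigroup $S$ (equivalently, a biordered set in Nambooripad's axiomatic sense satisfying the regularity axiom). An isomorphism of biordered sets is a bijection $\theta$ such that $ef$ is defined iff $\theta(e)\theta(f)$ is defined, and then $\theta(ef)=\theta(e)\theta(f)$. A ring is regular if for every $x$ there is $y$ with $xyx=x$; the biordered set of idempotents of a ring is that of its multiplicative semigroup. In a biordered set $E$: $\omega^l=\{(e,f): ef=e\}$, $\omega^r=\{(e,f): fe=e\}$, $\omega=\omega^l\cap\omega^r$; $\omega^l(e)=\{g: g\,\omega^l\,e\}$, $\omega^r(e)=\{g: g\,\omega^r\,e\}$; $M(e,f)=\omega^l(e)\cap\omega^r(f)$; for $g,h\in M(e,f)$ write $g\preceq h$ iff $eg\,\omega^r\,eh$ and $gf\,\omega^l\,hf$; the sandwich set is $S(e,f)=\{h\in M(e,f): g\preceq h \text{ for all } g\in M(e,f)\}$. Let $\mathcal L=\omega^l\cap(\omega^l)^{-1}$ and $\mathcal R=\omega^r\cap(\omega^r)^{-1}$. An $E$-sequence of length $m\ge1$ from $e$ to $f$ is a sequence $e=x_0,x_1,\dots,x_m=f$ in $E$ with $x_{i-1}\,(\mathcal L\cup\mathcal R)\,x_i$ for each $i$; $d_l(e,f)$ is the least length of an $E$-sequence from $e$ to $f$ with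 $x_0\,\mathcal L\,x_1$ (and $d_l(e,f)=0$ if no such sequence exists). *)

(* Defs.v *)
From mathcomp Require Import all_boot all_order all_algebra.
Set Implicit Arguments. Unset Strict Implicit. Unset Printing Implicit Defensive.
Import GRing.Theory.

Definition idem (T : Type) (mul : T -> T -> T) := {x : T | mul x x = x}.

Section Bio.
Variables (T : Type) (mul : T -> T -> T).
Local Notation E := (idem mul).
Local Notation v := (@proj1_sig T _).

Definition wlT (x y : T) := mul x y = x.
Definition wrT (x y : T) := mul y x = x.

(* the basic product e f is defined iff {ef, fe} meets {e, f} *)
Definition bdef (e f : E) :=
  mul (v e) (v f) = v e \/ mul (v e) (v f) = v f \/
  mul (v f) (v e) = v e \/ mul (v f) (v e) = v f.

Definition bwl (e f : E) := wlT (v e) (v f).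
Definition bwr (e f : E) := wrT (v e) (v f).
Definition bw (e f : E) := bwl e f /\ bwr e f.

Definition bM (e f g : E) := bwl g e /\ bwr g f.
Definition bpreceq (e f g h : E) :=
  wrT (mul (v e) (v g)) (mul (v e) (v h)) /\ wlT (mul (v g) (v f)) (mul (v h) (v f)).
Definition bS (e f h : E) := bM e f h /\ forall g, bM e f g -> bpreceq e f g h.

Definition bL (e f : E) := bwl e f /\ bwl f e.
Definition bR (e f : E) := bwr e f /\ bwr f e.

Definition lseq (e f : E) (m : nat) :=
  1 <= m /\ exists x : nat -> E,
    [/\ x 0 = e, x m = f, bL (x 0) (x 1) &
        forall i, i < m -> bL (x i) (x i.+1) \/ bR (x i) (x i.+1)].

Definition dl_is (e f : E) (d : nat) :=
  (d = 0 /\ forall m, ~ lseq e f m) \/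
  (lseq e f d /\ forall m, lseq e f m -> d <= m).
End Bio.

Definition biset_iso (T1 : Type) (m1 : T1 -> T1 -> T1) (T2 : Type) (m2 : T2 -> T2 -> T2)
  (th : idem m1 -> idem m2) :=
  bijective th /\
  forall a b, (bdef a b <-> bdef (th a) (th b)) /\
    (bdef a b -> forall c, proj1_sig c = m1 (proj1_sig a) (proj1_sig b) ->
       proj1_sig (th c) = m2 (proj1_sig (th a)) (proj1_sig (th b))).

Definition regular_semigroup (S : Type) (mul : S -> S -> S) :=
  associative mul /\ forall x, exists y, mul (mul x y) x = x.

Definition regular_ring (R : nzRingType) := forall x : R, exists y, (x * y * x = x)%R.

(* Main.v *)
(** The classes of [E] modulo [L] form a complemented modular lattice, and [e]
   corresponds to the complementary pair formed by the classes of [e] and of [e'].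
   The idempotents of (E4) give a homogeneous frame of this lattice, whose order [n]
   is at least 4, so von Neumann's coordinatization applies: the lattice is that of
   the finitely generated submodules of [R^n] for a regular ring [R].  Complementary
   pairs of such submodules are exactly the idempotent matrices.  Both [omega^l] and
   [omega^r] can be read off the pairs, and they determine the basic products.

   For the coordinatization, morphisms between members of the frame are encoded as
   lattice elements, their graphs.  The ring is made of the coherent families of
   morphisms from the last member [a] to the other members [b_j], and [x + q s] is the
   sum of a morphism and of a composite, computed through a third member.  Members are
   then removed one at a time: an element below [b_0 + ... + b_k] is the join of its
   part below [b_0 + ... + b_(k-1)] and of the graph of a row vector restricted to its
   projection on [b_k]. *)
Require Import Defs.
From mathcomp Require Import all_boot all_order all_algebra.
From HB Require Import structures.
From mathcomp Require Import boolp.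
Set Implicit Arguments. Unset Strict Implicit. Unset Printing Implicit Defensive.
Import GRing.Theory.

(** * Morphisms as graphs in a complemented modular lattice *)

(** Products are computed in the ambient regular semigroup, also where they are not basic; there
    [zero] is known to absorb idempotents only. Two facts carry the construction of the lattice: by
    (E2)(iii), [f] lies below [e'] for [omega^l] exactly when [f e = 0], and by (E3), [e] commutes
    with [g'] whenever [g] lies below [e] for [omega]. Meets, joins and modular cancellation are
    then explicit products. An E-sequence of minimal length 3 starting with an L-step must alternate
    L, R, L. Its middle R-step becomes an L-step under the prime map, and this yields a common
    complement of two frame members, hence the perspectivities. Order 4 is needed because
    associativity, distributivity and the exchange of summands all compare morphisms between four
    independent elements. All axes between the [b j] factor through [a], so they are coherent by
    construction and no normalization of the frame is required. The lattice of submodules is never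
    built: lattice elements are matched with predicates on rows, and both sides are analysed by the
    same elimination of the last coordinate. *)

Record modLattice := ModLattice {
  carrier :> choiceType;
  lle : rel carrier;
  lmeet : carrier -> carrier -> carrier;
  ljoin : carrier -> carrier -> carrier;
  lbot : carrier;
  ltop : carrier;
  lle_refl : reflexive lle;
  lle_anti : forall x y, lle x y -> lle y x -> x = y;
  lle_trans : forall x y z, lle x y -> lle y z -> lle x z;
  lmeetP : forall x y z, lle z (lmeet x y) = lle z x && lle z y;
  ljoinP : forall x y z, lle (ljoin x y) z = lle x z && lle y z;
  lbotP : forall x, lle lbot x;
  ltopP : forall x, lle x ltop;
  lmod : forall x y z, lle x z -> lle (lmeet (ljoin x y) z) (ljoin x (lmeet y z));
  lcompl : forall x, exists y, lmeet x y = lbot /\ ljoin x y = ltop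
}.

Declare Scope lat_scope.
Delimit Scope lat_scope with L.
Notation "x <= y" := (lle x y) : lat_scope.
Notation "x `&` y" := (lmeet x y) : lat_scope.
Notation "x `|` y" := (ljoin x y) : lat_scope.
Notation bot := (lbot _).
Notation top := (ltop _).

Local Open Scope lat_scope.

Section LatTac.
Variable L : modLattice.
Implicit Types x y z : L.
Lemma lat_leU x y z : x <= z -> y <= z -> x `|` y <= z.
Proof. by rewrite ljoinP => -> ->. Qed.
Lemma lat_leI x y z : z <= x -> z <= y -> z <= x `&` y.
Proof. by rewrite lmeetP => -> ->. Qed.
Lemma lat_Ul x y z : x <= y -> x <= y `|` z.
Proof. by move/lle_trans; apply; have := lle_refl (y `|` z); rewrite ljoinP => /andP[]. Qed.
Lemma lat_Ur x y z : x <= z -> x <= y `|` z.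
Proof. by move/lle_trans; apply; have := lle_refl (y `|` z); rewrite ljoinP => /andP[]. Qed.
Lemma lat_Il x y z : y <= x -> y `&` z <= x.
Proof. by apply: lle_trans; have := lle_refl (y `&` z); rewrite lmeetP => /andP[]. Qed.
Lemma lat_Ir x y z : z <= x -> y `&` z <= x.
Proof. by apply: lle_trans; have := lle_refl (y `&` z); rewrite lmeetP => /andP[]. Qed.
End LatTac.

(** Backward search with the universal properties of meets and joins; [n] bounds the hypotheses
    chained by transitivity. Modularity is never tried, so modular steps are made explicitly, mostly
    through [le_mod] and [le_mod0]. *)
Ltac lat_rec n :=
  lazymatch goal with
  | |- is_true ((_ `|` _) <= _) => refine (lat_leU _ _); lat_rec n
  | |- is_true (_ <= (_ `&` _)) => refine (lat_leI _ _); lat_rec n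
  | |- is_true (bot <= _) => exact (lbotP _)
  | |- is_true (_ <= top) => exact (ltopP _)
  | |- is_true (?x <= ?y) => first
     [ constr_eq x y; exact (lle_refl x)
     | match goal with H : is_true (x <= y) |- _ => exact H end
     | lazymatch y with _ `|` _ => first
         [ refine (lat_Ul _ _); lat_rec n | refine (lat_Ur _ _); lat_rec n ] end
     | lazymatch x with _ `&` _ => first
         [ refine (lat_Il _ _); lat_rec n | refine (lat_Ir _ _); lat_rec n ] end
     | match n with S ?n' => match goal with
        H : is_true (x <= _) |- _ => refine (lle_trans H _); lat_rec n' end
       end
     | lazymatch y with bot => match n with S ?n' => match goal with
        H : is_true (_ `&` _ <= bot) |- _ => refine (lle_trans _ H); lat_rec n' end
       end end ]
  end.
Ltac lat := solve [lat_rec 0%nat | lat_rec 1%nat | lat_rec 2%nat].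
Local Close Scope lat_scope.

(** * Modularity, independence and graphs *)

Section Lat.
Local Open Scope lat_scope.
Variable L : modLattice.
Implicit Types (x y z w a b c : L) (s t : seq L).

Lemma ljoinC x y : x `|` y = y `|` x. Proof. by apply: lle_anti; lat. Qed.
Lemma lmeetC x y : x `&` y = y `&` x. Proof. by apply: lle_anti; lat. Qed.

Fixpoint joins s : L := if s is x :: s' then x `|` joins s' else bot.

Lemma joins_cat s t : joins (s ++ t) = joins s `|` joins t.
Proof. by elim: s => [|x s IH] /=; [|rewrite IH]; apply: lle_anti; lat. Qed.

Lemma joins_le s x : reflect {in s, forall y, y <= x} (joins s <= x).
Proof.
apply: (iffP idP) => [|h].
  elim: s => //= z s IH; rewrite ljoinP => /andP[hz /IH h] y.
  by rewrite inE => /predU1P[->|/h].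
elim: s h => [|z s IH] h /=; first by lat.
by rewrite ljoinP h ?mem_head // IH // => y hy; apply: h; rewrite inE hy orbT.
Qed.

Lemma le_joins s x : x \in s -> x <= joins s.
Proof. by move/joins_le: (lle_refl (joins s)) => h /h. Qed.

Lemma joins_perm s t : s =i t -> joins s = joins t.
Proof.
by move=> h; apply: lle_anti; apply/joins_le => y; [rewrite h|rewrite -h]; apply: le_joins.
Qed.

Lemma le_mod x y z w : w <= x `|` y -> w <= z -> x <= z -> w <= x `|` (y `&` z).
Proof. by move=> h1 h2 h3; apply: lle_trans (lmod y h3); lat. Qed.

(** Deletes the summand [y] from a bound on [w]: below [z], modularity cuts [y] down to its meet
    with [z], which vanishes. *)
Lemma le_mod0 x y z w : w <= x `|` y -> w <= z -> x <= z -> y `&` z <= bot -> w <= x.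
Proof.
move=> h1 h2 h3 h4; apply: lle_trans (le_mod h1 h2 h3) _.
by have h := lle_trans h4 (lbotP x); lat.
Qed.

Lemma rel_compl x z : x <= z -> exists y, [/\ x `&` y <= bot, y <= z & z <= x `|` y].
Proof.
move=> xz; have [y [h1 h2]] := lcompl x; exists (y `&` z); split; last 1 first.
- by apply: le_mod; rewrite ?h2; lat.
- by rewrite -h1; lat.
- by lat.
Qed.

Fixpoint indep s : bool :=
  if s is x :: s' then (x `&` joins s' <= bot) && indep s' else true.

Definition jmask (m : bitseq) s := joins (mask m s).

Lemma jmask_le m s : jmask m s <= joins s.
Proof. by apply/joins_le => y /mem_mask; apply: le_joins. Qed.

(** Independent elements behave like a basis: two partial joins meet in the join over the common
    indices. A head present in only one of the joins is discarded by [side]. *)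
Lemma jmask_meet m1 m2 s : indep s ->
  jmask m1 s `&` jmask m2 s <= jmask [seq p.1 && p.2 | p <- zip m1 m2] s.
Proof.
have side x A B J : x `&` J <= bot -> A <= J -> B <= J -> (x `|` A) `&` B <= A `&` B.
  move=> h hA hB; apply: lat_leI; last by lat.
  by apply: (@le_mod0 _ x J) => //; lat.
elim: s m1 m2 => [|x s IH] [|b1 m1] [|b2 m2] //=; rewrite /jmask /=; try (by move=> _; lat).
case/andP=> hx /IH{}IH; have J1 := jmask_le m1 s; have J2 := jmask_le m2 s.
have h := IH m1 m2; have h1 := side _ _ _ _ hx J1 J2; have h2 := side _ _ _ _ hx J2 J1.
rewrite /jmask in h J1 J2 h1 h2; case: b1; case: b2 => //=.
- have h3 : joins (mask m1 s) `&` (x `|` joins (mask m2 s)) <=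
      joins (mask m2 s) `&` joins (mask m1 s).
    by apply: lle_trans h2; lat.
  apply: lle_trans (@le_mod x (joins (mask m1 s)) (x `|` joins (mask m2 s)) _ _ _ _) _; try lat.
  apply: lat_leU; first by lat.
  by apply: lat_Ur; apply: lle_trans h; lat.
- by lat.
- by apply: lle_trans h; apply: lle_trans (lle_trans _ h2) _; lat.
Qed.

(* The graphs [{t - phi t | t in a}] of the morphisms [phi : a -> b], in the lattice of
   submodules of a module containing [a] and [b] independently. *)
Definition hom a b : pred L := [pred x | [&& x `&` b <= bot, x <= a `|` b & a <= x `|` b]].

Lemma homI a b x : x `&` b <= bot -> x <= a `|` b -> a <= x `|` b -> hom a b x.
Proof. by move=> h1 h2 h3; rewrite /hom /= h1 h2. Qed.
Lemma hom_le a b x : hom a b x -> x <= a `|` b.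
Proof. by case/and3P. Qed.
Lemma hom_src a b x : hom a b x -> a <= x `|` b.
Proof. by case/and3P. Qed.
Lemma hom_bot a b x : hom a b x -> x `&` b <= bot.
Proof. by case/and3P. Qed.

(** Both graphs are complements of [b] in the join of [a] and [b], and comparable complements
    coincide in a modular lattice. Most identities between morphisms thus reduce to one
    inequality. *)
Lemma hom_eq a b x y : hom a b x -> hom a b y -> x <= y -> x = y.
Proof.
move=> /and3P[hx1 hx2 hx3] /and3P[hy1 hy2 hy3] le; apply: lle_anti => //.
by apply: (@le_mod0 x b y y) => //; [lat|lat|apply: lle_trans hy1; lat].
Qed.

Lemma jmask_lex m1 m2 s w : indep s -> w <= jmask m1 s -> w <= jmask m2 s ->
  w <= jmask [seq p.1 && p.2 | p <- zip m1 m2] s.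
Proof. by move=> h h1 h2; apply: lle_trans (jmask_meet _ _ h); lat. Qed.

Lemma indep_swap x y s : indep [:: x, y & s] -> indep [:: y, x & s].
Proof.
rewrite /= => /and3P[hx hy ->]; rewrite andbT.
have xJ : x `&` joins s <= bot by apply: lle_trans hx; lat.
rewrite xJ andbT; apply: lle_trans hy; apply: lat_leI; first by lat.
by apply: (@le_mod0 _ x (y `|` joins s)); lat.
Qed.

Lemma indep_perm s t : perm_eq s t -> indep s -> indep t.
Proof.
have mid u x v : indep (x :: u ++ v) -> indep (u ++ x :: v).
  elim: u => //= y u IH h; move: (indep_swap h) => /= /andP[hy /IH ->]; rewrite andbT.
  rewrite (@joins_perm _ (x :: u ++ v)) // => z.
  by rewrite !(inE, mem_cat) orbCA.
elim: s t => [|x s IH] t; first by rewrite perm_sym => /perm_nilP->.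
move=> hp; have /splitPr ht: x \in t by rewrite -(perm_mem hp) mem_head.
case: ht hp => t1 t2; rewrite perm_sym perm_catC /= perm_cons perm_catC perm_sym => hp.
move=> /= /andP[h /(IH _ hp) h']; apply: mid; rewrite /= h' -(joins_perm (perm_mem hp)).
by rewrite h.
Qed.

Lemma indep_swap2 x y z s : indep [:: x, y, z & s] -> indep [:: x, z, y & s].
Proof. by apply: indep_perm; rewrite perm_cons; apply/permPl/(perm_catCA [:: y] [:: z]). Qed.

Lemma indep_catl s t : indep (s ++ t) -> indep s.
Proof.
elim: s => //= x s IH /andP[h /IH ->]; rewrite andbT; apply: lle_trans h.
by rewrite joins_cat; lat.
Qed.

Lemma indep_group s t : indep (s ++ t) -> indep (s ++ [:: joins t]).
Proof.
elim: s => [|x s IH] /=; first by move=> _; rewrite andbT; lat.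
move=> /andP[h /IH ->]; rewrite andbT; apply: lle_trans h.
by rewrite !joins_cat /=; lat.
Qed.

End Lat.

(* Meets of joins of members of an independent sequence, selected by bit masks. *)
Ltac indm H m1 m2 :=
  refine (lle_trans (jmask_lex (m1:=m1) (m2:=m2) H _ _) _); rewrite /jmask /=; lat.

Section Hom.
Local Open Scope lat_scope.
Local Notation T := true.
Local Notation F := false.
Variable L : modLattice.
Implicit Types (x y z w a b c p q r s e : L).

(* The graph of the composite of the morphisms [a -> b -> c] with graphs [x] and [y]. *)
Definition hcomp a c x y := (x `|` y) `&` (a `|` c).
(* The graph of the morphism from [a] to the direct sum of [b] and [c] with components
   [x] and [y]. *)
Definition hpair b c x y := (x `|` c) `&` (y `|` b).

Lemma comp_hom a b c x y : indep [:: a; b; c] -> hom a b x -> hom b c y ->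
  hom a c (hcomp a c x y).
Proof.
move=> I hx hy; rewrite /hcomp.
have xl := hom_le hx; have xs := hom_src hx; have xb := hom_bot hx.
have yl := hom_le hy; have ys := hom_src hy; have yb := hom_bot hy.
apply: homI; [|lat|].
  apply: lle_trans yb; apply: lat_leI; last by lat.
  apply: (@le_mod0 _ _ x (b `|` c)); [lat|lat|lat|].
  apply: lle_trans xb; apply: lat_leI; [lat|].
  by indm I [:: T; T; F] [:: F; T; T].
apply: lle_trans (@le_mod _ c (x `|` y) (a `|` c) a _ _ _) _; lat.
Qed.

Lemma comp_assoc a b c e x y z : indep [:: a; b; c; e] ->
  hom a b x -> hom b c y -> hom c e z ->
  hcomp a e (hcomp a c x y) z = hcomp a e x (hcomp b e y z).
Proof.
move=> I hx hy hz; rewrite /hcomp.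
have xl := hom_le hx; have yl := hom_le hy; have zl := hom_le hz.
(* Both bracketings are the part over [a] and [e] of the join of the three graphs. *)
transitivity ((x `|` y `|` z) `&` (a `|` e)); apply: lle_anti;
  [lat| | |lat]; apply: lat_leI; try lat.
  apply: lle_trans (@le_mod _ z (x `|` y) (a `|` c `|` e) _ _ _ _) _; [lat|lat|lat|].
  apply: lat_leU; [lat|]; apply: lat_Ul; apply: lat_leI; [lat|].
  by indm I [:: T; T; T; F] [:: T; F; T; T].
apply: lle_trans (@le_mod _ x (y `|` z) (a `|` b `|` e) _ _ _ _) _; [lat|lat|lat|].
apply: lat_leU; [lat|]; apply: lat_Ur; apply: lat_leI; [lat|].
by indm I [:: F; T; T; T] [:: T; T; F; T].
Qed.

Lemma pair_hom a b c x y : indep [:: a; b; c] -> hom a b x -> hom a c y ->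
  hom a (b `|` c) (hpair b c x y).
Proof.
move=> I hx hy; rewrite /hpair.
have xl := hom_le hx; have xs := hom_src hx; have xb := hom_bot hx.
have yl := hom_le hy; have ys := hom_src hy; have yb := hom_bot hy.
apply: homI; [|lat|].
  have h1 : (x `|` c) `&` (y `|` b) `&` (b `|` c) <= c.
    apply: (@le_mod0 _ _ x (b `|` c)); [lat|lat|lat|].
    by apply: lle_trans xb; apply: lat_leI; [lat|]; indm I [:: T; T; F] [:: F; T; T].
  have h2 : (x `|` c) `&` (y `|` b) `&` (b `|` c) <= b.
    apply: (@le_mod0 _ _ y (b `|` c)); [lat|lat|lat|].
    by apply: lle_trans yb; apply: lat_leI; [lat|]; indm I [:: T; F; T] [:: F; T; T].
  by indm I [:: F; T; F] [:: F; F; T].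
have h : y <= b `|` ((x `|` c) `&` (y `|` b)) by apply: le_mod; lat.
by lat.
Qed.

Lemma pair_eq a b c x y z : indep [:: a; b; c] -> hom a b x -> hom a c y ->
  hom a (b `|` c) z -> z <= x `|` c -> z <= y `|` b -> z = hpair b c x y.
Proof.
by move=> I hx hy hz h1 h2; apply: (hom_eq hz (pair_hom I hx hy)); rewrite /hpair; lat.
Qed.

Lemma pair_projl a b c z : indep [:: a; b; c] -> hom a (b `|` c) z ->
  hom a b ((z `|` c) `&` (a `|` b)) /\ z <= (z `|` c) `&` (a `|` b) `|` c.
Proof.
move=> I hz.
have zl := hom_le hz; have zs := hom_src hz; have zb := hom_bot hz.
split.
  apply: homI; [|lat|].
    have h1 : (z `|` c) `&` (a `|` b) `&` b <= c.
      apply: (@le_mod0 _ _ z (b `|` c)); [lat|lat|lat|].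
      by apply: lle_trans zb; lat.
    by indm I [:: F; T; F] [:: F; F; T].
  apply: lle_trans (@le_mod _ b (z `|` c) (a `|` b) _ _ _ _) _; lat.
apply: lle_trans (@le_mod _ c (a `|` b) (z `|` c) _ _ _ _) _; lat.
Qed.

Lemma pair_projr a b c z : indep [:: a; b; c] -> hom a (b `|` c) z ->
  hom a c ((z `|` b) `&` (a `|` c)) /\ z <= (z `|` b) `&` (a `|` c) `|` b.
Proof.
move=> I; rewrite [b `|` c]ljoinC; apply: pair_projl.
exact: indep_swap2 I.
Qed.

Lemma pairP a b c z : indep [:: a; b; c] -> hom a (b `|` c) z ->
  z = hpair b c ((z `|` c) `&` (a `|` b)) ((z `|` b) `&` (a `|` c)).
Proof.
move=> I hz; have [h1 h2] := pair_projl I hz; have [h3 h4] := pair_projr I hz.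
exact: pair_eq hz h2 h4.
Qed.

Lemma pair_fst a b c x y : indep [:: a; b; c] -> hom a b x -> hom a c y ->
  (hpair b c x y `|` c) `&` (a `|` b) = x.
Proof.
move=> I hx hy; have [h1 _] := pair_projl I (pair_hom I hx hy).
have xl := hom_le hx; have xs := hom_src hx.
have yl := hom_le hy; have ys := hom_src hy.
apply/esym/(hom_eq hx h1); apply: lat_leI; [|lat]; rewrite /hpair.
apply: lle_trans (@le_mod _ c (y `|` b) (x `|` c) _ _ _ _) _; lat.
Qed.

Lemma pair_snd a b c x y : indep [:: a; b; c] -> hom a b x -> hom a c y ->
  (hpair b c x y `|` b) `&` (a `|` c) = y.
Proof.
move=> I hx hy; have [h1 _] := pair_projr I (pair_hom I hx hy).
have xl := hom_le hx; have xs := hom_src hx.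
have yl := hom_le hy; have ys := hom_src hy.
apply/esym/(hom_eq hy h1); apply: lat_leI; [|lat]; rewrite /hpair.
apply: lle_trans (@le_mod _ b (x `|` c) (y `|` b) _ _ _ _) _; lat.
Qed.

Lemma hom0 a b : a `&` b <= bot -> hom a b a.
Proof. by move=> h; apply: homI; lat. Qed.

(* [p] is a perspectivity axis: an isomorphism from [a] to [b] whose inverse is again [p]. *)
Lemma comp_cancell a b c p y : indep [:: a; b; c] -> hom a b p -> hom b a p -> hom b c y ->
  hcomp b c p (hcomp a c p y) = y.
Proof.
move=> I p1 p2 hy.
have I' := indep_swap I.
have h1 := comp_hom I p1 hy.
apply/esym/(hom_eq hy (comp_hom I' p2 h1)).
have yl := hom_le hy; have ps := hom_src p2; have pl := hom_le p2.
apply: lat_leI; [|lat]; rewrite /hcomp.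
apply: lle_trans (@le_mod _ p (a `|` c) (p `|` y) _ _ _ _) _; lat.
Qed.

Lemma comp_cancelr a b c p x : indep [:: a; b; c] -> hom b c p -> hom c b p -> hom a b x ->
  hcomp a b (hcomp a c x p) p = x.
Proof.
move=> I p1 p2 hx.
have I' := indep_swap2 I.
have h1 := comp_hom I hx p1.
apply/esym/(hom_eq hx (comp_hom I' h1 p2)).
have xl := hom_le hx; have ps := hom_src p1; have pl := hom_le p2.
apply: lat_leI; [|lat]; rewrite /hcomp.
apply: lle_trans (@le_mod _ p (a `|` c) (x `|` p) _ _ _ _) _; lat.
Qed.
End Hom.

(** * The ternary operation [x + q s] *)

Section Tern.
Local Open Scope lat_scope.
Local Notation T := true.
Local Notation F := false.
Variable L : modLattice.
Implicit Types (a k j l w x y z p q r s t u v : L).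

(* The graph of [x + s o q] for [q : a -> k], [s : k -> j] and [x : a -> j]: the image of
   [q + x : a -> k + j] under the shear along [s]. *)
Definition tern a k j q x s := (hpair k j q x `|` s) `&` (a `|` j).

Lemma le_comp a b c x y : x <= a `|` b -> b <= y `|` c -> x <= y `|` hcomp a c x y.
Proof.
move=> h1 h2; rewrite /hcomp.
by apply: lle_trans (@le_mod _ y (a `|` c) (x `|` y) _ _ _ _) _; lat.
Qed.

Lemma tern_hom a k j q x s : indep [:: a; k; j] -> hom a k q -> hom a j x ->
  hom k j s -> hom a j (tern a k j q x s).
Proof.
move=> I hq hx hs; have hp := pair_hom I hq hx; rewrite /tern.
have ps := hom_src hp; have pb := hom_bot hp.
have sl := hom_le hs; have ss := hom_src hs; have sb := hom_bot hs.
apply: homI; [|lat|].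
  apply: lle_trans sb; apply: lat_leI; last by lat.
  by apply: (@le_mod0 _ _ (hpair k j q x) (k `|` j)); lat.
by apply: lle_trans (@le_mod _ j (hpair k j q x `|` s) (a `|` j) _ _ _ _) _; lat.
Qed.

(** Composition with [p] distributes over the sum. This serves both for the law [fmulDl] and for
    changing the target of a sum. *)
Lemma tern_comp a k j l q x s p : indep [:: a; k; j; l] ->
  hom a k q -> hom a j x -> hom k j s -> hom j l p ->
  hcomp a l (tern a k j q x s) p = tern a k l q (hcomp a l x p) (hcomp k l s p).
Proof.
move=> I hq hx hs hp.
have Iakj : indep [:: a; k; j] := indep_catl (s := [:: a; k; j]) I.
have Ikjl : indep [:: k; j; l] by case/andP: I.
have Iajl : indep [:: a; j; l] by have := indep_swap I => /andP[].
have Iakl : indep [:: a; k; l].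
  by apply: (indep_catl (s := [:: a; k; l]) (t := [:: j])); apply: indep_perm I; rewrite !perm_cons;
     apply/permPl/(perm_catC [:: j] [:: l]).
have hxp := comp_hom Iajl hx hp; have hsp := comp_hom Ikjl hs hp.
have ht := tern_hom Iakj hq hx hs.
have ht' := tern_hom Iakl hq hxp hsp.
apply: (hom_eq (comp_hom Iajl ht hp) ht' _).
have ql := hom_le hq; have xl := hom_le hx; have sl := hom_le hs; have pl := hom_le hp.
have ps := hom_src hp; have pb := hom_bot hp.
have x1 := le_comp xl ps; have s1 := le_comp sl ps.
have pH : p `&` (a `|` k `|` l) <= bot.
  by apply: lle_trans pb; apply: lat_leI; [lat|]; indm I [:: F; F; T; T] [:: T; T; F; T].
have jH : j `&` (a `|` k `|` l) <= bot by indm I [:: F; F; T; F] [:: T; T; F; T].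
(* Projecting along [p] carries the pair into [k] and [j] to the pair into [k] and [l]. *)
have pp : hpair k j q x <= p `|` hpair k l q (hcomp a l x p).
  apply: lle_trans (@le_mod _ p (a `|` k `|` l) (hpair k j q x `|` p) _ _ _ _) _; [|lat|lat|].
    by have := hom_le (pair_hom Iakj hq hx) => ?; lat.
  apply: lat_leU; first by lat.
  apply: lat_Ur; rewrite /hpair; apply: lat_leI.
    by apply: (@le_mod0 _ _ j (a `|` k `|` l)); lat.
  have hc : hcomp a l x p <= a `|` l by rewrite /hcomp; lat.
  by apply: (@le_mod0 _ _ p (a `|` k `|` l)); lat.
rewrite {1}/hcomp /tern; apply: lat_leI; last by lat.
apply: (@le_mod0 _ _ p (a `|` k `|` l)) => //; [lat|lat|].
by rewrite /hpair /hcomp; lat.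
Qed.

(** A factor [p] can be moved from the shear to its argument; this makes sums independent of the
    auxiliary member [k]. *)
Lemma tern_pre a k j l q x s p : indep [:: a; k; j; l] ->
  hom a k q -> hom a j x -> hom l j s -> hom k l p ->
  tern a k j q x (hcomp k j p s) = tern a l j (hcomp a l q p) x s.
Proof.
move=> I hq hx hs hp.
have Iakj : indep [:: a; k; j] := indep_catl (s := [:: a; k; j]) I.
have Ikjl : indep [:: k; j; l] by case/andP: I.
have Iklj := indep_swap2 Ikjl.
have Iajl : indep [:: a; j; l] by have := indep_swap I => /andP[].
have Ialj := indep_swap2 Iajl.
have Iakl : indep [:: a; k; l].
  by apply: (indep_catl (s := [:: a; k; l]) (t := [:: j])); apply: indep_perm I; rewrite !perm_cons;
     apply/permPl/(perm_catC [:: j] [:: l]).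
have hqp := comp_hom Iakl hq hp; have hps := comp_hom Iklj hp hs.
apply: (hom_eq (tern_hom Iakj hq hx hps) (tern_hom Ialj hqp hx hs) _).
have ql := hom_le hq; have xl := hom_le hx; have sl := hom_le hs; have pl := hom_le hp.
have ps := hom_src hp; have pb := hom_bot hp.
have q1 := le_comp ql ps.
have pH : p `&` (a `|` j `|` l) <= bot.
  by apply: lle_trans pb; apply: lat_leI; [lat|]; indm I [:: F; T; F; T] [:: T; F; T; T].
have kH : k `&` (a `|` j `|` l) <= bot by indm I [:: F; T; F; F] [:: T; F; T; T].
have pp : hpair k j q x <= p `|` hpair l j (hcomp a l q p) x.
  apply: lle_trans (@le_mod _ p (a `|` j `|` l) (hpair k j q x `|` p) _ _ _ _) _; [|lat|lat|].
    by have := hom_le (pair_hom Iakj hq hx) => ?; lat.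
  apply: lat_leU; first by lat.
  apply: lat_Ur; rewrite /hpair; apply: lat_leI.
    have hc : hcomp a l q p <= a `|` l by rewrite /hcomp; lat.
    by apply: (@le_mod0 _ _ p (a `|` j `|` l)); lat.
  by apply: (@le_mod0 _ _ k (a `|` j `|` l)); lat.
rewrite {1}/hcomp /tern; apply: lat_leI; last by lat.
apply: (@le_mod0 _ _ p (a `|` j `|` l)) => //; [lat|lat|].
by rewrite /hpair /hcomp; lat.
Qed.

Lemma comp_tern a k j l z q x s : indep [:: a; k; j; l] ->
  hom a l z -> hom l k q -> hom l j x -> hom k j s ->
  hcomp a j z (tern l k j q x s) = tern a k j (hcomp a k z q) (hcomp a j z x) s.
Proof.
move=> I hz hq hx hs.
have Iakj : indep [:: a; k; j] := indep_catl (s := [:: a; k; j]) I.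
have Ikjl : indep [:: k; j; l] by case/andP: I.
have Ilkj : indep [:: l; k; j].
  by apply: indep_perm Ikjl; apply/permPl/(perm_catC [:: k; j] [:: l]).
have Iajl : indep [:: a; j; l] by have := indep_swap I => /andP[].
have Ialj := indep_swap2 Iajl.
have Ialk : indep [:: a; l; k].
  apply: (indep_catl (s := [:: a; l; k]) (t := [:: j])); apply: indep_perm I; rewrite perm_cons.
  by apply/permPl/(perm_catC [:: k; j] [:: l]).
have hzq := comp_hom Ialk hz hq; have hzx := comp_hom Ialj hz hx.
have ht := tern_hom Ilkj hq hx hs.
apply: (hom_eq (comp_hom Ialj hz ht) (tern_hom Iakj hzq hzx hs) _).
have zl := hom_le hz; have ql := hom_le hq; have xl := hom_le hx; have sl := hom_le hs.
have qs := hom_src hq; have qb := hom_bot hq; have xs := hom_src hx; have xb := hom_bot hx.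
have hP := pair_hom Ilkj hq hx.
have Pl := hom_le hP; have Ps := hom_src hP; have Pb := hom_bot hP.
have z1 := le_comp zl Ps; have z2 := le_comp zl qs; have z3 := le_comp zl xs.
have PH : hpair k j q x `&` (a `|` k `|` j) <= bot.
  by apply: lle_trans Pb; apply: lat_leI; [lat|]; indm I [:: F; T; T; T] [:: T; T; T; F].
have qH : q `&` (a `|` k `|` j) <= bot.
  by apply: lle_trans qb; apply: lat_leI; [lat|]; indm I [:: F; T; F; T] [:: T; T; T; F].
have xH : x `&` (a `|` k `|` j) <= bot.
  by apply: lle_trans xb; apply: lat_leI; [lat|]; indm I [:: F; F; T; T] [:: T; T; T; F].
have c1 : hcomp a k z q <= a `|` k by rewrite /hcomp; lat.
have c2 : hcomp a j z x <= a `|` j by rewrite /hcomp; lat.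
have pp : hcomp a (k `|` j) z (hpair k j q x) <= hpair k j (hcomp a k z q) (hcomp a j z x).
  rewrite /hcomp; apply: lat_leI.
    by apply: (@le_mod0 _ _ q (a `|` k `|` j)); rewrite -/(hcomp a k z q); rewrite /hpair; lat.
  by apply: (@le_mod0 _ _ x (a `|` k `|` j)); rewrite -/(hcomp a j z x); rewrite /hpair; lat.
rewrite {1}/hcomp {1 2}/tern; apply: lat_leI; last by lat.
have c3 : hcomp a (k `|` j) z (hpair k j q x) <= a `|` k `|` j by rewrite /hcomp; lat.
apply: lle_trans (_ : hcomp a (k `|` j) z (hpair k j q x) `|` s <= _); last by lat.
by apply: (@le_mod0 _ _ (hpair k j q x) (a `|` k `|` j)); lat.
Qed.

Lemma tern_0l a k j q s : indep [:: a; k; j] -> hom a k q -> hom k j s ->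
  tern a k j q a s = hcomp a j q s.
Proof.
move=> I hq hs; have ha : hom a j a by apply: hom0; indm I [:: T; F; F] [:: F; F; T].
apply/esym; apply: (hom_eq (comp_hom I hq hs) (tern_hom I hq ha hs) _); have ql := hom_le hq.
by rewrite /tern /hpair /hcomp; lat.
Qed.

(** The shears along [s] and along [t] commute. With axes as [q] and [r], this is the source of
    commutativity and associativity of addition. *)
Lemma tern_exch a k l j q r x s t : indep [:: a; k; l; j] ->
  hom a k q -> hom a l r -> hom a j x -> hom k j s -> hom l j t ->
  tern a l j r (tern a k j q x s) t = tern a k j q (tern a l j r x t) s.
Proof.
move=> I hq hr hx hs ht.
have Ialj : indep [:: a; l; j] by have := indep_swap I => /andP[].
have Iakj : indep [:: a; k; j].
  by have /indep_swap/andP[] : indep [:: a; l; k; j] := indep_swap2 I.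
have Iaklj : indep [:: a; k; l `|` j].
  move: (@indep_group _ [:: a; k] [:: l; j] I) => /=.
  by have -> : l `|` (j `|` bot) = l `|` j by apply: lle_anti; lat.
have h1 := pair_hom Ialj hr hx; have h2 := pair_hom Iakj hq hx.
(* The triple with components [q], [r] and [x]: both sides are the part over [a] and [j] of its join
   with [s] and [t]. *)
have hQ := pair_hom Iaklj hq h1.
set Q := hpair _ _ _ _ in hQ.
have B1 : Q <= q `|` (l `|` j) by rewrite /Q /hpair; lat.
have B2 : Q <= hpair l j r x `|` k by rewrite /Q {1}/hpair; lat.
have ql := hom_le hq; have rl := hom_le hr; have xl := hom_le hx.
have sl := hom_le hs; have ss := hom_src hs; have sb := hom_bot hs.
have tl := hom_le ht; have ts := hom_src ht; have tb := hom_bot ht.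
have B3 : Q <= hpair k j q x `|` l.
  have B2' : Q <= x `|` k `|` l by apply: lle_trans B2 _; rewrite /hpair; lat.
  apply: lle_trans (@le_mod _ l (q `|` j) (x `|` k `|` l) _ _ _ _) _; [lat|lat|lat|].
  apply: lat_leU; first by lat.
  apply: lat_Ul; rewrite /hpair; apply: lat_leI; first by lat.
  apply: (@le_mod0 _ _ l (a `|` k `|` j)); [lat|lat|lat|].
  by indm I [:: F; F; T; F] [:: T; T; F; T].
have Qs := hom_src hQ; have Qb := hom_bot hQ.
have hu := tern_hom Iakj hq hx hs; have hv := tern_hom Ialj hr hx ht.
have e1 : (Q `|` s) `&` (a `|` l `|` j) = hpair l j r (tern a k j q x s).
  apply: (pair_eq Ialj hr hu).
  - apply: homI; [|lat|].
      apply: lle_trans sb; apply: lat_leI.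
        by apply: (@le_mod0 _ _ Q (k `|` (l `|` j))); lat.
      have h : (Q `|` s) `&` (a `|` l `|` j) `&` (l `|` j) <= s.
        by apply: (@le_mod0 _ _ Q (k `|` (l `|` j))); lat.
      by indm I [:: F; T; F; T] [:: F; F; T; T].
    by apply: lle_trans (@le_mod _ (l `|` j) (Q `|` s) (a `|` l `|` j) _ _ _ _) _; lat.
  - have B2' : Q <= r `|` j `|` k by apply: lle_trans B2 _; rewrite /hpair; lat.
    apply: (@le_mod0 _ _ k (a `|` l `|` j)); [lat|lat|lat|].
    by indm I [:: F; T; F; F] [:: T; F; T; T].
  - have B3' : Q `|` s <= l `|` (hpair k j q x `|` s) by lat.
    apply: lle_trans (@le_mod _ l (hpair k j q x `|` s) (a `|` l `|` j) _ _ _ _) _; [lat|lat|lat|].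
    apply: lat_leU; first by lat.
    apply: lat_Ul; rewrite /tern; apply: lat_leI; first by lat.
    have pl := hom_le h2.
    by indm I [:: T; T; F; T] [:: T; F; T; T].
have e2 : (Q `|` t) `&` (a `|` k `|` j) = hpair k j q (tern a l j r x t).
  apply: (pair_eq Iakj hq hv).
  - apply: homI; [|lat|].
      apply: lle_trans tb; apply: lat_leI.
        by apply: (@le_mod0 _ _ Q (k `|` (l `|` j))); lat.
      have h : (Q `|` t) `&` (a `|` k `|` j) `&` (k `|` j) <= t.
        by apply: (@le_mod0 _ _ Q (k `|` (l `|` j))); lat.
      by indm I [:: F; F; T; T] [:: F; T; F; T].
    by apply: lle_trans (@le_mod _ (k `|` j) (Q `|` t) (a `|` k `|` j) _ _ _ _) _; lat.
  - apply: (@le_mod0 _ _ l (a `|` k `|` j)); [lat|lat|lat|].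
    by indm I [:: F; F; T; F] [:: T; T; F; T].
  - have B3' : Q `|` t <= k `|` (hpair l j r x `|` t) by lat.
    apply: lle_trans (@le_mod _ k (hpair l j r x `|` t) (a `|` k `|` j) _ _ _ _) _; [lat|lat|lat|].
    apply: lat_leU; first by lat.
    apply: lat_Ul; rewrite /tern; apply: lat_leI; first by lat.
    have pl := hom_le h1.
    by indm I [:: T; F; T; T] [:: T; T; F; T].
have f1 := tern_hom Ialj hr hu ht; have f2 := tern_hom Iakj hq hv hs.
set X := (Q `|` s `|` t) `&` (a `|` j).
have hX : hom a j X.
  have f1s := hom_src f1.
  have le1 : tern a l j r (tern a k j q x s) t <= X by rewrite {1}/tern -e1 /X; lat.
  rewrite /X in le1 *; apply: homI; [|lat|lat].
  have h3 : (Q `|` s `|` t) `&` (a `|` j) `&` j <= s `|` t.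
    by apply: (@le_mod0 _ _ Q (k `|` (l `|` j))); lat.
  apply: lle_trans sb; apply: lat_leI; last by lat.
  apply: (@le_mod0 _ _ t (k `|` j)); [lat|lat|lat|].
  by apply: lle_trans tb; apply: lat_leI; [lat|]; indm I [:: F; F; T; T] [:: F; T; F; T].
transitivity X.
  by apply: (hom_eq f1 hX _); rewrite {1}/tern -e1 /X; lat.
by apply/esym; apply: (hom_eq f2 hX _); rewrite {1}/tern -e2 /X; lat.
Qed.

(** The zero morphism, with graph [a], is pulled back along the shear: [D] is the pair with first
    component [q] that the shear along [s] sends to zero, and [z] is its second component. *)
Lemma tern_opp a k j q s : indep [:: a; k; j] -> hom a k q -> hom k j s ->
  exists2 z, hom a j z & tern a k j q z s = a.
Proof.
move=> I hq hs; pose D := (a `|` s) `&` (q `|` j).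
have qs := hom_src hq; have qb := hom_bot hq; have ql := hom_le hq.
have ss := hom_src hs; have sb := hom_bot hs; have sl := hom_le hs.
have aD : a <= s `|` D.
  by apply: lle_trans (@le_mod _ s (q `|` j) (a `|` s) _ _ _ _) _; rewrite /D; lat.
have hD : hom a (k `|` j) D.
  apply: homI; [|rewrite /D; lat|lat].
  have h1 : D `&` (k `|` j) <= s.
    apply: (@le_mod0 _ _ a (k `|` j)); [rewrite /D; lat|lat|lat|].
    by indm I [:: T; F; F] [:: F; T; T].
  have h2 : D `&` (k `|` j) <= j.
    apply: (@le_mod0 _ _ q (k `|` j)); [rewrite /D; lat|lat|lat|].
    by apply: lle_trans qb; apply: lat_leI; [lat|]; indm I [:: T; T; F] [:: F; T; T].
  by apply: lle_trans sb; lat.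
have [hz Dz] := pair_projr I hD; exists ((D `|` k) `&` (a `|` j)) => //.
have e : D = hpair k j q ((D `|` k) `&` (a `|` j)).
  by apply: (pair_eq I hq hz hD) => //; rewrite /D; lat.
have ha : hom a j a by apply: hom0; indm I [:: T; F; F] [:: F; F; T].
by apply/esym; apply: (hom_eq ha (tern_hom I hq hz hs) _); rewrite /tern -e; lat.
Qed.
End Tern.


(** * The coordinate ring *)

Section Frame.
Local Open Scope lat_scope.
Local Notation T := true.
Local Notation F := false.
Variables (L : modLattice) (m : nat) (a : L) (b c : 'I_m -> L).
Implicit Types i j k l : 'I_m.
Hypothesis m_gt2 : (2 < m)%N.
Hypothesis Iabc : forall j k l, uniq [:: j; k; l] -> indep [:: a; b j; b k; b l].
Hypothesis cab : forall j, hom a (b j) (c j).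
Hypothesis cba : forall j, hom (b j) a (c j).
Hypothesis a_neq0 : a <> bot.

Lemma other j k : {l | uniq [:: j; k; l]} + (j = k).
Proof.
case: (eqVneq j k) => [->|ne]; [by right|left].
have : (0 < #|~: [set j; k]|)%N.
  rewrite cardsCs setCK card_ord subn_gt0; apply: leq_ltn_trans m_gt2.
  by rewrite cards2; case: (_ != _).
move=> h; have /sigW[l hl] : exists l, l \in ~: [set j; k] by case/card_gt0P: h => l; exists l.
exists l; move: hl; rewrite !inE negb_or => /andP[h1 h2].
by rewrite /= !inE negb_or ne eq_sym h1 eq_sym h2.
Qed.

(** Informative, because the definition of [ftern] takes its auxiliary index from it. *)
Lemma other1 j : {k | k != j}.
Proof.
have h1 : (1 < m)%N by apply: ltn_trans m_gt2.
have h0 : (0 < m)%N by apply: ltn_trans h1.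
case: (eqVneq j (Ordinal h0)) => [->|ne]; first by exists (Ordinal h1).
by exists (Ordinal h0); rewrite eq_sym.
Qed.

Lemma other2 j k : k != j -> {l | uniq [:: k; j; l]}.
Proof. by move=> ne; case: (other k j) => // e; rewrite e eqxx in ne. Qed.

Lemma Iab j k : k != j -> indep [:: a; b k; b j].
Proof. by case/other2 => l /Iabc; apply: (indep_catl (s := [:: a; b k; b j])). Qed.

(** The axis between [b j] and [b k] passes through [a]; composites of axes therefore agree with
    axes, which [comp_tr] makes precise. *)
Definition ax j k := hcomp (b j) (b k) (c j) (c k).
(* Precomposes [s : a -> b j] with the axis [c k : b k -> a]. *)
Definition sg k j s := hcomp (b k) (b j) (c k) s.

Lemma Ibab j k : k != j -> indep [:: b k; a; b j].
Proof. by move=> /Iab/indep_swap. Qed.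

Lemma sg_hom k j s : k != j -> hom a (b j) s -> hom (b k) (b j) (sg k j s).
Proof. by move=> ne hs; apply: comp_hom (Ibab ne) (cba k) hs. Qed.

Lemma ax_hom j k : j != k -> hom (b j) (b k) (ax j k).
Proof. by move=> ne; apply: sg_hom. Qed.

Lemma ax_sym j k : ax j k = ax k j.
Proof. by rewrite /ax /hcomp; apply: lle_anti; lat. Qed.

Lemma comp_csg k j s : k != j -> hom a (b j) s -> hcomp a (b j) (c k) (sg k j s) = s.
Proof. by move=> ne hs; apply: comp_cancell (Ibab ne) (cba k) (cab k) hs. Qed.

Lemma sg_comp k j l s : uniq [:: k; j; l] -> hom a (b j) s ->
  hcomp (b k) (b l) (sg k j s) (ax j l) = sg k l (hcomp a (b l) s (ax j l)).
Proof.
move=> u hs; have I := indep_swap (Iabc u).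
apply: (comp_assoc I (cba k) hs); apply: ax_hom.
by move: u; rewrite /= !inE; case: (j =P l) => //; rewrite andbF.
Qed.

Lemma uniq3 j k l : uniq [:: j; k; l] = [&& j != k, j != l & k != l].
Proof. by rewrite /= !inE negb_or andbT -andbA. Qed.

(** The arrival of [ax l k] from [a] cancels against the return to [a] inside [sg k j]. *)
Lemma comp_ax_sg l k j s : uniq [:: l; k; j] -> hom a (b j) s ->
  hcomp (b l) (b j) (ax l k) (sg k j s) = sg l j s.
Proof.
move=> u; rewrite uniq3 in u; case/and3P: (u) => n1 n2 n3 hs.
have I : indep [:: b l; a; b k; b j] by apply: indep_swap; apply: Iabc; rewrite uniq3.
by rewrite /ax (comp_assoc I (cba l) (cab k) (sg_hom n3 hs)) comp_csg.
Qed.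

(* A ring element is the family of all its versions [a -> b j], matched by the axes [ax j k].
   Products then do not depend on a choice of indices, which gives associativity. *)
Definition fam (x : {ffun 'I_m -> L}) :=
  [forall j, hom a (b j) (x j)] &&
  [forall j, forall k, (j != k) ==> (hcomp a (b k) (x j) (ax j k) == x k)].

Definition famType := {x | fam x}.
Implicit Types x y z q r s : famType.
Definition co x j : L := val x j.

Lemma co_hom x j : hom a (b j) (co x j).
Proof. by case: x => x hx; case/andP: (hx) => /forallP h _; apply: h. Qed.
Local Hint Resolve co_hom : core.

Lemma co_tr x j k : j != k -> hcomp a (b k) (co x j) (ax j k) = co x k.
Proof.
move=> ne; case: x => x hx; case/andP: (hx) => _ /forallP /(_ j)/forallP/(_ k).
by rewrite ne => /eqP.
Qed.

Lemma comp_tr j k l (x : L) : uniq [:: j; k; l] -> hom a (b j) x ->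
  hcomp a (b l) (hcomp a (b k) x (ax j k)) (ax k l) = hcomp a (b l) x (ax j l).
Proof.
move=> u; case/and3P: (etrans (esym (uniq3 _ _ _)) u) => n1 n2 n3 hx.
by rewrite (comp_assoc (Iabc u) hx (ax_hom n1) (ax_hom n3)) comp_ax_sg.
Qed.

Lemma comp_trK j k (x : L) : j != k -> hom a (b j) x ->
  hcomp a (b j) (hcomp a (b k) x (ax j k)) (ax k j) = x.
Proof.
move=> ne hx; rewrite [ax k j]ax_sym.
apply: (comp_cancelr (Iab ne) (ax_hom ne) _ hx).
by rewrite ax_sym; apply: ax_hom; rewrite eq_sym.
Qed.

Lemma co_ext j (x : L) : hom a (b j) x -> {y | co y j = x}.
Proof.
move=> hx; pose y := [ffun i => if i == j then x else hcomp a (b i) x (ax j i)].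
have hy : fam y.
  apply/andP; split; apply/forallP => i.
    rewrite ffunE; case: eqP => [->//|/eqP ne]; rewrite eq_sym in ne.
    by apply: comp_hom (Iab ne) hx (ax_hom ne).
  apply/forallP => k; apply/implyP => ne; rewrite !ffunE.
  case: (i =P j) ne => [->|/eqP ni ne].
    by rewrite eq_sym => /negbTE->.
  rewrite eq_sym in ni; case: (k =P j) ne => [->|/eqP nk] ne; first by rewrite comp_trK.
  by rewrite comp_tr // uniq3 ni ne eq_sym nk.
by exists (exist _ y hy); rewrite /co /= ffunE eqxx.
Qed.

Lemma co_inj j x y : co x j = co y j -> x = y.
Proof.
move=> e; apply: val_inj; apply/ffunP => k; case: (j =P k) => [<-//|/eqP ne].
by have := co_tr x ne; rewrite e (co_tr y ne).
Qed.

Lemma hom_a j : hom a (b j) a.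
Proof. by case: (other1 j) => k /Iab I; apply: hom0; indm I [:: T; F; F] [:: F; F; T]. Qed.

Let i0 : 'I_m := Ordinal (ltn_trans (isT : (0 < 2)%N) m_gt2).

Definition fzero : famType := sval (co_ext (hom_a i0)).

Definition fone : famType := sval (co_ext (cab i0)).

Definition tr k j (x q s : famType) :=
  tern a (b k) (b j) (co q k) (co x j) (sg k j (co s j)).

Lemma tr_hom k j x q s : k != j -> hom a (b j) (tr k j x q s).
Proof. by move=> ne; apply: tern_hom (Iab ne) _ _ (sg_hom ne _). Qed.

(** Computed at one fixed target with one auxiliary member; [co_tern] shows that every other choice
    gives the same family, so laws can be checked at convenient indices. *)
Definition ftern x q s : famType :=
  sval (co_ext (tr_hom x q s (svalP (other1 i0)))).

Lemma tr_pre k l j x q s : uniq [:: k; j; l] -> tr k j x q s = tr l j x q s.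
Proof.
move=> u; case/and3P: (etrans (esym (uniq3 _ _ _)) u) => n1 n2 n3.
have u' : uniq [:: k; l; j] by rewrite uniq3 n2 n1 eq_sym.
rewrite /tr -(comp_ax_sg u' (co_hom s j)).
rewrite (tern_pre (Iabc u) (co_hom q k) (co_hom x j)); first by rewrite co_tr.
  by apply: sg_hom => //; rewrite eq_sym.
exact: ax_hom.
Qed.

Lemma tr_post k j l x q s : uniq [:: k; j; l] ->
  hcomp a (b l) (tr k j x q s) (ax j l) = tr k l x q s.
Proof.
move=> u; case/and3P: (etrans (esym (uniq3 _ _ _)) u) => n1 n2 n3.
rewrite /tr (tern_comp (Iabc u) (co_hom q k) (co_hom x j)) //; last exact: ax_hom.
  by rewrite sg_comp // !co_tr.
exact: sg_hom.
Qed.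

Lemma co_tern k j x q s : k != j -> co (ftern x q s) j = tr k j x q s.
Proof.
move=> ne; rewrite /ftern; set j0 := i0; case: (other1 j0) => k0 /= ne0.
case: co_ext => y /= ey; set t := tr k0 j0 x q s in ey.
have base k' : k' != j0 -> tr k' j0 x q s = t.
  move=> h; case: (k' =P k0) => [->//|/eqP h'].
  by apply: tr_pre; rewrite uniq3 h h' eq_sym ne0.
case: (j =P j0) ne => [->|/eqP nj] ne; first by rewrite ey base.
have nj' : j0 != j by rewrite eq_sym.
rewrite -(co_tr y nj') ey.
case: (k =P j0) ne => [->|/eqP nk] ne; last first.
  by rewrite -(base k nk) tr_post // uniq3 nk ne.
(* Here the auxiliary member is the reference target itself, so a third index [l] replaces it before
   the transport. *)
have [l] := other2 ne; rewrite uniq3 => /and3P[n1 n2 n3].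
rewrite -(base l) ?[l == _]eq_sym // tr_post; last by rewrite uniq3 nj' ![l == _]eq_sym n2 n3.
by apply: tr_pre; rewrite uniq3 ![l == _]eq_sym n2 n3 eq_sym nj'.
Qed.

Definition fadd x y := ftern x fone y.
(** Products compose from left to right, first [x] and then [y], which suits row vectors and left
    ideals. *)
Definition fmul x y := ftern fzero x y.

Lemma co0 j : co fzero j = a.
Proof.
rewrite /fzero; case: (co_ext _) => y /= ey.
case: (i0 =P j) => [<-//|/eqP ne]; rewrite -(co_tr y ne) ey.
have I := Iab ne.
apply/esym; apply: (hom_eq (hom_a j) (comp_hom I (hom_a i0) (ax_hom ne))).
by rewrite /hcomp; lat.
Qed.

Lemma co1 j : co fone j = c j.
Proof.
rewrite /fone; case: (co_ext _) => y /= ey.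
case: (i0 =P j) => [<-//|/eqP ne]; rewrite -(co_tr y ne) ey.
exact: comp_csg.
Qed.

Lemma pick1 : {j : 'I_m & {k | k != j}}.
Proof. by exists i0; apply: other1. Qed.

Lemma pick2 : {j : 'I_m & {k & {l | uniq [:: k; j; l]}}}.
Proof. by have [j [k ne]] := pick1; exists j, k; apply: other2. Qed.

Lemma co_mul k j x y : k != j -> co (fmul x y) j = hcomp a (b j) (co x k) (sg k j (co y j)).
Proof.
by move=> ne; rewrite (co_tern _ _ _ ne) /tr co0 tern_0l ?sg_hom // Iab.
Qed.

Lemma co_add k j x y : k != j ->
  co (fadd x y) j = tern a (b k) (b j) (c k) (co x j) (sg k j (co y j)).
Proof. by move=> ne; rewrite (co_tern _ _ _ ne) /tr co1. Qed.

Lemma sg_mul l k j x y : uniq [:: l; k; j] ->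
  sg l j (co (fmul x y) j) = hcomp (b l) (b j) (sg l k (co x k)) (sg k j (co y j)).
Proof.
move=> u; case/and3P: (etrans (esym (uniq3 _ _ _)) u) => n1 n2 n3.
have I : indep [:: b l; a; b k; b j] by apply: indep_swap; apply: Iabc; rewrite uniq3 n1 n2.
by rewrite (co_mul _ _ n3) /sg (comp_assoc I (cba l) (co_hom x k)) //; apply: sg_hom.
Qed.

Lemma fternE x q s : ftern x q s = fadd x (fmul q s).
Proof.
have [j [k [l u]]] := pick2; case/and3P: (etrans (esym (uniq3 _ _ _)) u) => n1 n2 n3.
have u' : uniq [:: k; l; j] by rewrite uniq3 n2 n1 eq_sym.
have n3' : l != j by rewrite eq_sym.
apply: (@co_inj j); rewrite (co_add _ _ n1) (sg_mul _ _ u').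
rewrite (tern_pre (Iabc u) (cab k) (co_hom x j) (sg_hom n3' (co_hom s j))); last exact: sg_hom.
by rewrite (comp_csg n2 (co_hom q l)) (co_tern _ _ _ n3').
Qed.

Lemma f0add x : fadd fzero x = x.
Proof.
have [j [k ne]] := pick1; apply: (@co_inj j); rewrite (co_add _ _ ne) co0.
by rewrite tern_0l ?Iab ?sg_hom // comp_csg.
Qed.

(** As zero is a left unit, this single law yields both commutativity and associativity. *)
Lemma faddAC x y z : fadd (fadd x y) z = fadd (fadd x z) y.
Proof.
have [j [k [l u]]] := pick2; case/and3P: (etrans (esym (uniq3 _ _ _)) u) => n1 n2 n3.
have n3' : l != j by rewrite eq_sym.
apply: (@co_inj j); rewrite (co_add _ _ n3') (co_add x y n1) (co_add _ _ n1) (co_add x z n3').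
by apply: tern_exch; rewrite ?sg_hom // Iabc // uniq3 n2 n1.
Qed.

Lemma faddC x y : fadd x y = fadd y x.
Proof. by rewrite -{1}[x]f0add faddAC f0add. Qed.

Lemma faddA x y z : fadd x (fadd y z) = fadd (fadd x y) z.
Proof. by rewrite faddC faddAC [fadd y x]faddC. Qed.

Lemma fopp_ex x : exists y, fadd y x == fzero.
Proof.
have [j [k ne]] := pick1.
have [z hz ez] := tern_opp (Iab ne) (cab k) (sg_hom ne (co_hom x j)).
have [y ey] := co_ext hz; exists y; apply/eqP; apply: (@co_inj j).
by rewrite (co_add _ _ ne) ey ez co0.
Qed.

Definition fopp x : famType := xchoose (fopp_ex x).
Lemma faddN x : fadd (fopp x) x = fzero.
Proof. exact/eqP/(xchooseP (fopp_ex x)). Qed.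

Lemma fmulA x y z : fmul x (fmul y z) = fmul (fmul x y) z.
Proof.
have [j [k [l u]]] := pick2; case/and3P: (etrans (esym (uniq3 _ _ _)) u) => n1 n2 n3.
have n3' : l != j by rewrite eq_sym.
have u' : uniq [:: k; l; j] by rewrite uniq3 n2 n1.
apply: (@co_inj j); rewrite (co_mul _ _ n1) (sg_mul _ _ u') (co_mul _ _ n3') (co_mul x y n2).
by rewrite (comp_assoc (Iabc u')) // sg_hom.
Qed.

Lemma f1mul x : fmul fone x = x.
Proof.
by have [j [k ne]] := pick1; apply: (@co_inj j); rewrite (co_mul _ _ ne) co1 comp_csg.
Qed.

Lemma fmul1 x : fmul x fone = x.
Proof.
by have [j [k ne]] := pick1; apply: (@co_inj j); rewrite (co_mul _ _ ne) co1 (co_tr x ne).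
Qed.

Lemma fmulDl x y s : fmul (fadd x y) s = fadd (fmul x s) (fmul y s).
Proof.
have [j [k [l u]]] := pick2; case/and3P: (etrans (esym (uniq3 _ _ _)) u) => n1 n2 n3.
have u' : uniq [:: k; j; l] by [].
apply: (@co_inj l); rewrite (co_mul _ _ n3) (co_add x y n1) (co_add _ _ n2).
by rewrite (tern_comp (Iabc u)) ?sg_hom // -co_mul // (sg_mul y s u).
Qed.

Lemma fmulDr x y z : fmul x (fadd y z) = fadd (fmul x y) (fmul x z).
Proof.
have [j [k [l u]]] := pick2; case/and3P: (etrans (esym (uniq3 _ _ _)) u) => n1 n2 n3.
have [n1' n2' n3'] : [/\ j != k, l != k & l != j] by rewrite ![l == _]eq_sym [j == _]eq_sym.
apply: (@co_inj j); rewrite -fternE (co_mul _ _ n3') (co_tern _ _ _ n1) /tr.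
(* Composition with [x] is done in two stages, the axis [c l] from [b l] to [a] and the component of
   [x] from [a] to [b l]; [comp_tern] moves each of them into the sum. *)
have I : indep [:: b l; b k; b j; a].
  apply: (indep_perm _ (Iabc u)).
  apply/permP => p /=; rewrite !addn0 addnC -!addnA [in RHS]addnC -!addnA.
  by rewrite [(p a + _)%N]addnC.
rewrite /sg (co_add y z n1) (comp_tern I (cba l) (cab k) (co_hom y j)) ?sg_hom //.
rewrite -/(ax l k) -/(sg l j (co y j)) -/(sg k j (co z j)).
rewrite (comp_tern (Iabc u) (co_hom x l) (ax_hom n2')) ?sg_hom //.
by rewrite (co_tr x n2') -co_mul.
Qed.

Lemma fone_neq0 : fone != fzero.
Proof.
have [j _] := pick1; apply/eqP => e; apply: a_neq0; apply: lle_anti; last by lat.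
have := hom_bot (cba j); rewrite -co1 e co0 => h.
by apply: lle_trans h; lat.
Qed.

Lemma sg_surj k j (s : L) : k != j -> hom (b k) (b j) s ->
  exists x, sg k j (co x j) = s.
Proof.
move=> ne hs; have [x ex] := co_ext (comp_hom (Iab ne) (cab k) hs).
by exists x; rewrite ex; apply: comp_cancell (Iab ne) (cab k) (cba k) hs.
Qed.

(* The quasi-inverse of [r] inverts [r] between a complement of its kernel and
   its image, and kills a complement of the image. *)
Lemma fmul_regular r : exists w, fmul (fmul r w) r = r.
Proof.
have [j [k ne]] := pick1; have I := Iab ne.
have hr := co_hom r j; set x := co r j in hr.
have rl := hom_le hr; have rs := hom_src hr; have rb := hom_bot hr.
have [a' [a1 a2 a3]] := rel_compl (lat_Ir x (lle_refl a)).
have [i' [i1 i2 i3]] := rel_compl (lat_Ir (x `|` a) (lle_refl (b j))).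
set u := x `&` a in a1 a3 *; set i := (x `|` a) `&` b j in i1 i3 *.
(* Here [u] is the kernel and [i] the image. Read from [b j] to [a], the graph [g] inverts [r] on
   [i], and containing [i'] means that [W] is zero there. *)
pose g := x `&` (a' `|` b j); pose W := g `|` i'.
have ab0 : a `&` b j <= bot by indm I [:: T; F; F] [:: F; F; T].
have ba0 : b j `&` a <= bot by rewrite lmeetC.
have xi : x <= a `|` i.
  by apply: lle_trans (@le_mod _ a (b j) (x `|` a) _ _ _ _) _; rewrite /i; lat.
have xg : x <= u `|` g.
  have ux : u <= x by rewrite /u; lat.
  have gE : (a' `|` b j) `&` x <= g by rewrite /g; lat.
  by apply: lle_trans (@le_mod _ u (a' `|` b j) x _ _ _ _) _; lat.
have hW : hom (b j) a W.
  apply: homI.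
  - have h1 : W `&` a <= g.
      apply: (@le_mod0 _ _ i' (a `|` i)); [rewrite /W; lat|lat|rewrite /g; lat|].
      apply: lle_trans i1; apply: lat_leI; last by lat.
      by apply: (@le_mod0 _ _ a (b j)); rewrite /i; lat.
    have h2 : W `&` a <= a'.
      by apply: (@le_mod0 _ _ (b j) a); rewrite /g in h1; lat.
    by apply: lle_trans a1; rewrite /u /g in h1 *; lat.
  - by rewrite /W /g; lat.
  - have ix : i <= x `|` a by rewrite /i; lat.
    have ua : u <= a by rewrite /u; lat.
    have xW : x <= W `|` a by rewrite /W; lat.
    have iW : i' <= W by rewrite /W; lat.
    by lat.
have ne' : j != k by rewrite eq_sym.
have hs := comp_hom (indep_swap (Iab ne')) hW (cab k).
set s := hcomp _ _ _ _ in hs.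
have [w ew] := sg_surj ne' hs; exists w; apply: (@co_inj j).
rewrite (co_mul _ _ ne) (co_mul _ _ ne') ew -/x; apply/esym.
have I' := Iab ne'.
apply: (hom_eq hr (comp_hom I (comp_hom I' hr hs) (sg_hom ne hr))).
have cl := hom_le (cab k); have cs := hom_src (cab k).
pose c' := c k `&` (a' `|` b k).
have ag : a' <= b j `|` g.
  by apply: lle_trans (@le_mod _ (b j) x (a' `|` b j) _ _ _ _) _; rewrite /g; lat.
have ac : a' <= b k `|` c'.
  by apply: lle_trans (@le_mod _ (b k) (c k) (a' `|` b k) _ _ _ _) _; rewrite /c'; lat.
have c1 : c' <= a' `|` b k by rewrite /c'; lat.
have g1 : g <= a' `|` b j by rewrite /g; lat.
have gx : g <= x by rewrite /g; lat.
have cc : c' <= c k by rewrite /c'; lat.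
have h1 : c' <= hcomp a (b k) x s.
  rewrite /hcomp; apply: lat_leI; last by lat.
  apply: lle_trans (@le_mod _ g (b j `|` b k) (g `|` c') _ _ _ _) _; [lat|lat|lat|].
  by rewrite /s /hcomp /W; lat.
have h2 : g <= c' `|` sg k j x.
  apply: lle_trans (@le_mod _ c' (b k `|` b j) (c' `|` g) _ _ _ _) _; [lat|lat|lat|].
  by rewrite /sg /hcomp; lat.
have h3 : u <= hcomp a (b k) x s by rewrite /u /hcomp; lat.
by rewrite {1}/hcomp; lat.
Qed.

(** The ring is used later only through this interface. Its last identity covers products as the
    case [x = 0] and sums as the case [q = 1]. *)
Theorem coordinate_ring : exists (R : nzRingType) (rho : 'I_m -> R -> L),
  [/\ forall r : R, exists w, (r * w * r = r)%R,
      forall j (r : R), hom a (b j) (rho j r),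
      forall j (x : L), hom a (b j) x -> exists r : R, rho j r = x,
      forall j, injective (rho j) &
      [/\ forall j, rho j 0%R = a, forall j, rho j 1%R = c j &
        forall k j (x q s : R), k != j -> rho j (x + q * s)%R =
         tern a (b k) (b j) (rho k q) (rho j x) (hcomp (b k) (b j) (c k) (rho j s))]].
Proof.
pose Rz := GRing.isNzRing.Build famType faddA faddC f0add faddN fmulA f1mul fmul1
  fmulDl fmulDr fone_neq0.
pose R : nzRingType := HB.pack {x | fam x} Rz.
exists R, (fun j (r : R) => co r j); split=> [r|j r|j x hx|j x y /co_inj//|].
- exact: fmul_regular.
- exact: co_hom.
- by have [y ey] := co_ext hx; exists y.
split=> [j|j|k j x q s ne]; [exact: co0|exact: co1|].
exact: etrans (congr1 (fun y => co y j) (esym (fternE x q s))) (co_tern x q s ne).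
Qed.
End Frame.

(** * Finitely generated modules of row vectors over a regular ring *)

Section Fgen.
Variable R : nzRingType.
Hypothesis R_regular : forall r : R, exists s, (r * s * r = r)%R.
Implicit Types (u v s : nat -> R) (M Y : (nat -> R) -> Prop).
Local Open Scope ring_scope.

(** Rows are functions on all of [nat] of which only the first [k] values count, so that lengths can
    change in inductions without dependent types. *)
Definition fgen k M := exists N (X : 'I_N -> nat -> R), forall v,
  M v <-> exists t : 'I_N -> R, forall j, (j < k)%N -> v j = \sum_i t i * X i j.

Lemma fgen0 M : (forall v, M v) -> fgen 0 M.
Proof. by move=> h; exists 0, (fun _ _ => 0) => v; split=> // _; exists (fun=> 0). Qed.

(** Over a regular ring a finitely generated left ideal is generated by an idempotent, here the sum
    of the [t l * x l]. *)
Lemma regular_col N (x : 'I_N -> R) : exists t : 'I_N -> R,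
  forall i, x i * (\sum_l t l * x l) = x i.
Proof.
elim: N x => [|N IH] x; first by exists x; case.
have [t ht] := IH (fun i => x (lift ord0 i)); set e := \sum_l _ in ht.
(* The part of the new generator not yet fixed by [e] has a quasi-inverse [c]; the idempotent grows
   by [(1 - e) * c * x ord0 * (1 - e)]. *)
have [c hc] := R_regular (x ord0 * (1 - e)).
pose d := (1 - e) * c * x ord0.
exists (fun i => if unlift ord0 i is Some l then t l - d * t l else (1 - e) * c).
have -> : \sum_l (if unlift ord0 l is Some l' then t l' - d * t l' else (1 - e) * c) * x l
    = e + (1 - e) * c * (x ord0 * (1 - e)).
  rewrite big_ord_recl unlift_none; under eq_bigr do rewrite liftK mulrBl -mulrA.
  rewrite sumrB -mulr_sumr -/e mulrBr mulr1 /d mulrBr !mulrA addrCA; congr (_ + _).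
move=> i; case: (unliftP ord0 i) => [l|] ->.
  have hl : x (lift ord0 l) * (1 - e) = 0.
    by rewrite mulrBr mulr1; apply/eqP; rewrite subr_eq0; apply/eqP/esym/ht.
  rewrite mulrDr -[RHS]addr0; congr (_ + _); first exact: ht.
  by rewrite !mulrA hl !mul0r.
rewrite (mulrDr _ e) !mulrA -[x ord0 * (1 - e) * c * x ord0 * (1 - e)]mulrA hc.
by rewrite mulrBr mulr1 addrC subrK.
Qed.

(** The generators are those of [Y], with last coordinate 0, and one row with last coordinate [e]
    and other entries [- (e * s j)]. The description of [M] has the same shape as [inD_step] on the
    lattice side. *)
Lemma fgen_cons k M Y (e : R) s : e * e = e -> fgen k Y ->
  (forall v, M v <-> v k * e = v k /\ Y (fun j => v j + v k * s j)) -> fgen k.+1 M.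
Proof.
move=> ee [N [X hX]] hM.
exists N.+1, (fun i j => if unlift ord0 i is Some l then (if j == k then 0 else X l j)
   else (if j == k then e else - (e * s j))) => v.
split=> [/hM[ve /hX[t ht]]|[t ht]].
  exists (fun i => if unlift ord0 i is Some l then t l else v k) => j.
  rewrite ltnS leq_eqVlt big_ord_recl !unlift_none; under eq_bigr do rewrite !liftK.
  case: eqP => [->|_] /= hj.
    by rewrite big1 ?addr0 // => i _; rewrite mulr0.
  by rewrite mulrN mulrA ve -ht // addrCA addNr addr0.
have vk : v k = t ord0 * e.
  rewrite (ht k (ltnSn k)) big_ord_recl !unlift_none eqxx big1 ?addr0 // => i _.
  by rewrite liftK mulr0.
apply/hM; split; first by rewrite vk -mulrA ee.
apply/hX; exists (fun i => t (lift ord0 i)) => j hj.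
rewrite (ht j (ltnW hj)) big_ord_recl !unlift_none ltn_eqF //; under eq_bigr do rewrite liftK.
by rewrite vk mulrN !mulrA addrAC addNr add0r.
Qed.

(** The combination [p] of the generators has last coordinate [e]; subtracting multiples of it
    clears the last coordinate of each generator, and the cleared rows span [Y]. *)
Lemma fgen_uncons k M : fgen k.+1 M -> exists (e : R) s Y, [/\ e * e = e, fgen k Y &
  forall v, M v <-> v k * e = v k /\ Y (fun j => v j + v k * s j)].
Proof.
move=> [N [X hX]]; have [t0 ht0] := regular_col (fun i => X i k).
set e := \sum_l _ in ht0.
pose p j := \sum_l t0 l * X l j.
pose Y v := exists t : 'I_N -> R, forall j, (j < k)%N -> v j = \sum_i t i * (X i j - X i k * p j).
have ex (t : 'I_N -> R) : (\sum_i t i * X i k) * e = \sum_i t i * X i k.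
  by rewrite mulr_suml; apply: eq_bigr => i _; rewrite -mulrA ht0.
have sub (t : 'I_N -> R) j : \sum_i t i * (X i j - X i k * p j) =
    \sum_i t i * X i j - (\sum_i t i * X i k) * p j.
  by under eq_bigr do rewrite mulrBr mulrA; rewrite sumrB -mulr_suml.
exists e, (fun j => - p j), Y; split; first by rewrite /e ex.
  by exists N, (fun i j => X i j - X i k * p j).
move=> v; split=> [/hX[t ht]|[ve [t ht]]].
  have vk := ht k (ltnSn k); split; first by rewrite vk ex.
  by exists t => j hj; rewrite sub -vk -(ht j (ltnW hj)) mulrN.
(* The multiple of the row [p] that is still missing after the combination [t] of the original
   generators. *)
pose d := v k - \sum_i t i * X i k.
apply/hX; exists (fun i => t i + d * t0 i) => j; rewrite ltnS leq_eqVlt => hj.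
have -> : \sum_i (t i + d * t0 i) * X i j = \sum_i t i * X i j + d * p j.
  under eq_bigr do rewrite mulrDl -mulrA.
  by rewrite big_split /= -mulr_sumr.
case/predU1P: hj => [->|hj]; last first.
  have := ht j hj; rewrite sub mulrN => /eqP; rewrite subr_eq => /eqP ->.
  by rewrite mulrBl -addrA; congr (_ + _); rewrite addrC.
by rewrite /d -/e mulrBl ve ex addrC subrK.
Qed.
End Fgen.


(** * Row vectors and lattice elements *)

Section Split.
Local Open Scope lat_scope.
Variable L : modLattice.
Implicit Types (a b h x y z w e : L).

(** Elements below [v] meet in the same way modulo [u], because [u] is independent of [v]. *)
Lemma join_meet u x y v w : w <= x `|` u -> w <= y `|` u -> x <= v -> y <= v ->
  u `&` v <= bot -> w <= (x `&` y) `|` u.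
Proof.
move=> h1 h2 h3 h4 h5.
apply: lle_trans (@le_mod _ u x (y `|` u) _ _ _ _) _; [lat|lat|lat|].
apply: lat_leU; first by lat.
by apply: lat_Ul; apply: lat_leI; [lat|]; apply: (@le_mod0 _ _ u v); lat.
Qed.

(** One step of Gaussian elimination: [y] is its part in [h] plus a graph over its projection on
    [b]. The graph is a complement of that part in [y], extended by zero on a complement [f] of the
    projection. *)
Lemma hom_split b h y : b `&` h <= bot -> y <= b `|` h ->
  exists z, [/\ hom b h z, z `&` ((y `|` h) `&` b `|` h) <= y &
    y <= (y `&` h) `|` (z `&` ((y `|` h) `&` b `|` h))].
Proof.
move=> bh yb; set e := (y `|` h) `&` b.
have [y' [y1 y2 y3]] := rel_compl (lat_Il h (lle_refl y)).
have [f [f1 f2 f3]] := rel_compl (lat_Ir (y `|` h) (lle_refl b)).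
rewrite -/e in f1 f3.
have ye : y <= e `|` h.
  have h1 : b `&` (y `|` h) <= e by rewrite /e; lat.
  by apply: lle_trans (@le_mod _ h b (y `|` h) _ _ _ _) _; lat.
have eb : e <= b by rewrite /e; lat.
have feh : f `&` (e `|` h) <= bot.
  apply: lle_trans f1; apply: lat_leI; last by lat.
  by apply: (@le_mod0 _ _ h b); rewrite 1?[h `&` b]lmeetC; lat.
have zy : (y' `|` f) `&` (e `|` h) <= y' by apply: (@le_mod0 _ _ f (e `|` h)); lat.
exists (y' `|` f); split; [|lat|].
- apply: homI; [|lat|].
    have h1 : (y' `|` f) `&` h <= y' by apply: lle_trans zy; lat.
    by apply: lle_trans y1; lat.
  have e1 : e <= y `|` h by rewrite /e; lat.
  have e2 : e <= y' `|` h by lat.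
  by lat.
- by apply: lle_trans y3 _; lat.
Qed.

Lemma hom_build b h y e z : b `&` h <= bot -> y <= h -> e <= b -> hom b h z ->
  let x := y `|` (z `&` (e `|` h)) in x `&` h = y /\ (x `|` h) `&` b = e.
Proof.
move=> bh yh eb hz x; have zs := hom_src hz; have zb := hom_bot hz.
have zh : z `&` (e `|` h) `&` h <= bot by apply: lle_trans zb; lat.
have hb : h `&` b <= bot by rewrite lmeetC.
split; apply: lle_anti.
- by apply: (@le_mod0 _ _ (z `&` (e `|` h)) h); rewrite /x; lat.
- by rewrite /x; lat.
- by apply: (@le_mod0 _ _ h b); rewrite /x; lat.
- apply: lat_leI => //.
  by apply: lle_trans (@le_mod _ h z (e `|` h) _ _ _ _) _; rewrite /x; lat.
Qed.
End Split.

(** * Lattice elements as finitely generated modules of rows *)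

Section Coord.
Local Open Scope lat_scope.
Local Notation T := true.
Local Notation F := false.
Variables (L : modLattice) (m : nat) (a : L) (b c : nat -> L).
Variables (R : nzRingType) (rho : nat -> R -> L).
Implicit Types (j k l : nat) (x y z w e : L) (p q r s : R) (u v : nat -> R).
Hypothesis m_gt1 : (1 < m)%N.
Hypothesis Iab : indep (a :: [seq b i | i <- iota 0 m]).
Hypothesis cab : forall j, (j < m)%N -> hom a (b j) (c j).
Hypothesis cba : forall j, (j < m)%N -> hom (b j) a (c j).
Hypothesis R_regular : forall r, exists s, (r * s * r = r)%R.
Hypothesis rho_hom : forall j r, (j < m)%N -> hom a (b j) (rho j r).
Hypothesis rho_surj : forall j x, (j < m)%N -> hom a (b j) x -> exists r, rho j r = x.
Hypothesis rho_inj : forall j, (j < m)%N -> injective (rho j).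
Hypothesis rho0 : forall j, (j < m)%N -> rho j 0%R = a.
Hypothesis rho1 : forall j, (j < m)%N -> rho j 1%R = c j.

Definition sgr k j s := hcomp (b k) (b j) (c k) (rho j s).
Hypothesis rhoT : forall k j p q s, (k < m)%N -> (j < m)%N -> k != j ->
  rho j (p + q * s)%R = tern a (b k) (b j) (rho k q) (rho j p) (sgr k j s).

Fixpoint hh k : L := if k is k'.+1 then hh k' `|` b k' else bot.

Lemma hh_joins k : joins [seq b i | i <- iota 0 k] = hh k.
Proof.
elim: k => [//|k IH]; have -> : iota 0 k.+1 = iota 0 k ++ [:: k] by rewrite -addn1 iotaD.
rewrite map_cat joins_cat IH /=.
by apply: lle_anti; lat.
Qed.

Lemma Isub (s1 s2 : seq nat) : uniq (s1 ++ s2) -> all (fun j => (j < m)%N) (s1 ++ s2) ->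
  indep (a :: [seq b i | i <- s1] ++ [:: joins [seq b i | i <- s2]]).
Proof.
set t := s1 ++ s2 => ut /allP lt.
rewrite -cat_cons; apply: indep_group; rewrite cat_cons -map_cat -/t.
apply: (@indep_catl _ (a :: [seq b i | i <- t])
  [seq b i | i <- [seq i <- iota 0 m | i \notin t]]).
apply: indep_perm Iab; rewrite /= perm_cons -map_cat; apply: perm_map.
rewrite -(permPl (permEl (perm_filterC (mem t) (iota 0 m)))) perm_cat2r.
apply: uniq_perm => //; first by rewrite filter_uniq ?iota_uniq.
move=> i; rewrite mem_filter mem_iota /= add0n; case: (boolP (i \in t)) => //= it.
by rewrite lt.
Qed.

Lemma Iakj k j : (k < m)%N -> (j < m)%N -> k != j -> indep [:: a; b k; b j].
Proof.
move=> km jm kj; apply: (indep_catl (s := [:: a; b k; b j]) (t := [:: bot])).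
by apply: (@Isub [:: k; j] [::]); rewrite /= ?inE ?kj ?km ?jm.
Qed.

Lemma Iakh k : (k < m)%N -> indep [:: a; b k; hh k].
Proof.
move=> km; rewrite -hh_joins; apply: (@Isub [:: k]).
  by rewrite /= mem_iota /= ltnn iota_uniq.
by rewrite /= km; apply/allP => i; rewrite mem_iota /= add0n => h; apply: ltn_trans h km.
Qed.

Lemma Iahk k : (k < m)%N -> indep [:: a; hh k; b k].
Proof. by move=> /Iakh/indep_swap2. Qed.

Lemma Iakjh k j : (j < k)%N -> (k < m)%N -> indep [:: a; b k; b j; hh j].
Proof.
move=> jk km; have jm := ltn_trans jk km; rewrite -hh_joins; apply: (@Isub [:: k; j]).
  by rewrite /= inE !mem_iota /= iota_uniq ltnn (gtn_eqF jk) add0n ltnNge (ltnW jk).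
by rewrite /= km jm; apply/allP => i; rewrite mem_iota /= add0n => h; apply: ltn_trans h jm.
Qed.

Lemma Iah k : (k <= m)%N -> indep [:: a; hh k].
Proof.
move=> km; rewrite -hh_joins; apply: (@Isub [::]); first exact: iota_uniq.
by apply/allP => i; rewrite mem_iota /= add0n => h; apply: leq_trans h km.
Qed.

Lemma ahh k : (k <= m)%N -> a `&` hh k <= bot.
Proof. by move=> /Iah I; indm I [:: T; F] [:: F; T]. Qed.

Lemma abj j : (j < m)%N -> a `&` b j <= bot.
Proof. by move=> /Iakh I; indm I [:: T; F; F] [:: F; T; F]. Qed.

Lemma bhh k : (k < m)%N -> b k `&` hh k <= bot.
Proof. by move=> /Iakh I; indm I [:: F; T; F] [:: F; F; T]. Qed.

Lemma other_index j : exists k, (k < m)%N /\ k != j.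
Proof. by case: j => [|j]; [exists 1|exists 0]; rewrite // (ltn_trans _ m_gt1). Qed.

Lemma sgr_hom k j s : (k < m)%N -> (j < m)%N -> k != j -> hom (b k) (b j) (sgr k j s).
Proof.
move=> km jm kj; apply: comp_hom (cba km) (rho_hom s jm).
exact: indep_swap (Iakj km jm kj).
Qed.

Lemma sgr_surj k j x : (k < m)%N -> (j < m)%N -> k != j -> hom (b k) (b j) x ->
  exists s, sgr k j s = x.
Proof.
move=> km jm kj hx; have I := Iakj km jm kj.
have [s es] := rho_surj jm (comp_hom I (cab km) hx).
by exists s; rewrite /sgr es; apply: comp_cancell I (cab km) (cba km) hx.
Qed.

Lemma rho_mul k j q s : (k < m)%N -> (j < m)%N -> k != j ->
  rho j (q * s)%R = hcomp a (b j) (rho k q) (sgr k j s).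
Proof.
move=> km jm kj; rewrite -[(q * s)%R]add0r (rhoT _ _ _ km jm kj) rho0 //.
by apply: tern_0l; [apply: Iakj|apply: rho_hom|apply: sgr_hom].
Qed.

(** In the form [r + 1 * p], the sum depends on [p] only through the shear, and a change of [p]
    within [e] changes the shear within [e]. *)
Lemma rho_shift j p q r e : (j < m)%N -> e <= b j -> rho j p <= rho j q `|` e ->
  rho j (r + p)%R <= rho j (r + q)%R `|` e.
Proof.
move=> jm eb le; have [k [km kj]] := other_index j.
rewrite -[p]mul1r -[q]mul1r !(rhoT _ _ _ km jm kj) /tern.
have h : sgr k j p <= e `|` sgr k j q.
  rewrite /sgr /hcomp.
  by apply: lle_trans (@le_mod _ e (c k `|` rho j q) (b k `|` b j) _ _ _ _) _; lat.
set P := hpair _ _ _ _.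
by apply: lle_trans (@le_mod _ e (P `|` sgr k j q) (a `|` b j) _ _ _ _) _; lat.
Qed.

Lemma rho_leP j p q e : (j < m)%N -> e <= b j ->
  (rho j p <= rho j q `|` e) = (rho j (p - q)%R <= a `|` e).
Proof.
move=> jm eb; apply/idP/idP => le.
  by move: (rho_shift (- q)%R jm eb le); rewrite addNr rho0 // addrC.
rewrite -(rho0 jm) in le.
by move: (rho_shift q jm eb le); rewrite addr0 addrC subrK.
Qed.

(* The image of the morphism [rho j r] lies in [e]. *)
Definition inI j e r := rho j r <= a `|` e.

Lemma inI_mul j e r s : (j < m)%N -> e <= b j -> inI j e r -> inI j e (s * r)%R.
Proof.
rewrite /inI => jm eb le; have [k [km kj]] := other_index j.
have I := Iakj km jm kj; rewrite (rho_mul _ _ km jm kj).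
have kl := hom_le (rho_hom s km); have cl := hom_le (cab km).
have h1 : sgr k j r <= b k `|` e.
  rewrite /sgr /hcomp; apply: (@le_mod0 _ _ a (b k `|` b j)); [lat|lat|lat|].
  by indm I [:: T; F; F] [:: F; T; T].
rewrite /hcomp; apply: (@le_mod0 _ _ (b k) (a `|` b j)); [lat|lat|lat|].
by indm I [:: F; T; F] [:: T; F; T].
Qed.

Lemma inI_src j e r : (j < m)%N -> e <= b j -> inI j e r -> a <= rho j r `|` e.
Proof.
rewrite /inI => jm eb le; have rs := hom_src (rho_hom r jm); have ab := abj jm.
apply: lle_trans (@le_mod _ (rho j r) (b j) (a `|` e) _ _ _ _) _; [lat|lat|lat|].
apply: lat_leU; first by lat.
by apply: lat_Ur; apply: (@le_mod0 _ _ a (b j)); lat.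
Qed.

Lemma inI_sub j e r s : (j < m)%N -> e <= b j -> inI j e r -> inI j e s -> inI j e (r - s)%R.
Proof.
move=> jm eb hr hs; rewrite /inI -rho_leP //.
by have := inI_src jm eb hs; rewrite /inI in hr => ?; lat.
Qed.

(** The idempotent is the projection of [b j] onto [e] along [e'], carried to [a] by the axis; it
    generates the left ideal of the morphisms with image in [e]. *)
Lemma inI_idem j e e' : (j < m)%N -> e <= b j -> e' <= b j -> e `&` e' <= bot ->
  b j <= e `|` e' -> exists s, [/\ rho j s = (c j `|` e') `&` (a `|` e), inI j e s &
    forall r, inI j e r -> (r * s)%R = r].
Proof.
move=> jm eb eb' ee1 ee2; set x := (c j `|` e') `&` (a `|` e).
have cl := hom_le (cab jm); have cb := hom_bot (cab jm); have cs := hom_src (cab jm).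
have cas := hom_src (cba jm).
have ab := abj jm.
have homx y : hom a (b j) y -> y <= a `|` e -> y <= y `|` e' -> (y `|` e') `&` (a `|` e) = y.
  move=> hy ya _; have yl := hom_le hy; have yb := hom_bot hy; have ys := hom_src hy.
  apply/esym; apply: (hom_eq hy); last by lat.
  apply: homI; [|lat|].
    have h1 : (y `|` e') `&` (a `|` e) `&` b j <= e'.
      by apply: (@le_mod0 _ _ y (b j)); lat.
    have h2 : (y `|` e') `&` (a `|` e) `&` b j <= e.
      by apply: (@le_mod0 _ _ a (b j)); lat.
    by lat.
  by lat.
have hx : hom a (b j) x.
  apply: homI; [|rewrite /x; lat|].
    have h1 : x `&` b j <= e' by apply: (@le_mod0 _ _ (c j) (b j)); rewrite /x; lat.
    have h2 : x `&` b j <= e by apply: (@le_mod0 _ _ a (b j)); rewrite /x; lat.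
    by lat.
  have : a <= e `|` x; last by move=> ?; lat.
  by apply: lle_trans (@le_mod _ e (c j `|` e') (a `|` e) _ _ _ _) _; rewrite /x; lat.
have [s es] := rho_surj jm hx; exists s; split=> //.
  by rewrite /inI es /x; lat.
move=> r hr; apply: (rho_inj jm).
have hrs : inI j e (r * s)%R by apply: inI_mul => //; rewrite /inI es /x; lat.
have h1 := rho_hom r jm; have h2 := rho_hom (r * s)%R jm.
rewrite /inI in hr hrs.
apply: (hom_eq h2 h1); rewrite -[X in _ <= X](homx _ h1) //; last by lat.
apply: lat_leI => //; have [k [km kj]] := other_index j.
have I := Iakj km jm kj.
rewrite (rho_mul _ _ km jm kj) -{2}[r]mulr1 (rho_mul _ _ km jm kj).
have hk := hom_le (rho_hom r km).
(* The shears along [s] and along 1 agree modulo [e'], hence so do [r * s] and [r]. *)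
have h3 : sgr k j s <= e' `|` sgr k j 1%R.
  rewrite /sgr es rho1 // /hcomp /x.
  by apply: lle_trans (@le_mod _ e' (c k `|` c j) (b k `|` b j) _ _ _ _) _; lat.
rewrite /hcomp.
by apply: lle_trans (@le_mod _ e' (rho k r `|` sgr k j 1%R) (a `|` b j) _ _ _ _) _; lat.
Qed.

(** An idempotent acts as the identity on its image, so right multiplication by [s] fixes each
    morphism with image there. *)
Lemma inI_of_idem j s : (j < m)%N -> (s * s = s)%R ->
  let e := (rho j s `|` a) `&` b j in forall r, inI j e r <-> (r * s)%R = r.
Proof.
move=> jm ss e r; have [k [km kj]] := other_index j.
have I := Iakj km jm kj; have hs := rho_hom s jm; have sl := hom_le hs.
have eb : e <= b j by rewrite /e; lat.
have se : rho j s <= a `|` e.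
  apply: lle_trans (@le_mod _ a (b j) (rho j s `|` a) _ _ _ _) _; [lat|lat|lat|].
  by rewrite /e; lat.
split=> [hr|<-]; last by apply: inI_mul.
apply: (rho_inj jm); apply/esym; apply: (hom_eq (rho_hom _ jm) (rho_hom _ jm)).
rewrite (rho_mul _ _ km jm kj); apply: lat_leI; last first.
  by have := hom_le (rho_hom r jm).
have hck := sgr_hom 1%R km jm kj; have ckl := hom_le hck; have cks := hom_src hck.
have ckb := hom_bot hck.
set t := sgr k j 1%R in hck ckl cks ckb.
have e1 q : rho j q = (rho k q `|` t) `&` (a `|` b j).
  by rewrite -{1}[q]mulr1 (rho_mul _ _ km jm kj).
have rkl q := hom_le (rho_hom q km); have rkb q := hom_bot (rho_hom q km).
pose ek := (rho k s `|` a) `&` b k.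
have h1 : rho k s `|` a <= a `|` ek.
  apply: lat_leU; last by lat.
  apply: lle_trans (@le_mod _ a (b k) (rho k s `|` a) _ _ _ _) _; [have := rkl s => ?; lat|lat|lat|].
  by rewrite /ek; lat.
have ekb : ek <= b k by rewrite /ek; lat.
(* The bound on the image is transported from [b j] to [b k] along the axis [t]. *)
have h2 : rho k r <= a `|` ek.
  have r1 : rho k r <= rho j r `|` t.
    have := e1 r => er; have rk := rkl r.
    apply: lle_trans (@le_mod _ t (a `|` b j) (rho k r `|` t) _ _ _ _) _; [lat|lat|lat|].
    by rewrite er; lat.
  rewrite /inI in hr.
  have r2 : rho k r <= (a `|` ek) `|` t.
    have s1 : rho j s <= rho k s `|` t by rewrite e1; lat.
    have h1' : rho k s <= a `|` ek by apply: lle_trans h1; lat.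
    have s2 : e <= a `|` ek `|` t by rewrite /e; lat.
    by lat.
  apply: (@le_mod0 _ _ t (a `|` b k)); [lat|have := rkl r => ?; lat|lat|].
  apply: lle_trans (_ : t `&` b k <= _).
    by apply: lat_leI; [lat|]; indm I [:: F; T; T] [:: T; T; F].
  have tk : t = hcomp (b k) (b j) (c k) (c j) by rewrite /t /sgr rho1.
  have cjk := cab jm; have cjb := hom_bot (cba jm); have cjl := hom_le cjk.
  have ckk := hom_bot (cab km); have ckkl := hom_le (cab km).
  have w1 : t `&` b k <= c k.
    apply: (@le_mod0 _ _ (c j) (a `|` b k)); rewrite ?tk /hcomp; [lat|lat|lat|].
    apply: lle_trans cjb; apply: lat_leI; [lat|].
    by indm I [:: T; F; T] [:: T; T; F].
  by apply: lle_trans ckk; lat.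
(* Since [s * s = s], the axis and the shear along [s] agree over the image of [s]. *)
have h3 : t `&` (ek `|` b j) <= sgr k j s.
  have s0 : sgr k j s <= b k `|` b j by exact: hom_le (sgr_hom s km jm kj).
  have d1 : rho j s <= rho k s `|` sgr k j s.
    have es := rho_mul s s km jm kj; rewrite ss in es.
    by rewrite {1}es /hcomp; lat.
  have d2 : t `&` (ek `|` b j) <= rho k s `|` rho j s.
    apply: lle_trans (@le_mod _ (rho k s) (a `|` b j) (rho k s `|` t) _ _ _ _) _; [|lat|lat|].
      have ekl : ek <= rho k s `|` a by rewrite /ek; lat.
      by lat.
    by rewrite (e1 s); lat.
  apply: (@le_mod0 _ _ (rho k s) (b k `|` b j)); [lat|lat|lat|].
  apply: lle_trans (rkb s); apply: lat_leI; [lat|].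
  by have := rkl s => ?; indm I [:: T; T; F] [:: F; T; T].
rewrite {1}(e1 r).
have h4 : t `&` (a `|` ek `|` b j) <= ek `|` b j.
  apply: (@le_mod0 _ _ a (b k `|` b j)); [lat|lat|lat|].
  by indm I [:: T; F; F] [:: F; T; T].
apply: lle_trans (@le_mod _ (rho k r) t (a `|` ek `|` b j) _ _ _ _) _; [lat|lat|lat|].
by apply: lat_leU; [lat|]; apply: lat_Ur; apply: lle_trans h3; lat.
Qed.

(* The graph of the row vector [(u 0, ..., u (k - 1))], from [x] to the sum of the [b j]
   for [j < k]. *)
Fixpoint graph x (val : nat -> R -> L) k u : L :=
  if k is k'.+1 then hpair (hh k') (b k') (graph x val k' u) (val k' (u k')) else x.

Lemma graph_ext x val k u v : (forall j, (j < k)%N -> u j = v j) ->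
  graph x val k u = graph x val k v.
Proof.
elim: k => //= k IH h; rewrite h // IH // => j hj.
by apply: h; apply: ltnW.
Qed.

Lemma graph_hom x val k u : (forall j, (j < k)%N -> indep [:: x; hh j; b j]) ->
  (forall j, (j < k)%N -> hom x (b j) (val j (u j))) -> hom x (hh k) (graph x val k u).
Proof.
elim: k => [|k IH] hI hu; first by apply: hom0; apply: lat_Ir; apply: lle_refl.
by apply: pair_hom; [apply: hI|apply: IH => j hj; [apply: hI|apply: hu]; apply: ltnW|apply: hu].
Qed.

Lemma graph_surj x val k z : (forall j, (j < k)%N -> indep [:: x; hh j; b j]) ->
  (forall j y, (j < k)%N -> hom x (b j) y -> exists r, val j r = y) ->
  hom x (hh k) z -> exists u, graph x val k u = z.
Proof.
elim: k z => [|k IH] z hI hs hz.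
  exists (fun=> 0%R); apply/esym; apply: (hom_eq hz); rewrite [graph _ _ _ _]/=; first by apply: hom0; apply: lat_Ir; apply: lle_refl.
  by have /= := hom_le hz => ?; lat.
have I := hI k (ltnSn k); have [h1 _] := pair_projl I hz; have [h2 _] := pair_projr I hz.
have [||u eu] := IH _ _ _ h1.
- by move=> j hj; apply: hI; apply: ltnW.
- by move=> j y hj; apply: hs; apply: ltnW.
have [r er] := hs k _ (ltnSn k) h2.
exists (fun j => if j == k then r else u j); rewrite [LHS]/= eqxx er [RHS](pairP I hz) -eu.
by congr hpair; apply: graph_ext => j hj; rewrite ltn_eqF.
Qed.

Definition gr := graph a rho.
(** The same rows with source [b k]: they describe how an element below the first [k + 1] members
    lies over [b k]. *)
Definition gs k := graph (b k) (sgr k).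

Lemma gr_hom k u : (k <= m)%N -> hom a (hh k) (gr k u).
Proof.
move=> km; apply: graph_hom => j hj; have jm := leq_trans hj km; first exact: Iahk.
exact: rho_hom.
Qed.

Lemma gr_surj k z : (k <= m)%N -> hom a (hh k) z -> exists u, gr k u = z.
Proof.
move=> km; apply: graph_surj => j; first by move=> hj; apply: Iahk (leq_trans hj km).
by move=> y hj; apply: rho_surj (leq_trans hj km).
Qed.

Lemma Ibhb k j : (j < k)%N -> (k < m)%N -> indep [:: b k; hh j; b j].
Proof. by move=> jk km; have /andP[_ /indep_swap2] := Iakjh jk km. Qed.

Lemma gs_hom k j u : (j <= k)%N -> (k < m)%N -> hom (b k) (hh j) (gs k j u).
Proof.
move=> jk km; apply: graph_hom => i hi; have ik := leq_trans hi jk; first exact: Ibhb.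
by apply: sgr_hom => //; [apply: ltn_trans km|rewrite gtn_eqF].
Qed.

Lemma gs_surj k z : (k < m)%N -> hom (b k) (hh k) z -> exists u, gs k k u = z.
Proof.
move=> km; apply: graph_surj => j; first by move=> hj; apply: Ibhb.
by move=> y hj; apply: sgr_surj => //; [apply: ltn_trans km|rewrite gtn_eqF].
Qed.

Lemma gr0 k : (k <= m)%N -> gr k (fun=> 0%R) = a.
Proof.
elim: k => // k IH km; rewrite /gr /= -/(gr k) IH ?(ltnW km) // rho0 //.
have I := Iahk km; apply: lle_anti; last by rewrite /hpair; lat.
by rewrite /hpair; indm I [:: T; F; T] [:: T; T; F].
Qed.

(** The move leaves [p + q * s] unchanged; by injectivity of [rho], this value and [q'] determine
    [p']. *)
Lemma rho_slide k j p q p' q' s t : (k < m)%N -> (j < m)%N -> k != j ->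
  q' = (q + t)%R -> p' = (p - t * s)%R ->
  (hpair (b k) (b j) (rho k q) (rho j p) `|` sgr k j s) `&` (rho k q' `|` b j)
    <= rho j p' `|` b k.
Proof.
move=> km jm kj eq' ep'; have I := Iakj km jm kj.
have hq := rho_hom q km; have hp := rho_hom p jm; have hs := sgr_hom s km jm kj.
have hq' := rho_hom q' km; have hP := pair_hom I hq hp.
set P := hpair _ _ _ _ in hP *; set X := P `|` _.
have Pl := hom_le hP; have Ps := hom_src hP; have Pb := hom_bot hP.
have sl := hom_le hs; have ss := hom_src hs; have sb := hom_bot hs.
have ql := hom_le hq'; have qs := hom_src hq'; have qb := hom_bot hq'.
set z := X `&` _.
have hz : hom a (b k `|` b j) z.
  apply: homI; [|rewrite /z /X; lat|].
    have h1 : z `&` (b k `|` b j) <= sgr k j s.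
      by apply: (@le_mod0 _ _ P (b k `|` b j)); rewrite /z /X; lat.
    have h2 : z `&` (b k `|` b j) <= b j.
      apply: (@le_mod0 _ _ (rho k q') (b k `|` b j)); [rewrite /z; lat|lat|lat|].
      by apply: lle_trans qb; apply: lat_leI; [lat|]; indm I [:: T; T; F] [:: F; T; T].
    by apply: lle_trans sb; lat.
  have h1 : rho k q' <= b j `|` z.
    have h3 : b k <= b j `|` X by rewrite /X; lat.
    have h4 : P <= X by rewrite /X; lat.
    have h5 : a <= b j `|` X by lat.
    have h2 : rho k q' <= b j `|` X by lat.
    by apply: lle_trans (@le_mod _ (b j) X (rho k q' `|` b j) _ _ _ _) _; rewrite /z; lat.
  by lat.
have [h1 h2] := pair_projr I hz.
have [r er] := rho_surj jm h1; rewrite -er in h1 h2.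
have ez : z = hpair (b k) (b j) (rho k q') (rho j r).
  by apply: (pair_eq I hq' h1 hz) => //; rewrite /z; lat.
have e1 := rhoT r q' s km jm kj; have e2 := rhoT p q s km jm kj.
have : rho j (r + q' * s)%R = rho j (p + q * s)%R.
  apply: (hom_eq (rho_hom _ jm) (rho_hom _ jm)); rewrite e1 e2 /tern -ez -/P -/X.
  by rewrite /z /X; lat.
move/(rho_inj jm) => e3.
have <- // : r = p'.
by rewrite ep' -[r](addrK (q' * s)%R) e3 eq' mulrDl opprD addrA addrK.
Qed.

Lemma gr_coord k u : (k < m)%N -> (gr k.+1 u `|` hh k) `&` (a `|` b k) = rho k (u k).
Proof.
move=> km; rewrite /gr /= -/(gr k u).
exact: pair_snd (Iahk km) (gr_hom u (ltnW km)) (rho_hom _ km).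
Qed.

Lemma gr_init k u : (k < m)%N -> (gr k.+1 u `|` b k) `&` (a `|` hh k) = gr k u.
Proof.
move=> km; rewrite /gr /= -/(gr k u).
exact: pair_fst (Iahk km) (gr_hom u (ltnW km)) (rho_hom _ km).
Qed.

(* Moving the last coordinate of [v] by [t] along the direction [s] inside the
   subspace spanned by the graph of [s], one coordinate at a time. *)
Lemma gr_slide_aux k j (s u v : nat -> R) (t : R) : (k < m)%N -> (j <= k)%N ->
  u k = (v k + t)%R -> (forall i, (i < k)%N -> u i = (v i - t * s i)%R) ->
  ((rho k (v k) `|` hh j) `&` (gr j v `|` b k) `|` gs k j s) `&` (rho k (u k) `|` hh j)
    <= gr j u `|` b k.
Proof.
move=> km + ek eu; elim: j => [|j IH] jk.
  by have := hom_le (rho_hom (u k) km); rewrite /gr /= => ?; lat.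
have := IH (ltnW jk); have jm := ltn_trans jk km; have kj : k != j by rewrite gtn_eqF.
have I := Iakjh jk km.
set A := (rho k (v k) `|` hh j) `&` (gr j v `|` b k) => C.
have ukl := hom_le (rho_hom (u k) km); have vkl := hom_le (rho_hom (v k) km).
have ujl := hom_le (rho_hom (u j) jm); have vjl := hom_le (rho_hom (v j) jm).
have gul := hom_le (gr_hom u (ltnW jm)); have gvl := hom_le (gr_hom v (ltnW jm)).
have gsl := hom_le (gs_hom s (ltnW jk) km); have sgl := hom_le (sgr_hom (s j) km jm kj).
have bV : b j `&` (a `|` b k `|` hh j) <= bot by indm I [:: F; F; T; F] [:: T; T; F; T].
have kV : b k `&` (a `|` b j `|` hh j) <= bot by indm I [:: F; T; F; F] [:: T; F; T; T].
have hV : hh j `&` (a `|` b k `|` b j) <= bot by indm I [:: F; F; F; T] [:: T; T; T; F].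
rewrite /gr /gs /= -/(gr j) -/(gs k j).
set G := hpair _ _ (gr j v) _; set S := hpair _ _ (gs k j s) _; set U := hpair _ _ (gr j u) _.
set W := _ `&` _.
have G1 : G <= gr j v `|` b j by rewrite /G /hpair; lat.
have G2 : G <= rho j (v j) `|` hh j by rewrite /G /hpair; lat.
have S1 : S <= gs k j s `|` b j by rewrite /S /hpair; lat.
have S2 : S <= sgr k j (s j) `|` hh j by rewrite /S /hpair; lat.
have A1 : (rho k (v k) `|` (hh j `|` b j)) `&` (G `|` b k) <= A `|` b j.
  by apply: (@join_meet _ _ _ _ (a `|` b k `|` hh j)); lat.
have B1 : (rho k (v k) `|` (hh j `|` b j)) `&` (G `|` b k) <=
    hpair (b k) (b j) (rho k (v k)) (rho j (v j)) `|` hh j.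
  by rewrite {1}/hpair; apply: (@join_meet _ _ _ _ (a `|` b k `|` b j)); lat.
have AV : A <= a `|` b k `|` hh j by rewrite /A; lat.
set P := hpair (b k) _ _ _ in B1.
have PV : P <= a `|` b k `|` b j by rewrite /P /hpair; lat.
have W1 : W <= gr j u `|` b j `|` b k.
  have : W <= (A `|` gs k j s) `&` (rho k (u k) `|` hh j) `|` b j.
    by apply: (@join_meet _ _ _ _ (a `|` b k `|` hh j)); rewrite /W; lat.
  by move/lle_trans; apply; apply: lat_leU; [apply: lle_trans C _|]; lat.
have W2 : W <= rho j (u j) `|` hh j `|` b k.
  have : W <= (P `|` sgr k j (s j)) `&` (rho k (u k) `|` b j) `|` hh j.
    by apply: (@join_meet _ _ _ _ (a `|` b k `|` b j)); rewrite /W; lat.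
  move/lle_trans; apply; apply: lat_leU; last by lat.
  by apply: lle_trans (rho_slide km jm kj ek (eu _ jk)) _; lat.
by rewrite /U /hpair; apply: (@join_meet _ _ _ _ (a `|` b j `|` hh j)); lat.
Qed.

(** The row with last coordinate [t] and other entries [- (t * s i)] lies on the graph of [s], and
    [t] in the ideal of [e] keeps it over [e]. *)
Lemma gr_slide k (s u v : nat -> R) (t : R) e : (k < m)%N -> e <= b k -> inI k e t ->
  u k = (v k + t)%R -> (forall i, (i < k)%N -> u i = (v i - t * s i)%R) ->
  gr k.+1 u <= gr k.+1 v `|` (gs k k s `&` (e `|` hh k)).
Proof.
move=> km eb et ek eu; have I := Iahk km.
have hs := gs_hom s (leqnn k) km; have ss := hom_src hs; have sb := hom_bot hs.
have sl := hom_le hs.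
have hu := gr_hom u km; have hv := gr_hom v km; rewrite [hh k.+1]/= in hu hv.
have vl := hom_le hv; have vb := hom_bot hv.
have hru := rho_hom (u k) km; have rul := hom_le hru; have rus := hom_src hru.
have rub := hom_bot hru.
have rv : rho k (v k) <= gr k.+1 v `|` hh k by rewrite -(gr_coord v km); lat.
have ruv : rho k (u k) <= rho k (v k) `|` e by rewrite rho_leP // ek addrC addKr.
set w := gs k k s `&` _; set z := (gr k.+1 v `|` w) `&` (rho k (u k) `|` hh k).
have wl : w <= b k `|` hh k by rewrite /w; lat.
have ew : e <= hh k `|` w.
  by apply: lle_trans (@le_mod _ (hh k) (gs k k s) (e `|` hh k) _ _ _ _) _; rewrite /w; lat.
have hz : hom a (hh k `|` b k) z.
  apply: homI; [|rewrite /z; lat|].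
    have h1 : z `&` (hh k `|` b k) <= w.
      by apply: (@le_mod0 _ _ (gr k.+1 v) (hh k `|` b k)); rewrite /z; lat.
    have h2 : z `&` (hh k `|` b k) <= hh k.
      apply: (@le_mod0 _ _ (rho k (u k)) (hh k `|` b k)); [rewrite /z; lat|lat|lat|].
      by apply: lle_trans rub; apply: lat_leI; [lat|]; indm I [:: T; F; T] [:: F; T; T].
    have h3 : w <= gs k k s by rewrite /w; lat.
    by apply: lle_trans sb; lat.
  have h1 : rho k (u k) <= hh k `|` z.
    have h2 : rho k (v k) <= hh k `|` (gr k.+1 v `|` w) by lat.
    have h3 : e <= hh k `|` (gr k.+1 v `|` w) by lat.
    by apply: lle_trans (@le_mod _ (hh k) (gr k.+1 v `|` w) (rho k (u k) `|` hh k) _ _ _ _) _;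
      rewrite /z; lat.
  by lat.
have <- : z = gr k.+1 u; last by rewrite /z; lat.
apply: (hom_eq hz hu); rewrite {1}/gr /= -/(gr k) {1}/hpair; apply: lat_leI; last by rewrite /z; lat.
apply: lle_trans (gr_slide_aux km (leqnn k) ek eu); rewrite /z /w /gr /= -/(gr k) /hpair.
by lat.
Qed.

(* The row vector [u] of length [k] belongs to the submodule [y] of [hh k]. *)
Definition inD k y u := gr k u <= a `|` y.

Lemma inD_ext k y u v : (forall j, (j < k)%N -> u j = v j) -> inD k y u = inD k y v.
Proof. by move=> h; rewrite /inD /gr (graph_ext _ _ h). Qed.

Lemma inI0 j e : (j < m)%N -> inI j e 0%R.
Proof. by move=> jm; rewrite /inI rho0 //; lat. Qed.

Lemma inI_opp j e r : (j < m)%N -> e <= b j -> inI j e r -> inI j e (- r)%R.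
Proof. by move=> jm eb hr; rewrite -sub0r; apply: inI_sub => //; apply: inI0. Qed.

Definition diff u v : nat -> R := fun j => (u j - v j)%R.

Lemma gr_le_coord k y u v : (k < m)%N -> y <= hh k.+1 ->
  gr k.+1 u <= gr k.+1 v `|` y ->
  rho k (u k) <= rho k (v k) `|` ((y `|` hh k) `&` b k).
Proof.
move=> km /= yh le; have I := Iahk km; set e := _ `&` b k.
have ye : y <= hh k `|` e.
  have h1 : b k `&` (y `|` hh k) <= e by rewrite /e; lat.
  by apply: lle_trans (@le_mod _ (hh k) (b k) (y `|` hh k) _ _ _ _) _; lat.
have vr : gr k.+1 v <= rho k (v k) `|` hh k by rewrite /gr /= /hpair; lat.
have rl := hom_le (rho_hom (v k) km); have eb : e <= b k by rewrite /e; lat.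
rewrite -(gr_coord u km); apply: (@le_mod0 _ _ (hh k) (a `|` b k)); [|lat|lat|].
  by lat.
by indm I [:: F; T; F] [:: T; F; T].
Qed.

Lemma gr_le_tail k y u v : (k < m)%N -> y <= hh k.+1 -> u k = v k ->
  (gr k.+1 u <= gr k.+1 v `|` y) = (gr k u <= gr k v `|` (y `&` hh k)).
Proof.
move=> km /= yh euv; have I := Iahk km.
have ul := hom_le (gr_hom u (ltnW km)); have vl := hom_le (gr_hom v (ltnW km)).
have hr := rho_hom (v k) km; have rl := hom_le hr; have rb := hom_bot hr.
apply/idP/idP => le.
  rewrite -(gr_init u km).
  have h1 : gr k.+1 u <= gr k.+1 v `|` (y `&` hh k).
    have h2 : gr k.+1 u <= rho k (v k) `|` hh k by rewrite /gr /= -euv /hpair; lat.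
    apply: lle_trans (@le_mod _ (gr k.+1 v) y (rho k (v k) `|` hh k) _ _ _ _) _; [lat|lat| |].
      by rewrite /gr /= /hpair; lat.
    apply: lat_leU; [lat|]; apply: lat_Ur; apply: lat_leI; first by lat.
    apply: (@le_mod0 _ _ (rho k (v k)) (hh k `|` b k)); [lat|lat|lat|].
    by apply: lle_trans rb; apply: lat_leI; [lat|]; indm I [:: T; F; T] [:: F; T; T].
  have h2 : gr k.+1 v <= gr k v `|` b k by rewrite /gr /= /hpair; lat.
  apply: (@le_mod0 _ _ (b k) (a `|` hh k)); [lat|lat|lat|].
  by indm I [:: F; F; T] [:: T; T; F].
rewrite {1}/gr /= -/(gr k) euv.
apply: lle_trans (_ : (y `&` hh k) `|` ((gr k v `|` b k) `&` (rho k (v k) `|` hh k)) <= _).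
  by rewrite /hpair; apply: le_mod; lat.
by rewrite {2}/gr /= -/(gr k) /hpair; lat.
Qed.

Lemma gr_le_step k y (s u v : nat -> R) : (k < m)%N ->
  (forall y u v, y <= hh k -> (gr k u <= gr k v `|` y) = inD k y (diff u v)) ->
  let e := (y `|` hh k) `&` b k in
  y <= hh k.+1 -> gs k k s `&` (e `|` hh k) <= y ->
  (gr k.+1 u <= gr k.+1 v `|` y) =
  inI k e (u k - v k)%R &&
    inD k (y `&` hh k) (fun j => u j - v j + (u k - v k) * s j)%R.
Proof.
move=> km IH e yh sy; set t := (u k - v k)%R.
have eb : e <= b k by rewrite /e; lat.
(* [w] is [v] moved along the graph of [s] until it has the last coordinate of [u]. It is congruent
   to [v] modulo [y], so only the tails of [u] and [w] remain to be compared. *)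
pose w j : R := if j == k then u k else (v j - t * s j)%R.
have wk : w k = u k by rewrite /w eqxx.
have wj j : (j < k)%N -> w j = (v j - t * s j)%R by move=> h; rewrite /w ltn_eqF.
have main : inI k e t -> (gr k.+1 u <= gr k.+1 v `|` y) =
    inD k (y `&` hh k) (fun j => u j - v j + t * s j)%R.
  move=> ht.
  have s1 : gr k.+1 w <= gr k.+1 v `|` y.
    apply: lle_trans (gr_slide (v := v) km eb ht _ wj) _; last by lat.
    by rewrite wk /t addrC subrK.
  have s2 : gr k.+1 v <= gr k.+1 w `|` y.
    apply: lle_trans (gr_slide (s := s) (v := w) km eb (inI_opp km eb ht) _ _) _; last by lat.
      by rewrite wk /t opprB addrC subrK.
    by move=> i hi; rewrite wj // mulNr opprK subrK.
  have -> : (gr k.+1 u <= gr k.+1 v `|` y) = (gr k.+1 u <= gr k.+1 w `|` y).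
    by apply/idP/idP => h; lat.
  rewrite gr_le_tail // IH; last by lat.
  by apply: inD_ext => j hj; rewrite /diff wj // opprB addrCA addrC.
apply/idP/andP => [h|[h1 h2]]; last by rewrite main.
have ht : inI k e t by rewrite /inI -rho_leP //; apply: gr_le_coord.
by rewrite -main.
Qed.

Lemma gs_split k y : (k < m)%N -> y <= hh k.+1 -> exists s : nat -> R,
  let w := gs k k s `&` ((y `|` hh k) `&` b k `|` hh k) in
  w <= y /\ y <= (y `&` hh k) `|` w.
Proof.
move=> km /= yh; have [|z [hz h1 h2]] := hom_split (bhh km) (_ : y <= b k `|` hh k).
  by lat.
by have [s es] := gs_surj km hz; exists s; rewrite es.
Qed.

(** Congruence modulo [y] depends only on the difference, because [gr_le_step] gives the same
    conditions for [u] against [v] as for [diff u v] against 0. *)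
Lemma gr_leP k y u v : (k <= m)%N -> y <= hh k ->
  (gr k u <= gr k v `|` y) = inD k y (diff u v).
Proof.
elim: k y u v => [|k IH] y u v km yh; first by rewrite /inD /gr /=; apply/idP/idP => _; lat.
have [s [h1 h2]] := gs_split km yh.
have IH' y' u' v' := @IH y' u' v' (ltnW km).
rewrite (gr_le_step u v km IH' yh h1).
have -> (w : nat -> R) : inD k.+1 y w = (gr k.+1 w <= gr k.+1 (fun=> 0%R) `|` y) by rewrite /inD gr0.
rewrite (gr_le_step _ _ km IH' yh h1) /diff subr0; congr (_ && _).
by apply: inD_ext => j _; rewrite subr0.
Qed.

(** The lattice counterpart of [fgen_cons], and the induction step that matches lattice elements
    with finitely generated modules. *)
Lemma inD_step k y (s u : nat -> R) : (k < m)%N -> y <= hh k.+1 ->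
  let e := (y `|` hh k) `&` b k in gs k k s `&` (e `|` hh k) <= y ->
  inD k.+1 y u = inI k e (u k) && inD k (y `&` hh k) (fun j => u j + u k * s j)%R.
Proof.
move=> km yh e h.
have -> : inD k.+1 y u = (gr k.+1 u <= gr k.+1 (fun=> 0%R) `|` y) by rewrite /inD gr0.
rewrite (gr_le_step _ _ km _ yh h) ?subr0; last by move=> y' u' v' ?; apply: gr_leP => //; apply: ltnW.
by congr (_ && _); apply: inD_ext => j _; rewrite subr0.
Qed.

Lemma inD0 k y : (k <= m)%N -> inD k y (fun=> 0%R).
Proof. by move=> km; rewrite /inD gr0 //; lat. Qed.

Lemma inD_src k y u : (k <= m)%N -> y <= hh k -> inD k y u -> a <= gr k u `|` y.
Proof.
rewrite /inD => km yh le; have us := hom_src (gr_hom u km); have ah := ahh km.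
apply: lle_trans (@le_mod _ (gr k u) (hh k) (a `|` y) _ _ _ _) _; [lat|lat|lat|].
apply: lat_leU; first by lat.
by apply: lat_Ur; apply: (@le_mod0 _ _ a (hh k)); lat.
Qed.

Lemma inD_diff k y u v : (k <= m)%N -> y <= hh k -> inD k y u -> inD k y v ->
  inD k y (diff u v).
Proof.
move=> km yh hu hv; rewrite -gr_leP //.
by have := inD_src km yh hv; rewrite /inD in hu => ?; lat.
Qed.

Lemma inD_mul k y r u : (k <= m)%N -> y <= hh k -> inD k y u ->
  inD k y (fun j => r * u j)%R.
Proof.
elim: k y u => [|k IH] y u km yh; first by rewrite /inD /gr.
have [s [sy _]] := gs_split km yh; rewrite !(inD_step _ km yh sy) => /andP[h1 h2].
apply/andP; split; first by apply: inI_mul => //; lat.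
have yk : y `&` hh k <= hh k by lat.
have := IH _ _ (ltnW km) yk h2; rewrite (@inD_ext k _ _ (fun j => r * u j + r * u k * s j)%R) //.
by move=> j _; rewrite mulrDr mulrA.
Qed.

Lemma inD_le k y z u : y <= z -> inD k y u -> inD k z u.
Proof. by rewrite /inD => h1 h2; lat. Qed.

Lemma gr_inj k u v : (k <= m)%N -> gr k u = gr k v -> forall j, (j < k)%N -> u j = v j.
Proof.
elim: k => // k IH km e j; rewrite ltnS leq_eqVlt => /predU1P[->|].
  by apply: (rho_inj km); rewrite -!gr_coord // e.
by apply: IH; [apply: ltnW|rewrite -(gr_init u km) -(gr_init v km) e].
Qed.

Lemma inI_compl j e : (j < m)%N -> e <= b j -> exists s,
  [/\ (s * s = s)%R, e <= rho j s `|` a & forall r, inI j e r <-> (r * s = r)%R].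
Proof.
move=> jm eb; have [e' [h1 h2 h3]] := rel_compl eb.
have [s [es hs hI]] := inI_idem jm eb h2 h1 h3; exists s.
split; [exact: hI| |].
  have cs := hom_src (cba jm); rewrite es.
  have h : e <= a `|` ((c j `|` e') `&` (a `|` e)).
    by apply: lle_trans (@le_mod _ a (c j `|` e') (a `|` e) _ _ _ _) _; lat.
  by lat.
by move=> r; split=> [/hI//|<-]; apply: inI_mul.
Qed.

(** Tested on the idempotent generating the ideal of [e1], whose image contains [e1]. *)
Lemma inI_le j e1 e2 : (j < m)%N -> e1 <= b j -> e2 <= b j ->
  (forall r, inI j e1 r -> inI j e2 r) -> e1 <= e2.
Proof.
move=> jm h1 h2 h; have [s [ss es hs]] := inI_compl jm h1.
have := h s (proj2 (hs s) ss); rewrite /inI => le; have ab := abj jm.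
by apply: (@le_mod0 _ _ a (b j)); lat.
Qed.

Lemma inD_bot k y : (k <= m)%N -> y <= hh k ->
  (forall u, inD k y u -> forall j, (j < k)%N -> u j = 0%R) -> y <= bot.
Proof.
elim: k y => [|k IH] y km yh h //.
have [s [sy ys]] := gs_split km yh; move: sy ys.
set e := _ `&` b k => sy ys; have eb : e <= b k by rewrite /e; lat.
have e0 : e <= bot.
  apply: (inI_le km) => // [|r hr]; first by lat.
  suff -> : r = 0%R by apply: inI0.
  have : inD k.+1 y (fun j => if j == k then r else (- (r * s j))%R).
    rewrite (inD_step _ km yh sy) eqxx hr /= (@inD_ext k _ _ (fun=> 0%R)) ?inD0 ?(ltnW km) //.
    by move=> j hj; rewrite ltn_eqF // addNr.
  by move/h => /(_ k (ltnSn k)); rewrite eqxx.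
have y0 : y `&` hh k <= bot.
  apply: IH; [exact: ltnW|lat|] => u hu j hj.
  have : inD k.+1 y (fun j => if j == k then 0%R else u j).
    rewrite (inD_step _ km yh sy) eqxx inI0 //=.
    rewrite (@inD_ext k _ _ u) // => i hi; by rewrite ltn_eqF // mul0r addr0.
  by move/h => /(_ j (ltnW hj)); rewrite ltn_eqF.
have sb := hom_bot (gs_hom s (leqnn k) km).
have w0 : gs k k s `&` (e `|` hh k) <= bot by apply: lle_trans sb; lat.
by lat.
Qed.

(** Let [w] be a complement in [y] of the meet of [y] and [z]. Its rows also lie in [z], so they
    vanish, and by [inD_bot] an element without nonzero rows is [bot]. *)
Lemma inD_reflect k y z : (k <= m)%N -> y <= hh k -> z <= hh k ->
  (forall u, inD k y u -> inD k z u) -> y <= z.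
Proof.
move=> km yh zh h; have [w [w1 w2 w3]] := rel_compl (lat_Il z (lle_refl y)).
have ah := ahh km.
suff w0 : w <= bot by lat.
apply: (inD_bot km); first by lat.
move=> u hu; have uz := h u (inD_le w2 hu); rewrite /inD in hu uz.
have zz : w `&` (a `|` z) <= z by apply: (@le_mod0 _ _ a (hh k)); lat.
have ua : gr k u <= a.
  apply: lle_trans (@le_mod _ a w (a `|` z) _ _ _ _) _; [lat|lat|lat|].
  have : w `&` (a `|` z) <= bot by apply: lle_trans w1; lat.
  by move=> ?; lat.
rewrite -(gr0 km) in ua.
have e0 := hom_eq (gr_hom u km) (gr_hom _ km) ua.
exact: gr_inj km e0.
Qed.

Lemma inD_fgen k y : (k <= m)%N -> y <= hh k -> fgen k (inD k y).
Proof.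
elim: k y => [|k IH] y km yh.
  by apply: fgen0 => v; rewrite /inD /gr /=; lat.
have [s [sy _]] := gs_split km yh; move: sy; set e := _ `&` b k => sy.
have eb : e <= b k by rewrite /e; lat.
have [t [tt _ ht]] := inI_compl km eb.
have yk : y `&` hh k <= hh k by lat.
apply: (fgen_cons tt (IH _ (ltnW km) yk) (s := s)) => v.
rewrite (inD_step _ km yh sy); split=> [/andP[/ht]//|[h1 h2]].
by apply/andP; split=> //; apply/ht.
Qed.

Lemma fgen_inD k M : (k <= m)%N -> fgen k M ->
  exists2 y, y <= hh k & forall v, M v <-> inD k y v.
Proof.
elim: k M => [|k IH] M km.
  case=> N [X hX]; exists bot => [|v]; first by lat.
  rewrite /inD /gr /=; split=> _; first by lat.
  by apply/hX; exists (fun=> 0%R).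
case/(fgen_uncons R_regular) => t [s [Y [tt fY hM]]].
have [y1 y1h hy1] := IH _ (ltnW km) fY.
set e := (rho k t `|` a) `&` b k; have eb : e <= b k by rewrite /e; lat.
have he r : inI k e r <-> (r * t = r)%R := inI_of_idem km tt r.
have hs := gs_hom s (leqnn k) km; have sl := hom_le hs.
have [] := hom_build (bhh km) y1h eb hs; set y := y1 `|` _ => e1 e2.
have yh : y <= hh k.+1 by rewrite /y /=; lat.
exists y => // v; rewrite (inD_step (s := s) _ km yh); last by rewrite e2 /y; lat.
rewrite e1 e2; split=> [/hM[/he-> /hy1]//|/andP[/he h1 /hy1 h2]].
exact/hM.
Qed.

(** * The last coordinate, carried by [a] *)

Let m_gt0 : (0 < m)%N := ltnW m_gt1.

(* Transports subobjects of [a] to [b 0] along the axis [c 0]. *)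
Definition tob x := (x `|` c 0) `&` b 0.
(** The maps [rho j] give no graph from [a] to itself, so the ideal attached to a part of [a] is
    read at index 0. *)
Definition inA e r := inI 0 (tob e) r.

Lemma tob_le x : tob x <= b 0. Proof. by rewrite /tob; lat. Qed.

Lemma tobK e : e <= a -> (tob e `|` c 0) `&` a = e.
Proof.
move=> ea; have c1 := hom_le (cba m_gt0); have c2 := hom_bot (cba m_gt0).
have c3 := hom_src (cab m_gt0).
have h : e <= c 0 `|` tob e.
  by apply: lle_trans (@le_mod _ (c 0) (b 0) (e `|` c 0) _ _ _ _) _; rewrite /tob; lat.
apply: lle_anti; last by lat.
by apply: (@le_mod0 _ _ (c 0) a); rewrite /tob; lat.
Qed.

Lemma tob_surj e : e <= b 0 -> tob ((e `|` c 0) `&` a) = e.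
Proof.
move=> eb; have c1 := hom_le (cab m_gt0); have c2 := hom_bot (cab m_gt0).
have c3 := hom_src (cba m_gt0).
have h : e <= c 0 `|` ((e `|` c 0) `&` a).
  by apply: lle_trans (@le_mod _ (c 0) a (e `|` c 0) _ _ _ _) _; lat.
apply: lle_anti; last by rewrite /tob; lat.
by apply: (@le_mod0 _ _ (c 0) (b 0)); rewrite /tob; lat.
Qed.

Lemma inA_le e1 e2 : e1 <= a -> e2 <= a ->
  (forall r, inA e1 r -> inA e2 r) <-> e1 <= e2.
Proof.
move=> h1 h2; split=> [h|h r].
  have := inI_le m_gt0 (tob_le e1) (tob_le e2) h.
  by rewrite -{2}(tobK h1) -{2}(tobK h2) => ?; lat.
have : tob e1 <= tob e2 by rewrite /tob; lat.
by rewrite /inA /inI => ? ?; lat.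
Qed.

Lemma inA_of_idem s : (s * s = s)%R -> exists2 e, e <= a &
  forall r, inA e r <-> (r * s = r)%R.
Proof.
move=> ss; set e0 := (rho 0 s `|` a) `&` b 0; have e0b : e0 <= b 0 by rewrite /e0; lat.
exists ((e0 `|` c 0) `&` a); first by lat.
by move=> r; rewrite /inA tob_surj //; apply: inI_of_idem.
Qed.

(** [s] is the projection of [a] onto [e] along [f]. The last clause expresses this at every target:
    the graph of [s] agrees with that of 1 over [e] and with that of 0 over [f]. *)
Lemma inA_compl e f : e <= a -> f <= a -> e `&` f <= bot -> a <= e `|` f -> exists s,
  [/\ (s * s = s)%R, forall r, inA e r <-> (r * s = r)%R &
    forall k, (k < m)%N -> c k `&` (e `|` b k) <= rho k s /\ f <= rho k s].
Proof.
move=> ea fa ef aef.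
have c1 := hom_le (cab m_gt0); have c2 := hom_bot (cab m_gt0).
have c3 := hom_src (cba m_gt0); have c4 := hom_bot (cba m_gt0); have c5 := hom_src (cab m_gt0).
have te : tob e <= b 0 := tob_le e; have tf : tob f <= b 0 := tob_le f.
have e1 : e <= c 0 `|` tob e.
  by apply: lle_trans (@le_mod _ (c 0) (b 0) (e `|` c 0) _ _ _ _) _; rewrite /tob; lat.
have f1 : f <= c 0 `|` tob f.
  by apply: lle_trans (@le_mod _ (c 0) (b 0) (f `|` c 0) _ _ _ _) _; rewrite /tob; lat.
have tef : tob e `&` tob f <= bot.
  apply: lle_trans c2; apply: lat_leI; last by lat.
  have : tob e `&` tob f <= (e `&` f) `|` c 0.
    by apply: (@join_meet _ _ _ _ a) => //; rewrite /tob; lat.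
  by move/lle_trans; apply; lat.
have atef : a <= tob e `|` tob f `|` c 0 by lat.
have btef : b 0 <= tob e `|` tob f by apply: (@le_mod0 _ _ (c 0) (b 0)); lat.
have [s [es hs hI]] := inI_idem m_gt0 te tf tef btef.
have ss : (s * s = s)%R := hI s hs; exists s; split=> //.
  by move=> r; split=> [/hI//|<-]; apply: inI_mul => //; apply: tob_le.
have base : c 0 `&` (e `|` b 0) <= rho 0 s /\ f <= rho 0 s.
  rewrite es; split; apply: lat_leI; try lat.
  apply: lle_trans (@le_mod _ e (b 0) (e `|` c 0) _ _ _ _) _; [lat|lat|lat|].
  by rewrite /tob; lat.
case=> [//|k] km; have [b1 b2] := base.
(* The other targets are reached from index 0 by writing [s] as [s * 1]. *)
have -> : rho k.+1 s = hcomp a (b k.+1) (rho 0 s) (sgr 0 k.+1 1%R).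
  by rewrite -[in LHS](mulr1 s) (rho_mul _ _ m_gt0 km).
rewrite /hcomp; split; apply: lat_leI; [|by have := hom_le (cab km) => ?; lat|lat|lat].
have ckl := hom_le (cab km).
have h : c k.+1 `&` (e `|` b k.+1) <= c 0 `&` (e `|` b 0) `|` sgr 0 k.+1 1%R.
  have e2 : e <= b 0 `|` (c 0 `&` (e `|` b 0)).
    by apply: lle_trans (@le_mod _ (b 0) (c 0) (e `|` b 0) _ _ _ _) _; lat.
  apply: lle_trans (@le_mod _ (c 0 `&` (e `|` b 0)) (b 0 `|` b k.+1)
    (c 0 `|` c k.+1) _ _ _ _) _; [lat|lat|lat|].
  by rewrite /sgr rho1 // /hcomp; lat.
by lat.
Qed.

Lemma rho_res k j e p q q' s : (k < m)%N -> (j < m)%N -> k != j -> e <= a ->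
  rho k q `&` (e `|` b k) <= rho k q' ->
  rho j (p + q * s)%R `&` (e `|` b j) <= rho j (p + q' * s)%R.
Proof.
move=> km jm kj ea h; have I := Iakj km jm kj.
have sl := hom_le (sgr_hom s km jm kj); have ql := hom_le (rho_hom q km).
have pl := hom_le (rho_hom p jm).
have jV : b j `&` (a `|` b k) <= bot by indm I [:: F; F; T] [:: T; T; F].
rewrite !(rhoT _ _ _ km jm kj) /tern; apply: lat_leI; last by lat.
set P := hpair _ _ (rho k q) _; set P' := hpair _ _ _ _.
have h1 : P `&` (e `|` b k `|` b j) <= P'.
  rewrite /P' /hpair; apply: lat_leI; last by rewrite /P /hpair; lat.
  have : P `&` (e `|` b k `|` b j) <= (rho k q `&` (e `|` b k)) `|` b j.
    by apply: (@join_meet _ _ _ _ (a `|` b k)); rewrite /P /hpair; lat.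
  by move/lle_trans; apply; lat.
apply: lle_trans (@le_mod _ (sgr k j s) P (e `|` b k `|` b j) _ _ _ _) _; lat.
Qed.

Lemma gr_res k e u v : (k <= m)%N -> e <= a ->
  (forall j, (j < k)%N -> rho j (u j) `&` (e `|` b j) <= rho j (v j)) ->
  gr k u `&` (e `|` hh k) <= gr k v.
Proof.
elim: k => [|k IH] km ea h; first by rewrite /gr /=; lat.
have := IH (ltnW km) ea (fun j hj => h j (ltnW hj)); have hk := h k (ltnSn k) => {}IH.
have I := Iahk km.
have ul := hom_le (gr_hom u (ltnW km)); have rl := hom_le (rho_hom (u k) km).
have bV : b k `&` (a `|` hh k) <= bot by indm I [:: F; F; T] [:: T; T; F].
have hV : hh k `&` (a `|` b k) <= bot by indm I [:: F; T; F] [:: T; F; T].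
rewrite /gr /= -/(gr k) /hpair; set W := _ `&` (e `|` _); apply: lat_leI.
  have : W <= (gr k u `&` (e `|` hh k)) `|` b k.
    by apply: (@join_meet _ _ _ _ (a `|` hh k)); rewrite /W; lat.
  by move/lle_trans; apply; lat.
have : W <= (rho k (u k) `&` (e `|` b k)) `|` hh k.
  by apply: (@join_meet _ _ _ _ (a `|` b k)); rewrite /W; lat.
by move/lle_trans; apply; lat.
Qed.

(* With [s] the projection of [a] onto [e] along [f], the row [v + s (u - v)] has
   the graph of [u] over [e] and that of [v] over [f]. *)
Lemma gr_res_leP e f s y u v : e <= a -> f <= a -> e `&` f <= bot -> a <= e `|` f ->
  (forall k, (k < m)%N -> c k `&` (e `|` b k) <= rho k s /\ f <= rho k s) -> y <= hh m ->
  (gr m u `&` (e `|` hh m) <= gr m v `|` y) = inD m y (fun j => s * (u j - v j))%R.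
Proof.
move=> ea fa ef aef hs yh; pose w j : R := (v j + s * (u j - v j))%R.
have h1 : gr m u `&` (e `|` hh m) <= gr m w.
  apply: gr_res => // j jm; have [k [km kj]] := other_index j.
  rewrite -{1}[u j](subrKC (v j)) -{1}[(u j - v j)%R]mul1r.
  by apply: (rho_res _ _ km jm kj ea); rewrite rho1 //; case: (hs k km).
have h2 : gr m v `&` (f `|` hh m) <= gr m w.
  apply: gr_res => // j jm; have [k [km kj]] := other_index j.
  rewrite -{1}[v j]addr0 -(mul0r (u j - v j)%R).
  apply: (rho_res _ _ km jm kj fa); rewrite rho0 //; have [_ fs] := hs k km.
  apply: lle_trans fs; apply: (@le_mod0 _ _ (b k) a); [lat|lat|lat|].
  by rewrite lmeetC; apply: abj.
have hu := gr_hom u (leqnn m); have hv := gr_hom v (leqnn m); have hw := gr_hom w (leqnn m).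
have us := hom_src hu; have vs := hom_src hv; have wb := hom_bot hw; have wl := hom_le hw.
set z := gr m u `&` (e `|` hh m) `|` gr m v `&` (f `|` hh m).
have ez : z = gr m w.
  apply: (hom_eq _ hw); last by rewrite /z; lat.
  have zw : z <= gr m w by rewrite /z; lat.
  apply: homI; [by apply: lle_trans wb; lat|lat|].
  have e1 : e <= hh m `|` z.
    by apply: lle_trans (@le_mod _ (hh m) (gr m u) (e `|` hh m) _ _ _ _) _; rewrite /z; lat.
  have f1 : f <= hh m `|` z.
    by apply: lle_trans (@le_mod _ (hh m) (gr m v) (f `|` hh m) _ _ _ _) _; rewrite /z; lat.
  by lat.
have -> : (gr m u `&` (e `|` hh m) <= gr m v `|` y) = (gr m w <= gr m v `|` y).
  by rewrite -ez; apply/idP/idP => h; [rewrite /z|rewrite /z in h]; [lat|apply: lle_trans h; lat].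
by rewrite gr_leP //; apply: inD_ext => j _; rewrite /diff /w addrC addKr.
Qed.

Hypothesis ah_top : forall x, x <= a `|` hh m.

Definition tip x := (x `|` hh m) `&` a.
(* The graph of [u], restricted to the projection of [x] on [a], lies in [x]; so [x] consists
   of the rows [(t, w)] with [t] in [tip x] and [w + t u] in [x]. *)
Definition axisOf x u := gr m u `&` (tip x `|` hh m) <= x.
Definition shear u v : nat -> R := fun j => (u j + u m * v j)%R.
(** The coordinate along [a] is stored at index [m]. The axis is quantified existentially to avoid a
    choice; [PsiP] shows that any axis serves. *)
Definition Psi x u := inA (tip x) (u m) /\
  exists2 v, axisOf x v & inD m (x `&` hh m) (shear u v).

Lemma tip_le x : tip x <= a. Proof. by rewrite /tip; lat. Qed.

Lemma axis_ex x : exists v, axisOf x v.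
Proof.
have [z [hz z1 _]] := hom_split (ahh (leqnn m)) (ah_top x).
by have [v ev] := gr_surj (leqnn m) hz; exists v; rewrite /axisOf ev.
Qed.

Lemma axis_le x v : axisOf x v -> x <= (x `&` hh m) `|` (gr m v `&` (tip x `|` hh m)).
Proof.
rewrite /axisOf => h; have vs := hom_src (gr_hom v (leqnn m)).
set w := gr m v `&` _ in h *.
have tb : tip x <= a := tip_le x.
have xt : x <= hh m `|` tip x.
  have xa := ah_top x.
  by apply: lle_trans (@le_mod _ (hh m) a (x `|` hh m) _ _ _ _) _; rewrite /tip; lat.
have tw : tip x <= hh m `|` w.
  by apply: lle_trans (@le_mod _ (hh m) (gr m v) (tip x `|` hh m) _ _ _ _) _; rewrite /w; lat.
by apply: lle_trans (@le_mod _ w (hh m) x _ _ _ _) _; lat.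
Qed.

(** Only the restrictions of the axes to [tip x] matter, and multiplication by the projection [s]
    onto [tip x] expresses this restriction in the ring. *)
Lemma axis_leP x z u v : tip x <= tip z -> axisOf x u -> axisOf z v -> x `&` hh m <= z ->
  exists s, [/\ inA (tip x) s, forall r, inA (tip x) r -> (r * s = r)%R &
    (x <= z) = inD m (z `&` hh m) (fun j => s * (u j - v j))%R].
Proof.
move=> txz hu hv xhz; have tx := tip_le x; have tz := tip_le z.
have [f [f1 f2 f3]] := rel_compl tx.
have [s [ss sI hs]] := inA_compl tx f2 f1 f3; exists s; split; [exact/sI|by move=> r /sI|].
have yh : z `&` hh m <= hh m by lat.
rewrite -(gr_res_leP u v tx f2 f1 f3 hs yh).
have xu := axis_le hu; have zv := axis_le hv; rewrite /axisOf in hu hv.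
apply/idP/idP => h; last first.
  set t := gr m u `&` _ in hu xu h.
  suff tz' : t <= z by lat.
  have t1 : t <= z `&` hh m `|` gr m v by lat.
  have t2 : t <= tip x `|` hh m by rewrite /t; lat.
  apply: lle_trans (@le_mod _ (z `&` hh m) (gr m v) (tip x `|` hh m) _ _ _ _) _; [lat|lat|lat|].
  by apply: lat_leU; [lat|]; apply: lle_trans hv; lat.
apply: lle_trans hu _; apply: lle_trans h _; apply: lle_trans zv _; lat.
Qed.

Lemma PsiP x u v : axisOf x v -> Psi x u <-> inA (tip x) (u m) /\ inD m (x `&` hh m) (shear u v).
Proof.
move=> hv; split=> [[h1 [w hw h2]]|[h1 h2]]; last by split=> //; exists v.
split=> //; have xx : x `&` hh m <= x by lat.
(* Comparing [x] with itself through two of its axes shows that [s] times their difference is a row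
   of [x]. *)
have [s [_ hs]] := axis_leP (lle_refl (tip x)) hw hv xx.
rewrite lle_refl => /esym h3.
have xh : x `&` hh m <= hh m by lat.
have := inD_diff (leqnn m) xh h2 (inD_mul (u m) (leqnn m) xh h3).
rewrite (@inD_ext m _ _ (shear u v)) // => j _.
by rewrite /diff /shear mulrA hs // mulrBr opprB -addrA subrKC.
Qed.

Lemma Psi_le x z : x <= z <-> (forall u, Psi x u -> Psi z u).
Proof.
have [p hp] := axis_ex x; have [q hq] := axis_ex z.
have xh : x `&` hh m <= hh m by lat.
have zh : z `&` hh m <= hh m by lat.
split=> [xz u|h].
  have txz : tip x <= tip z by rewrite /tip; lat.
  have xhz : x `&` hh m <= z by lat.
  have xzh : x `&` hh m <= z `&` hh m by lat.
  have [s [_ hs e]] := axis_leP txz hp hq xhz; rewrite xz in e; move/esym: e => e.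
  case/(PsiP u hp) => h1 h2; apply/(PsiP u hq).
  split; first exact: (proj2 (inA_le (tip_le x) (tip_le z)) txz).
  have := inD_diff (leqnn m) zh (inD_le xzh h2) (inD_mul (u m) (leqnn m) zh e).
  rewrite (@inD_ext m _ _ (shear u q)) // => j _.
  by rewrite /diff /shear mulrA hs // mulrBr opprB -addrA subrKC.
(* Test rows: those with last coordinate 0 detect the part of [x] below [hh m]; those with last
   coordinate [r] and entries [- (r * p j)] lie on the axis and detect the tip and the axis. *)
pose ext v r : nat -> R := fun j => if j == m then r else v j.
have extm v r : ext v r m = r by rewrite /ext eqxx.
have extj v r j : (j < m)%N -> ext v r j = v j by move=> hj; rewrite /ext ltn_eqF.
have xhz : x `&` hh m <= z.
  suff : x `&` hh m <= z `&` hh m by move=> ?; lat.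
  apply: (inD_reflect (leqnn m)) => // v hv.
  have : Psi x (ext v 0%R).
    apply/(PsiP _ hp); split; first by rewrite extm; apply: inI0.
    by rewrite (@inD_ext m _ _ v) // => j hj; rewrite /shear extm extj // mul0r addr0.
  move/h/(PsiP _ hq) => [_].
  by rewrite (@inD_ext m _ _ v) // => j hj; rewrite /shear extm extj // mul0r addr0.
have row r : inA (tip x) r -> Psi x (ext (fun j => - (r * p j))%R r).
  move=> hr; apply/(PsiP _ hp); split; first by rewrite extm.
  rewrite (@inD_ext m _ _ (fun=> 0%R)) ?inD0 // => j hj.
  by rewrite /shear extm extj // addNr.
have txz : tip x <= tip z.
  by apply/(inA_le (tip_le x) (tip_le z)) => r /row/h/(PsiP _ hq) []; rewrite extm.
have [s [hs _ ->]] := axis_leP txz hp hq xhz.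
have := row s hs => /h/(PsiP _ hq) [_] h2.
have := inD_mul (-1)%R (leqnn m) zh h2.
rewrite (@inD_ext m _ _ (fun j => s * (p j - q j))%R) // => j hj.
by rewrite /shear extm extj // mulN1r opprD opprK mulrBr.
Qed.

Lemma Psi_fgen x : fgen m.+1 (Psi x).
Proof.
have [p hp] := axis_ex x; have tx := tip_le x; have [f [f1 f2 f3]] := rel_compl tx.
have [s [ss sI _]] := inA_compl tx f2 f1 f3.
have xh : x `&` hh m <= hh m by lat.
apply: (fgen_cons ss (inD_fgen (leqnn m) xh) (s := p)) => v.
by split=> [/(PsiP _ hp)[/sI]//|[/sI h1 h2]]; apply/(PsiP _ hp).
Qed.

Lemma fgen_Psi M : fgen m.+1 M -> exists x, forall v, M v <-> Psi x v.
Proof.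
case/(fgen_uncons R_regular) => t [s [Y [tt fY hM]]].
have [y yh hy] := fgen_inD (leqnn m) fY.
have [e ea he] := inA_of_idem tt.
have [] := hom_build (ahh (leqnn m)) yh ea (gr_hom s (leqnn m)).
set x := y `|` _ => e1 e2; exists x => v.
have hs : axisOf x s by rewrite /axisOf /tip e2 /x; lat.
split=> [/hM[/he h1 /hy h2]|/(PsiP _ hs)]; first by apply/(PsiP _ hs); rewrite /tip e2 e1.
by rewrite /tip e2 e1 => -[/he h1 /hy h2]; apply/hM.
Qed.
End Coord.


Section Coordinatization.
Local Open Scope lat_scope.

Theorem coordinatization (L : modLattice) (m : nat) (f : nat -> L) : (2 < m)%N ->
  indep [seq f i | i <- iota 0 m.+1] ->
  (forall x, x <= joins [seq f i | i <- iota 0 m.+1]) ->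
  (forall j, (j < m)%N -> exists z, [/\ z `&` f m <= bot, z `&` f j <= bot,
     top <= z `|` f m & top <= z `|` f j]) ->
  f m <> bot ->
  exists (R : nzRingType) (Psi : L -> (nat -> R) -> Prop),
    [/\ forall r : R, exists s, (r * s * r = r)%R,
        forall x z, x <= z <-> (forall u, Psi x u -> Psi z u),
        forall x, fgen m.+1 (Psi x) &
        forall M : (nat -> R) -> Prop, fgen m.+1 M -> exists x, forall v, M v <-> Psi x v].
Proof.
move=> m2 If Tf Pf f0; pose a := f m.
have Iab : indep (a :: [seq f i | i <- iota 0 m]).
  apply: indep_perm If; rewrite -[m.+1]addn1 iotaD map_cat /= add0n.
  exact/permPl/(perm_catC _ [:: f m]).
have ax_ex j : exists z, (j < m)%N ==> (hom a (f j) z && hom (f j) a z).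
  case: (ltnP j m) => [jm|_]; last by exists bot.
  (* A common complement, cut down to the join of [a] and [f j], is an axis between them. *)
  have [z [z1 z2 z3 z4]] := Pf j jm; exists (z `&` (a `|` f j)); apply/andP.
  have l1 : f j <= z `|` a := lle_trans (ltopP _) z3.
  have l2 : a <= z `|` f j := lle_trans (ltopP _) z4.
  have h1 : f j <= z `&` (a `|` f j) `|` a.
    by rewrite ljoinC; apply: lle_trans (@le_mod _ a z (a `|` f j) _ _ _ _) _; lat.
  have h2 : a <= z `&` (a `|` f j) `|` f j.
    by rewrite ljoinC; apply: lle_trans (@le_mod _ (f j) z (a `|` f j) _ _ _ _) _; lat.
  by rewrite -/a in z1; split; apply: homI; lat.
pose c j := xchoose (ax_ex j).
have cab j : (j < m)%N -> hom a (f j) (c j).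
  by move=> jm; have /implyP/(_ jm)/andP[] := xchooseP (ax_ex j).
have cba j : (j < m)%N -> hom (f j) a (c j).
  by move=> jm; have /implyP/(_ jm)/andP[] := xchooseP (ax_ex j).
have [|||R [rho [regR homR surjR injR [rho0 rho1 rhoT]]]] :=
  @coordinate_ring L m a (fun i : 'I_m => f i) (fun i : 'I_m => c i) m2 _ _ _ f0.
- move=> j k l u; apply: (@indep_catl _ [:: a; f j; f k; f l] [:: bot]).
  apply: (Isub Iab (s1 := [:: val j; val k; val l]) (s2 := [::])).
    by rewrite cats0 (map_inj_uniq val_inj [:: j; k; l]).
  by rewrite /= !ltn_ord.
- by move=> j; apply: cab.
- by move=> j; apply: cba.
pose rh j r : L := if insub j is Some i then rho i r else bot.
have rhE j (jm : (j < m)%N) r : rh j r = rho (Ordinal jm) r by rewrite /rh insubT.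
have T k j (p q s : R) : (k < m)%N -> (j < m)%N -> k != j ->
    rh j (p + q * s)%R = tern a (f k) (f j) (rh k q) (rh j p) (sgr f c rh k j s).
  by move=> km jm kj; rewrite /sgr !rhE (rhoT (Ordinal km) (Ordinal jm)).
have top_le x : x <= a `|` hh f m.
  apply: lle_trans (Tf x) _; rewrite -[m.+1]addn1 iotaD map_cat joins_cat hh_joins /= add0n.
  by rewrite -/a; lat.
have H1 : (1 < m)%N by apply: ltnW.
have H2 j r : (j < m)%N -> hom a (f j) (rh j r) by move=> jm; rewrite rhE; apply: (homR (Ordinal jm)).
have H3 j x : (j < m)%N -> hom a (f j) x -> exists r, rh j r = x.
  by move=> jm hx; have [r <-] := surjR (Ordinal jm) x hx; exists r; apply: rhE.
have H4 j : (j < m)%N -> injective (rh j) by move=> jm r s; rewrite !rhE; apply: injR.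
have H5 j : (j < m)%N -> rh j 0%R = a by move=> jm; rewrite rhE rho0.
have H6 j : (j < m)%N -> rh j 1%R = c j by move=> jm; rewrite rhE rho1.
exists R, (@Psi L m a f c R rh); split=> //.
- by move=> x z; apply: Psi_le.
- by move=> x; apply: Psi_fgen.
- by move=> M; apply: fgen_Psi.
Qed.
End Coordinatization.

(** * The lattice of left ideals of a biordered set *)

Section Biordered.
Variables (S : Type) (mul : S -> S -> S).
Local Notation E := (idem mul).
Local Notation "x ** y" := (mul x y) (at level 40, left associativity).
Local Notation "# e" := (proj1_sig e) (at level 2, format "# e").
Hypothesis mulA : associative mul.
Hypothesis mul_reg : forall x, exists y, x ** y ** x = x.
Variables (zero : E) (pr : E -> E).
Implicit Types (e f g h k u w : E) (x y : S).
Hypothesis zl : forall e, #zero ** #e = #zero.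
Hypothesis zr : forall e, #e ** #zero = #zero.
Hypothesis prK : involutive pr.
Hypothesis bwl_pr : forall e f, bwl f e <-> bwr (pr e) (pr f).
Hypothesis bwl_ann : forall e f, bwl f (pr e) <-> (forall g, bM f e g <-> g = zero).
Hypothesis pr_comm : forall e g, bw g e -> #e ** #(pr g) = #(pr g) ** #e.

Lemma idm e : #e ** #e = #e. Proof. exact: proj2_sig e. Qed.

Lemma idem_inj e f : #e = #f -> e = f.
Proof.
move: e f => [x hx] [y hy] /= exy; move: hx; rewrite exy => hx.
by congr exist; apply: Prop_irrelevance.
Qed.

Lemma idemE x : x ** x = x -> {e : E | #e = x}.
Proof. by move=> h; exists (exist (fun x => x ** x = x) x h). Qed.

Lemma bwl_refl e : bwl e e. Proof. exact: idm. Qed.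
Lemma bwl_trans e f g : bwl e f -> bwl f g -> bwl e g.
Proof. by rewrite /bwl /wlT => h1 h2; rewrite -{1}h1 -mulA h2. Qed.
Lemma bwr_pr e f : bwr f e <-> bwl (pr e) (pr f).
Proof. by rewrite bwl_pr !prK. Qed.

(** Any [w] in [M(u, g)] equals [w u g w], hence has the form [zero] times something, and so is
    [zero]. The factor [x] is kept because [zero] is only known to absorb idempotents. *)
Lemma ann_gen u g x : #u ** #g = #zero ** x -> bwl u (pr g).
Proof.
move=> h; apply/bwl_ann => w; split=> [[h1 h2]|->]; last by split; [apply: zl|apply: zr].
rewrite /bwl /bwr /wlT /wrT in h1 h2; apply: idem_inj.
have e1 : #w = #zero ** (x ** #w).
  rewrite {1}(_ : #w = #w ** #u ** (#g ** #w)); last by rewrite h1 h2 idm.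
  by rewrite mulA -(mulA #w) h (mulA #w) zr -mulA.
by rewrite -(zl w) {2}e1 mulA zl.
Qed.

Lemma inverse_ex x : exists t, x ** t ** x = x /\ t ** x ** t = t.
Proof.
have [y hy] := mul_reg x; have hy' s : x ** (y ** (x ** s)) = x ** s by rewrite !mulA hy.
by exists (y ** x ** y); split; rewrite -?mulA !hy' ?mulA ?hy.
Qed.

Lemma annP f e : bwl f (pr e) <-> #f ** #e = #zero.
Proof.
split=> [|h]; last by apply: (@ann_gen _ _ #zero); rewrite h zl.
move/bwl_ann => h; have [t [t1 t2]] := inverse_ex (#f ** #e).
(* With [t] an inverse of [f e], the idempotent [e t f] lies in [M(f, e)], and [f e] is a multiple
   of it. *)
have hw : (#e ** t ** #f) ** (#e ** t ** #f) = #e ** t ** #f.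
  by rewrite -{3}t2 !mulA.
have [w ew] := idemE hw.
have /h w0 : bM f e w.
  by split; rewrite /bwl /bwr /wlT /wrT ew; [rewrite -!mulA idm|rewrite !mulA idm].
rewrite w0 in ew; rewrite -t1 -{1}(idm f) -[#f ** #e in X in X = _]/(#f ** #e).
have -> : #f ** #f ** #e ** t ** (#f ** #e) = #f ** (#e ** t ** #f) ** #e.
  by rewrite idm !mulA.
by rewrite -ew zr zl.
Qed.

Lemma annrP f e : bwr f (pr e) <-> #e ** #f = #zero.
Proof. by rewrite bwr_pr prK annP. Qed.

Lemma pr_l e : #(pr e) ** #e = #zero. Proof. exact/annP/bwl_refl. Qed.
Lemma pr_r e : #e ** #(pr e) = #zero. Proof. by apply/annP; rewrite prK; apply: bwl_refl. Qed.

Lemma bw_pr_mul e g : bw g e -> exists h, [/\ #h = #e ** #(pr g), #h = #(pr g) ** #e,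
  bw h e & bw h (pr g)].
Proof.
move=> ge; have c := pr_comm ge.
have hh : (#e ** #(pr g)) ** (#e ** #(pr g)) = #e ** #(pr g).
  by rewrite {2}c mulA -(mulA #e) idm -mulA -c mulA idm.
have [h eh] := idemE hh; exists h; rewrite /bw /bwl /bwr /wlT /wrT eh; split=> //; split.
- by rewrite {1}c -mulA idm.
- by rewrite mulA idm.
- by rewrite -mulA idm.
- by rewrite c mulA idm.
Qed.

(** Below [e], lying below [f] means annihilating [e f']. As [g] generates the same right ideal as
    [e f'], the meet is [e g']. The data [g] and [y] are kept for the cancellation arguments. *)
Lemma meet_ex e f : exists g h y, [/\ bw g e, #g ** (#e ** #(pr f)) = #e ** #(pr f),
  #g = #e ** #(pr f) ** y, #h = #e ** #(pr g) &
  forall u, bwl u h <-> bwl u e /\ bwl u f].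
Proof.
move ex0: (#e ** #(pr f)) => x; have [y hy] := mul_reg x.
have ex : #e ** x = x by rewrite -ex0 mulA idm.
have gg : (x ** y ** #e) ** (x ** y ** #e) = x ** y ** #e.
  by rewrite -mulA (mulA #e) (mulA #e) ex !mulA hy.
have [g eg] := idemE gg.
have ge : bw g e.
  by split; rewrite /bwl /bwr /wlT /wrT eg; [rewrite -mulA idm|rewrite !mulA ex].
have [h [h1 h2 he hg]] := bw_pr_mul ge.
have gx : #g ** x = x by rewrite eg -mulA ex hy.
exists g, h, (y ** #e); split=> //; first by rewrite eg mulA.
move=> u; split=> [uh|[ue uf]].
  split; first by apply: bwl_trans uh he.1.
  apply: bwl_trans uh _; rewrite -[f]prK; apply/annP.
  have -> : #h ** #(pr f) = #h ** x by rewrite -ex0 mulA he.1.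
  rewrite -gx mulA; have /annP -> := hg.1.
  by rewrite -ex0 mulA !zl.
have ug : bwl u (pr g).
  apply: (@ann_gen _ _ (y ** #e)).
  have /annP {}uf : bwl u (pr (pr f)) by rewrite prK.
  by rewrite eg -mulA mulA -ex0 (mulA #u #e) ue uf.
by rewrite /bwl /wlT h1 mulA ue.
Qed.
End Biordered.

(** * Joins, modularity and complements from the axioms *)

Section Coordinates.
Variables (S : Type) (mul : S -> S -> S).
Local Notation E := (idem mul).
Local Notation "x ** y" := (mul x y) (at level 40, left associativity).
Local Notation "# e" := (proj1_sig e) (at level 2, format "# e").
Hypothesis HS : regular_semigroup mul.
Variables (zero : E) (pr : E -> E).
Implicit Types (e f g h k u w : E) (x y : S).
Hypothesis HE1 : forall e, bw zero e.
Hypothesis prK : forall e, pr (pr e) = e.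
Hypothesis HE2ii : forall e f, bwl f e <-> bwr (pr e) (pr f).
Hypothesis HE2iii : forall e f, bwl f (pr e) <-> (forall g, bM f e g <-> g = zero).
Hypothesis HE3 : forall e f, bw f (pr e) ->
  exists h, bS (pr e) (pr f) h /\ bS (pr f) (pr e) h.

Let mulA : associative mul := HS.1.
Let mul_reg := HS.2.
Let zl e : #zero ** #e = #zero := (HE1 e).1.
Let zr e : #e ** #zero = #zero := (HE1 e).2.
Let idm := @idm S mul.
Let bwl_trans := @bwl_trans S mul mulA.
Let bwr_pr := bwr_pr prK HE2ii.
Let annP := annP mulA mul_reg zl zr HE2iii.
Let annrP := annrP mulA mul_reg zl zr prK HE2ii HE2iii.
Let pr_l := pr_l mulA mul_reg zl zr HE2iii.
Let pr_r := pr_r mulA mul_reg zl zr prK HE2iii.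

(** The maximality of [h] is applied to the single idempotent [f t e], where [t] is an inverse of
    [e f]. *)
Lemma sandwich e f h : bS e f h -> #e ** #f = #e ** #h ** #f.
Proof.
case=> -[he fh] hmax; have [t [t1 t2]] := inverse_ex mulA mul_reg (#e ** #f).
have ww : (#f ** t ** #e) ** (#f ** t ** #e) = #f ** t ** #e.
  by rewrite -{3}t2 !mulA.
have [w ew] := idemE ww.
have /hmax [h1 _] : bM e f w.
  by split; rewrite /bwl /bwr /wlT /wrT ew; [rewrite -mulA idm|rewrite !mulA idm].
have e1 : #e ** #w ** #f = #e ** #f by rewrite ew -[RHS]t1 !mulA.
rewrite -{1}e1 -h1 -mulA e1.
by rewrite mulA -(mulA #e) he.
Qed.

(** An element [h] of both sandwich sets lies below [e] and below [g'] for [omega], so both products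
    collapse to [h]. *)
Lemma pr_comm e g : bw g e -> #e ** #(pr g) = #(pr g) ** #e.
Proof.
rewrite -{1}[e]prK => /HE3 [h []]; rewrite prK => s1 s2.
have [[h1 h2] _] := s1; have [[h3 h4] _] := s2.
rewrite (sandwich s1) (sandwich s2).
by rewrite h4 h3 h2 h1.
Qed.

Let bw_pr_mul := bw_pr_mul mulA pr_comm.

Let opm x y := y ** x.
(** As [pr] exchanges the two preorders, a join of [e] and [f] is the prime of a meet of their
    primes in the opposite semigroup. *)
Lemma join_ex0 e f : exists g k y, [/\ bw g (pr f), #e ** #(pr f) ** #g = #e ** #(pr f),
  #g = y ** (#e ** #(pr f)), #k = #(pr g) ** #(pr f) &
  forall u, bwr u k <-> bwr u (pr f) /\ bwr u (pr e)].
Proof.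
have A : associative opm by move=> x y z; rewrite /opm mulA.
have reg x : exists y, opm (opm x y) x = x.
  by have [y hy] := mul_reg x; exists y; rewrite /opm mulA.
have iii (e' f' : idem opm) : bwl f' (pr e' : idem opm) <->
    (forall g : idem opm, bM f' e' g <-> g = zero).
  have h1 : (bwr (f' : E) (pr e')) <-> bwl (e' : E) (pr f') by rewrite bwr_pr prK.
  split=> [/h1/(HE2iii f' e') h g|h]; last apply/h1/(HE2iii f' e').
    by rewrite -h; split=> -[].
  by move=> g; rewrite -h; split=> -[].
have comm (e' g : idem opm) : bw g e' -> opm (proj1_sig e') (proj1_sig (pr g)) =
    opm (proj1_sig (pr g)) (proj1_sig e').
  by move=> [h1 h2]; apply/esym/pr_comm.
have zl' (e' : idem opm) : opm #zero #e' = #zero by apply: zr.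
have zr' (e' : idem opm) : opm #e' #zero = #zero by apply: zl.
have [g [k [y [h1 h2 h3 h4 h5]]]] :=
  @meet_ex S opm A reg zero pr zl' zr' prK iii comm (pr f) (pr e).
exists g, k, y; rewrite /opm prK in h2 h3; split=> //.
by case: h1.
Qed.

Let meet_ex := meet_ex mulA mul_reg zl zr prK HE2iii pr_comm.

Lemma join_ex e f : exists g j y, [/\ #e ** #(pr f) ** #g = #e ** #(pr f),
  #g = y ** (#e ** #(pr f)), forall u, bwl j u <-> bwl e u /\ bwl f u &
  forall u, bwl u g <-> bwl u (pr f) /\ bwl u j].
Proof.
have [g [k [y [gf xg eg ek hk]]]] := join_ex0 e f.
exists g, (pr k), y; split=> // u.
  rewrite -[u in bwl (pr k) u]prK -bwr_pr hk -!HE2ii; tauto.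
rewrite (annP u k) ek; split=> [ug|[uf]].
  split; first by apply: bwl_trans ug gf.1.
  have : bwl u (pr (pr g)) by rewrite prK.
  by rewrite mulA => /annP ->; apply: zl.
rewrite (_ : #(pr g) ** #(pr f) = #(pr f) ** #(pr g)); last exact/esym/pr_comm.
rewrite mulA uf => h; rewrite -[g]prK; exact/annP.
Qed.

(** The zero meet makes right multiplication by [f'] cancellable on [e2], and the join condition
    puts [e2 f'] in the left ideal of [e1 f']. So [k], the complement of [e1] in [e2], is a left
    multiple of [e1]; as [k e1 = 0], it vanishes. *)
Lemma bw_cancel e1 e2 f : bw e1 e2 ->
  (forall w, bwl e1 w -> bwl f w -> bwl e2 w) ->
  (forall u, bwl u e2 -> bwl u f -> u = zero) -> e1 = e2.
Proof.
move=> le hj hm.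
have [g1 [j1 [y1 [x1 eg1 hj1 hg1]]]] := join_ex e1 f.
have [g2 [j2 [y2 [x2 _ hj2 hg2]]]] := join_ex e2 f.
have [g [h [y [ge gx eg eh hh]]]] := meet_ex e2 f.
have h0 : h = zero by apply: hm; [|]; case: (proj1 (hh h) (idm h)).
have eg2 : bwl e2 g by rewrite -[g]prK; apply/annP; rewrite -eh h0.
have e2g : #e2 = #e2 ** #(pr f) ** y by rewrite -eg -{1}eg2 ge.2.
have g21 : bwl g2 g1.
  have [g2f g2j] := proj1 (hg2 g2) (idm g2).
  apply/hg1; split=> //; apply: bwl_trans g2j _.
  have [a1 a2] := proj1 (hj1 j1) (idm j1).
  by apply/hj2; split=> //; apply: hj.
have [k [k1 k2 [k3 k4] _]] := bw_pr_mul le.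
have e12 : #e1 = #e1 ** #e2 by rewrite le.1.
have kf : #k ** (#e2 ** #(pr f)) = #k ** (#e2 ** #(pr f)) ** #g2 ** y1 ** #e1 ** (#e2 ** #(pr f)).
  have a : #e2 ** #(pr f) = #e2 ** #(pr f) ** #g2 ** #g1 by rewrite -mulA g21 x2.
  by rewrite {1}a eg1 {1}e12 !mulA.
have kk : #k = #k ** (#e2 ** #(pr f)) ** #g2 ** y1 ** #e1.
  have ek : #k = #k ** (#e2 ** #(pr f)) ** y by rewrite -mulA -e2g k3.
  rewrite [LHS]ek [X in X ** y = _]kf -(mulA _ (#e2 ** #(pr f)) y) -e2g.
  by rewrite -(mulA _ #e1) -e12.
have k0 : #k = #zero.
  have k1' : #k ** #e1 = #k by rewrite {1}kk -(mulA _ #e1 #e1) idm -kk.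
  by rewrite -k1' k1 -mulA pr_l zr.
have e21 : bwl e2 e1 by rewrite -[e1]prK; apply/annP; rewrite -k1.
by apply: idem_inj; rewrite -[RHS]e21 le.2.
Qed.

Lemma bwl_reduce e f : bwl e f -> exists e0, [/\ bw e0 f, bwl e e0 & bwl e0 e].
Proof.
rewrite /bwl /wlT => ef.
have hh : (#f ** #e) ** (#f ** #e) = #f ** #e by rewrite -mulA (mulA #e) ef idm.
have [e0 ee] := idemE hh; exists e0; rewrite /bw /bwl /bwr /wlT /wrT ee.
by rewrite -mulA ef !mulA idm ef -mulA idm.
Qed.

(** Reduction to a zero meet: [e0] represents the meet of [e] and [f], and [e] and [e2] are replaced
    by the complements [k1] and [k2] of [e0] in them. *)
Lemma bwl_cancel e1 e2 f : bwl e1 e2 ->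
  (forall w, bwl e1 w -> bwl f w -> bwl e2 w) ->
  (forall u, bwl u e2 -> bwl u f -> bwl u e1) -> bwl e2 e1.
Proof.
move=> /bwl_reduce[e [ee2 e1e ee1]] hj hm; apply: bwl_trans ee1.
have {}hj w : bwl e w -> bwl f w -> bwl e2 w by move=> h; apply: hj; apply: bwl_trans h.
have {}hm u : bwl u e2 -> bwl u f -> bwl u e.
  by move=> h1 h2; apply: bwl_trans e1e; apply: hm.
have [_ [i [_ [_ _ _ _ hi]]]] := meet_ex e f.
have [ie if'] := proj1 (hi i) (idm i).
have [e0 [e0e ie0 e0i]] := bwl_reduce ie.
have e0f : bwl e0 f by apply: bwl_trans if'.
have e0e2 : bw e0 e2.
  case: e0e ee2 => a1 a2 [b1 b2]; split; first exact: bwl_trans b1.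
  by rewrite /bwr /wrT -a2 mulA b2.
have [k1 [k11 k12 k1e k1e0]] := bw_pr_mul e0e; have [k2 [k21 k22 k2e k2e0]] := bw_pr_mul e0e2.
have k12w : bw k1 k2.
  have ee2' : #e ** #e2 = #e := ee2.1; have e2e : #e2 ** #e = #e := ee2.2.
  split; rewrite /bwl /bwr /wlT /wrT.
    by rewrite k12 k21 -mulA (mulA #e) ee2' -k11 k12 mulA idm.
  by rewrite k22 k11 -mulA (mulA #e2) e2e -k11 k12 mulA idm.
have eqk : k1 = k2.
  apply: (@bw_cancel _ _ f) => // [w hk hf|u uk uf].
    apply: bwl_trans k2e.1 _; apply: hj => //.
    have e0w : bwl e0 w by apply: bwl_trans e0f _.
    rewrite -[w]prK; apply/annP.
    have : #e0 ** #(pr w) = #zero by apply/annP; rewrite prK.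
    move/annrP => h; rewrite -h mulA -k11; apply/annP.
    by rewrite prK.
  have ue : bwl u e by apply: hm => //; apply: bwl_trans k2e.1.
  have ue0 : bwl u e0 by apply: bwl_trans ie0; apply/hi.
  have /annP : bwl u (pr e0) by apply: bwl_trans k2e0.1.
  by move=> h; apply: idem_inj; rewrite -ue0.
rewrite -[e]prK; apply/annP.
have k2pe : #k2 ** #(pr e) = #zero.
  by apply/annP; rewrite prK -eqk; exact: k1e.1.
have : #e0 ** #(pr e) = #zero by apply/annP; rewrite prK; exact: e0e.1.
by move/annrP => h; rewrite -h mulA -k21.
Qed.

(** [q] is the idempotent in the L-class of [e] and the R-class of [f']. The meet condition lets
    [f'] be cancelled after [e], and the join condition gives [f'] as a left multiple of [e f']. *)
Lemma complementary e f : (forall u, bwl u e -> bwl u f -> u = zero) ->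
  (forall w, bwl e w -> bwl f w -> w = pr zero) ->
  exists q, [/\ bwl q e, bwl e q, bwl (pr q) f & bwl f (pr q)].
Proof.
move=> hm hj.
have [g1 [j1 [y1 [x1 eg1 hj1 hg1]]]] := join_ex e f.
have [g [h [y [ge gx eg eh hh]]]] := meet_ex e f.
have h0 : h = zero by apply: hm; [|]; case: (proj1 (hh h) (idm h)).
have eg2 : bwl e g by rewrite -[g]prK; apply/annP; rewrite -eh h0.
have ey : #e = #e ** #(pr f) ** y by rewrite -eg -{1}eg2 ge.2.
have fg : #(pr f) = #(pr f) ** y1 ** (#e ** #(pr f)).
  rewrite -mulA -eg1; apply/esym/hg1; split; first exact: idm.
  have [a1 a2] := proj1 (hj1 j1) (idm j1).
  by rewrite (hj _ a1 a2); apply/annP; rewrite zr.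
have qq : (#(pr f) ** y1 ** #e) ** (#(pr f) ** y1 ** #e) = #(pr f) ** y1 ** #e.
  by rewrite -{3}[pr f]prK prK {3}fg !mulA.
have [q eq] := idemE qq; exists q.
have eqe : #e ** #q = #e.
  by rewrite eq {2}ey (mulA (#(pr f) ** y1)) -fg mulA -ey.
have qf : #q ** #(pr f) = #(pr f) by rewrite eq [RHS]fg -!mulA.
have fq : #(pr f) ** #q = #q by rewrite eq !mulA idm.
split=> //.
- by rewrite /bwl /wlT eq -mulA idm.
- by rewrite -[f]prK -bwr_pr.
- by rewrite -[f]prK -bwr_pr.
Qed.

(* Recovers the basic product [f e] from the two quasi-orders alone. *)
Lemma basic_product e f g : bwl e f -> bwl g e -> bwl e g -> bwr g f ->
  (forall u, bwl u f -> bwl u (pr e) -> bwl u (pr g)) -> #g = #f ** #e.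
Proof.
move=> ef ge eg gf hx.
have hh : (#f ** #e) ** (#f ** #e) = #f ** #e by rewrite -mulA (mulA #e) ef idm.
have [p ep] := idemE hh; rewrite -ep.
have pf : bw p f.
  by split; rewrite /bwl /bwr /wlT /wrT ep; [rewrite -mulA ef|rewrite mulA idm].
have [k [k1 k2 [k3 k4] [k5 k6]]] := bw_pr_mul pf.
have ke : bwl k (pr e).
  by apply/annP; rewrite -k3 -mulA -ep; apply/annP.
have /annP kg := hx k k3 ke.
have pg : #p ** #g = #g.
  have /annrP : #(pr p) ** #g = #zero by rewrite -{1}gf mulA -k2.
  by rewrite prK.
by rewrite -pg ep -mulA eg -ep.
Qed.

Lemma basic_product_dual e f g : bwr e f -> bwr g e -> bwr e g -> bwl g f ->
  (forall u, bwr u f -> bwr u (pr e) -> bwr u (pr g)) -> #g = #e ** #f.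
Proof.
move=> ef ge eg gf hx.
have hh : (#e ** #f) ** (#e ** #f) = #e ** #f by rewrite -mulA (mulA #f) ef mulA idm.
have [p ep] := idemE hh; rewrite -ep.
have pf : bw p f.
  by split; rewrite /bwl /bwr /wlT /wrT ep; [rewrite -mulA idm|rewrite mulA ef].
have [k [k1 k2 [k3 k4] [k5 k6]]] := bw_pr_mul pf.
have ke : bwr k (pr e).
  by apply/annrP; rewrite -k4 mulA -ep; apply/annrP.
have /annrP gk := hx k k4 ke.
have gp : #g ** #p = #g.
  have /annP : #g ** #(pr p) = #zero by rewrite -{1}gf -mulA -k1.
  by rewrite prK.
by rewrite -gp ep mulA eg -ep.
Qed.

(** An L-class is represented by the predicate of lying below one of its members, so that
    extensionality forms the quotient. *)
Theorem left_lattice : exists (L : modLattice) (lam : E -> L),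
  (forall e f, lle (lam e) (lam f) <-> bwl e f) /\ (forall x : L, exists e, lam e = x).
Proof.
pose T := {X : E -> Prop | exists e, X = fun u => bwl u e}.
pose C : choiceType := {classic T}.
pose lam e : C := exist (fun X => exists e, X = fun u => bwl u e) (fun u => bwl u e)
  (ex_intro _ e erefl).
pose le (X Y : C) := `[< forall u, sval (X : T) u -> sval (Y : T) u >].
have lamP e f : le (lam e) (lam f) <-> bwl e f.
  split=> [/asboolP|ef]; first by apply; apply: idm.
  by apply/asboolP => u /= ue; apply: bwl_trans ef.
have lamS (X : C) : exists e, lam e = X.
  by case: X => X hX; have [e eX] := hX; exists e; apply: eq_exist.
have le_refl : reflexive le by move=> X; apply/asboolP.
have le_anti X Y : le X Y -> le Y X -> X = Y.
  case: X => X hX; case: Y => Y hY /asboolP h1 /asboolP h2; apply: eq_exist.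
  by rewrite predeqE => u; split; [apply: h1|apply: h2].
have le_trans X Y Z : le X Y -> le Y Z -> le X Z.
  by move=> /asboolP h1 /asboolP h2; apply/asboolP => u /h1/h2.
have [mt hmt] : exists mt : C * C -> C, forall p Z, le Z (mt p) = le Z p.1 && le Z p.2.
  suff : forall p : C * C, exists M : C, forall Z, le Z M = le Z p.1 && le Z p.2.
    by move/choice => [mt hmt]; exists mt.
  case=> X Y /=; have [e <-] := lamS X; have [f <-] := lamS Y.
  have [_ [h [_ [_ _ _ _ hh]]]] := meet_ex e f; exists (lam h) => Z.
  have [u <-] := lamS Z; apply/idP/andP => [/lamP/hh[h1 h2]|[/lamP h1 /lamP h2]].
    by split; apply/lamP.
  exact/lamP/hh.
have [jn hjn] : exists jn : C * C -> C, forall p Z, le (jn p) Z = le p.1 Z && le p.2 Z.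
  suff : forall p : C * C, exists M : C, forall Z, le M Z = le p.1 Z && le p.2 Z.
    by move/choice => [jn hjn]; exists jn.
  case=> X Y /=; have [e <-] := lamS X; have [f <-] := lamS Y.
  have [_ [j [_ [_ _ hj _]]]] := join_ex e f; exists (lam j) => Z.
  have [u <-] := lamS Z; apply/idP/andP => [/lamP/hj[h1 h2]|[/lamP h1 /lamP h2]].
    by split; apply/lamP.
  exact/lamP/hj.
have bot_le X : le (lam zero) X.
  by have [e <-] := lamS X; apply/lamP; case: (HE1 e).
have le_top X : le X (lam (pr zero)).
  by have [e <-] := lamS X; apply/lamP/annP; apply: zr.
have lmd X Y Z : le X Z -> le (mt (jn (X, Y), Z)) (jn (X, mt (Y, Z))).
  move=> xz; set c := mt _; set d := jn _.
  have [e1 ee1] := lamS d; have [e2 ee2] := lamS c; have [f ef] := lamS Y.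
  have := le_refl d; rewrite {1}/d hjn /= => /andP[d1 d2].
  have := le_refl c; rewrite {2}/c hmt /= => /andP[c1 c2].
  (* The two sides of the modular law have the same join and the same meet with [Y]. *)
  rewrite -ee1 -ee2; apply/lamP; apply: (bwl_cancel (f := f)).
  - apply/lamP; rewrite ee1 ee2 /c hmt /= /d !hjn /= xz.
    have := le_refl (jn (X, Y)); rewrite hjn /= => /andP[-> h].
    have := le_refl (mt (Y, Z)); rewrite hmt /= => /andP[h' ->].
    by rewrite (le_trans _ _ _ h' h).
  - move=> w /lamP; rewrite ee1 => dw /lamP; rewrite ef => yw; apply/lamP; rewrite ee2.
    by apply: (le_trans _ _ _ c1); rewrite hjn /= yw (le_trans _ _ _ d1 dw).
  - move=> u /lamP; rewrite ee2 => uc /lamP; rewrite ef => uy; apply/lamP; rewrite ee1.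
    by apply: (le_trans _ _ _ _ d2); rewrite hmt /= uy (le_trans _ _ _ uc c2).
have cmp X : exists Y, mt (X, Y) = lam zero /\ jn (X, Y) = lam (pr zero).
  have [e <-] := lamS X; exists (lam (pr e)); split; apply: le_anti => //.
    have [u eu] := lamS (mt (lam e, lam (pr e))); rewrite -eu.
    have : le (lam u) (mt (lam e, lam (pr e))) by rewrite eu.
    rewrite hmt /= => /andP[/lamP h1 /lamP/annP h2].
    by rewrite (_ : u = zero) //; apply: idem_inj; rewrite -h1.
  have [u eu] := lamS (jn (lam e, lam (pr e))); rewrite -eu.
  have : le (jn (lam e, lam (pr e))) (lam u) by rewrite eu.
  rewrite hjn /= => /andP[/lamP h1 /lamP h2].
  apply/lamP; have : bwr (pr u) (pr e) by apply/HE2ii.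
  move: h2; rewrite HE2ii prK => h2 /annrP h3.
  by rewrite (_ : u = pr zero) ?bwl_refl // -[u]prK; congr pr; apply: idem_inj; rewrite -h3 h2.
exists (@ModLattice C le (fun X Y => mt (X, Y)) (fun X Y => jn (X, Y)) (lam zero) (lam (pr zero))
  le_refl le_anti le_trans (fun X Y Z => hmt (X, Y) Z) (fun X Y Z => hjn (X, Y) Z)
  bot_le le_top lmd cmp), lam.
by [].
Qed.

(** (E4)(ii) requires a bound for both preorders, whereas the lattice join controls only [omega^l].
    For orthogonal [e] and [f] the element [(e' f')'] bounds both ways. *)
Lemma orthogonal_sum e f : bw f (pr e) -> exists s, [/\ bw e s, bw f s,
  forall w, bwl e w -> bwl f w -> bwl s w &
  forall g, bw g (pr e) -> bw g (pr f) -> bw g (pr s)].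
Proof.
case/bw_pr_mul=> h [h1 h2 _ _]; exists (pr h); rewrite prK; split.
- split; [apply/annP|apply/annrP].
    by rewrite h1 mulA pr_r zl.
  by rewrite h2 -mulA pr_l zr.
- split; [apply/annP|apply/annrP].
    by rewrite h2 mulA pr_r zl.
  by rewrite h1 -mulA pr_l zr.
- move=> w /HE2ii ew /HE2ii fw; apply/HE2ii; rewrite prK.
  by rewrite /bwr /wrT h1 -mulA fw ew.
move=> g [g1 g2] [g3 g4]; split; rewrite /bwl /bwr /wlT /wrT.
  by rewrite h1 mulA g1 g3.
by rewrite h2 -mulA g2 g4.
Qed.

Lemma orthogonal_sums (I : eqType) (es : I -> E) (r : seq I) :
  (forall i j, i != j -> bw (es i) (pr (es j))) -> uniq r ->
  exists s, [/\ forall i, i \in r -> bw (es i) s,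
    forall w, (forall i, i \in r -> bwl (es i) w) -> bwl s w &
    forall j, j \notin r -> bw (es j) (pr s)].
Proof.
move=> orth; elim: r => [_|i r IH /= /andP[ir /IH[s0 [s1 s2 s3]]]].
  exists zero; split=> // [w _|j _]; first by case: (HE1 w).
  by split; [apply/annP; apply: zr|apply/annrP; apply: zl].
have [s [t1 t2 t3 t4]] := orthogonal_sum (s3 i ir); exists s; split=> [j|w h|j].
- rewrite inE => /predU1P[->//|/s1 [h1 h2]]; case: t1 => t1 t1'; split.
    exact: bwl_trans t1.
  by rewrite /bwr /wrT -h2 mulA t1'.
- by apply: t3; [apply: s2 => j jr|]; apply: h; rewrite inE ?jr ?orbT ?eqxx.
by rewrite inE negb_or => /andP[ji jr]; apply: t4; [apply: s3|apply: orth].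
Qed.

(** * The frame supplied by (E4) *)

Section LatticeFrame.
Local Open Scope lat_scope.
Variables (L : modLattice) (lam : E -> L) (m : nat) (es : 'I_m.+1 -> E).
Hypothesis lamP : forall e f, lle (lam e) (lam f) <-> bwl e f.
Hypothesis lamS : forall x : L, exists e, lam e = x.
Hypothesis HE4i : forall i j, i <> j -> forall g, bM (es i) (es j) g <-> g = zero.
Hypothesis HE4ii : forall e, (forall i, bw (es i) e) -> e = pr zero.
Hypothesis HE4iii : forall i j, i <> j -> dl_is (es i) (es j) 3.

Lemma lam_zero : lam zero = bot.
Proof.
apply: lle_anti; last exact: lbotP.
by have [e <-] := lamS bot; apply/lamP; case: (HE1 e).
Qed.

Lemma lam_meet_pr e : lam e `&` lam (pr e) <= bot.
Proof.
have [u eu] := lamS (lam e `&` lam (pr e)).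
have := lle_refl (lam u); rewrite {2}eu lmeetP -eu => /andP[/lamP h1 /lamP/annP h2].
by rewrite (_ : u = zero) ?lam_zero ?lle_refl //; apply: idem_inj; rewrite -h1.
Qed.

Lemma lam_join_pr e : top <= lam e `|` lam (pr e).
Proof.
have [u eu] := lamS (lam e `|` lam (pr e)).
have := lle_refl (lam u); rewrite {1}eu ljoinP -eu => /andP[/lamP h1 /lamP h2].
have [w <-] := lamS top; apply/lamP.
move: h1; rewrite HE2ii => /annrP h3; move: h2; rewrite HE2ii prK => h2.
have -> : u = pr zero.
  by rewrite -[u]prK; congr pr; apply: idem_inj; rewrite -h3 h2.
by apply/annP; apply: zr.
Qed.

Lemma es_orth i j : i != j -> bw (es i) (pr (es j)).
Proof.
move=> ij; have nij : i <> j by apply/eqP.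
have nji : j <> i by move/esym.
split; first by apply/HE2iii => g; apply: HE4i => /esym.
by apply/annrP/annP/HE2iii; apply: HE4i.
Qed.

Let fr i := lam (es (inord i)).

Lemma frame_indep : indep [seq fr i | i <- iota 0 m.+1].
Proof.
suff h (k l : nat) : (k + l <= m.+1)%N -> indep [seq fr i | i <- iota k l] by apply: h.
elim: l k => [|l IH] k //= kl; rewrite IH ?addSnnS // andbT.
apply: lle_trans (lam_meet_pr (es (inord k))).
apply: lat_leI; first by apply: lat_Il; apply: lle_refl.
apply: lat_Ir; apply/joins_le => y /mapP[j]; rewrite mem_iota => /andP[j1 j2] ->.
apply/lamP; apply: (proj1 (es_orth _)); apply/eqP => /(congr1 (@nat_of_ord _)); rewrite !inordK //.
- by move=> jk; rewrite jk ltnn in j1.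
- by apply: leq_trans kl; rewrite addnS ltnS leq_addr.
by apply: leq_trans kl; rewrite -addSnnS.
Qed.

Lemma frame_top (x : L) : x <= joins [seq fr i | i <- iota 0 m.+1].
Proof.
have [s [s1 s2 _]] := orthogonal_sums es_orth (enum_uniq 'I_m.+1).
have es0 : s = pr zero by apply: HE4ii => i; apply: s1; rewrite mem_enum.
have [w ew] := lamS (joins [seq fr i | i <- iota 0 m.+1]); have [u <-] := lamS x.
rewrite -ew; apply/lamP; apply: (@bwl_trans _ (pr zero)); first by apply/annP; apply: zr.
rewrite -es0; apply: s2 => i _; apply/lamP; rewrite ew; apply: le_joins.
by apply/mapP; exists (val i); rewrite ?mem_iota ?ltn_ord // /fr inord_val.
Qed.

(** Two consecutive steps of the same kind would merge by transitivity into a sequence of length 2,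
    against minimality. *)
Lemma E_sequence3 i j : i <> j -> exists y z : E, [/\ bL (es i) y, bR y z & bL z (es j)].
Proof.
move/HE4iii=> [[]//|[[_ [x [x0 x3 x01 xs]]] min]].
have Ltr e f g : bL e f -> bL f g -> bL e g.
  by move=> [h1 h2] [h3 h4]; split; [apply: bwl_trans h3|apply: bwl_trans h2].
have Rtr e f g : bR e f -> bR f g -> bR e g.
  move=> [h1 h2] [h3 h4]; split; rewrite /bwr /wrT.
    by rewrite -h1 mulA h3.
  by rewrite -h4 mulA h2.
have no e (y : E) : bL (es i) y -> bL y e \/ bR y e -> e = es j -> False.
  move=> h1 h2 he; suff /min : lseq (es i) (es j) 2 by [].
  split=> //; exists (fun a => if a is b.+1 then if b is 0 then y else e else es i).
  by split=> // -[|[|a]] // _; left.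
have [h1|h1] := xs 1 isT.
  by case: (no (x 3) (x 2)) => //; [rewrite -x0; apply: Ltr h1|apply: (xs 2)].
have [h2|h2] := xs 2 isT; first by exists (x 1), (x 2); rewrite -x0 -x3.
by case: (no (x 3) (x 1)) => //; [rewrite -x0|right; apply: Rtr h2].
Qed.

Lemma frame_perspective j : (j < m)%N -> exists z, [/\ z `&` fr m <= bot, z `&` fr j <= bot,
  top <= z `|` fr m & top <= z `|` fr j].
Proof.
move=> jm; have [|y [z [h1 [h2 h3] h4]]] := @E_sequence3 (inord m) (inord j).
  by move/(congr1 (@nat_of_ord _)); rewrite !inordK ?(leqW jm) // => mj; rewrite mj ltnn in jm.
have eqL e f : bL e f -> lam e = lam f by case=> *; apply: lle_anti; apply/lamP.
(* As [y] and [z] are [R]-related, their complements are [L]-related. *)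
have eqP : lam (pr y) = lam (pr z) by apply: eqL; split; rewrite -bwr_pr.
exists (lam (pr y)); rewrite {2 4}eqP /fr (eqL _ _ h1) -(eqL _ _ h4).
by split; rewrite 1?lmeetC 1?ljoinC; apply: lam_meet_pr || apply: lam_join_pr.
Qed.

(** A zero member would make every term of an E-sequence starting at it zero, and the constant
    sequence of length 1 contradicts the distance 3. *)
Lemma frame_neq0 : (0 < m)%N -> fr m <> bot.
Proof.
move=> m0 h; have [|y [z [h1 [h2 h3] h4]]] := @E_sequence3 (inord m) (inord 0).
  by move/(congr1 (@nat_of_ord _)); rewrite !inordK // => mj; rewrite mj in m0.
have l0 e : bwl e zero -> e = zero.
  by move=> h'; apply: idem_inj; rewrite -h'; apply: zr.
have e0 : es (inord m) = zero.
  by apply/l0/lamP; rewrite -/(fr m) h; apply: lbotP.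
have y0 : y = zero by apply: l0; rewrite -e0; case: h1.
have z0 : z = zero by apply: idem_inj; rewrite -h3 y0 zl.
have f0 : es (inord 0) = zero by apply: l0; rewrite -z0; case: h4.
have mn0 : (inord m : 'I_m.+1) <> inord 0.
  by move/(congr1 (@nat_of_ord _)); rewrite !inordK // => mj; rewrite mj in m0.
case: (HE4iii mn0) => [[]//|[_ /(_ 1)]]; rewrite e0 f0 => hh.
have // := hh _; suff : lseq zero zero 1 by move=> /hh.
split=> //; exists (fun=> zero); split=> // [|i _]; last left; split; exact: idm.
Qed.
End LatticeFrame.
End Coordinates.

(** * Idempotent matrices and complementary pairs *)

Section MatrixForm.
Local Open Scope ring_scope.

Theorem coordinatization_mx (L : modLattice) (m : nat) (f : nat -> L) : (2 < m)%N ->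
  indep [seq f i | i <- iota 0 m.+1] ->
  (forall x, lle x (joins [seq f i | i <- iota 0 m.+1])) ->
  (forall j, (j < m)%N -> exists z, [/\ lle (lmeet z (f m)) bot, lle (lmeet z (f j)) bot,
     lle top (ljoin z (f m)) & lle top (ljoin z (f j))]) ->
  f m <> bot ->
  exists (R : nzRingType) (P : L -> 'rV[R]_m.+1 -> Prop),
    [/\ forall r : R, exists s, r * s * r = r,
        forall x z, lle x z <-> (forall u, P x u -> P z u),
        forall x, exists N (X : 'M[R]_(N, m.+1)), forall u, P x u <-> exists t, u = t *m X &
        forall N (X : 'M[R]_(N, m.+1)), exists x, forall u, P x u <-> exists t, u = t *m X].
Proof.
move=> m2 If Tf Pf f0.
have [R [Psi [regR Psi_le Psi_fg fg_Psi]]] := coordinatization m2 If Tf Pf f0.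
pose fv (u : 'rV[R]_m.+1) (j : nat) : R := u 0 (inord j).
pose rw (v : nat -> R) : 'rV[R]_m.+1 := \row_j v j.
have fv_rw v j : (j < m.+1)%N -> fv (rw v) j = v j.
  by move=> hj; rewrite /fv mxE inordK.
(* A finitely generated predicate sees only the first [m + 1] values of a sequence. *)
have ext x v : Psi x v <-> Psi x (fv (rw v)).
  have [N [X hX]] := Psi_fg x.
  split=> /hX [t ht]; apply/hX; exists t => j hj; first by rewrite fv_rw // ht.
  by rewrite -(fv_rw v j hj) ht.
exists R, (fun x u => Psi x (fv u)); split=> // [x z|x|N X].
- split=> [/Psi_le h u|h]; first exact: h.
  by apply/Psi_le => v /ext/h hv; apply/ext.
- have [N [X hX]] := Psi_fg x; exists N, (\matrix_(i, j) X i j) => u; split.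
    move/hX=> [t ht]; exists (\row_i t i); apply/rowP => j; rewrite !mxE.
    have := ht j (ltn_ord j); rewrite /fv inord_val => ->.
    by apply: eq_bigr => i _; rewrite !mxE.
  move=> [t ->]; apply/hX; exists (fun i => t 0 i) => j hj; rewrite /fv !mxE.
  by apply: eq_bigr => i _; rewrite !mxE inordK.
pose M (v : nat -> R) := exists t, rw v = t *m X.
have [|x hx] := fg_Psi M.
  exists N, (fun i j => X i (inord j)) => v; split=> [[t ht]|[t ht]].
    exists (fun i => t 0 i) => j hj; have := congr1 (fun A : 'rV__ => A 0 (inord j)) ht.
    by rewrite /rw !mxE inordK.
  exists (\row_i t i); apply/rowP => j; rewrite !mxE (ht j (ltn_ord j)).
  by apply: eq_bigr => i _; rewrite !mxE inord_val.
exists x => u; have urw : rw (fv u) = u by apply/rowP => j; rewrite mxE /fv inord_val.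
by split=> [/hx|h]; [|apply/hx]; rewrite /M urw.
Qed.
End MatrixForm.

(** * From complementary pairs to the isomorphism *)

Section IdempotentPairs.
Local Open Scope ring_scope.
Variables (L : modLattice) (R : nzRingType) (n : nat) (P : L -> 'rV[R]_n -> Prop).
Hypothesis P_le : forall x z, lle x z <-> (forall u, P x u -> P z u).
Hypothesis P_fg : forall x, exists N (X : 'M[R]_(N, n)), forall u, P x u <-> exists t, u = t *m X.
Hypothesis fg_P : forall N (X : 'M[R]_(N, n)), exists x, forall u, P x u <-> exists t, u = t *m X.

Lemma P_mul N x (t : 'rV[R]_N) (A : 'M[R]_(N, n)) : (forall i, P x (row i A)) -> P x (t *m A).
Proof.
have [N' [X hX]] := P_fg x => h.
have [T hT] := choice (fun i => proj1 (hX _) (h i)).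
apply/hX; exists (t *m \matrix_i T i); rewrite -mulmxA; congr mulmx.
by apply/row_matrixP => i; rewrite row_mul rowK -hT.
Qed.

Lemma P_add x u v : P x u -> P x v -> P x (u + v).
Proof.
have [N [X hX]] := P_fg x => /hX[t ->] /hX[s ->].
by apply/hX; exists (t + s); rewrite mulmxDl.
Qed.

Lemma P0 x : P x 0.
Proof. by have [N [X hX]] := P_fg x; apply/hX; exists 0; rewrite mul0mx. Qed.

Lemma P_opp x u : P x u -> P x (- u).
Proof. by have [N [X hX]] := P_fg x => /hX[t ->]; apply/hX; exists (- t); rewrite mulNmx. Qed.

Lemma P_bot u : P bot u -> u = 0.
Proof.
have [w hw] := fg_P (0 : 'M[R]_(0, n)).
by move/(proj1 (P_le bot w) (lbotP w))/hw => [t ->]; rewrite mulmx0.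
Qed.

Lemma P_top u : P top u.
Proof.
have [w hw] := fg_P (1%:M : 'M[R]_n).
by apply: (proj1 (P_le w top) (ltopP w)); apply/hw; exists u; rewrite mulmx1.
Qed.

(** The cyclic submodule of [u] is represented by a lattice element below both [x] and [y]. *)
Lemma P_meet x y u : P x u -> P y u -> P (lmeet x y) u.
Proof.
move=> hx hy; have [w hw] := fg_P u.
have sub z : P z u -> lle w z.
  by move=> hz; apply/P_le => v /hw[t ->]; apply: P_mul => i; rewrite ord1 row_id.
have wxy : lle w (lmeet x y) by rewrite lmeetP !sub.
by apply: (proj1 (P_le _ _) wxy); apply/hw; exists 1%:M; rewrite mul1mx.
Qed.

Lemma mulmx_fix (A : 'M[R]_n) (B : 'M[R]_n) : A *m A = A ->
  (forall u : 'rV_n, u *m A = u -> u *m B = u) <-> A *m B = A.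
Proof.
move=> AA; split=> [h|AB u uA]; last by rewrite -{1}uA -mulmxA AB.
by apply/row_matrixP => i; rewrite row_mul h // -row_mul AA.
Qed.

(** The rows of the identity are combinations of the generators of both submodules; their parts in
    [x] form the matrix of the projection onto [x] along [y]. *)
Lemma compl_idem x y : lmeet x y = bot -> ljoin x y = top ->
  exists A : 'M[R]_n, [/\ A *m A = A, forall u, P x u <-> u *m A = u &
    forall u, P y u <-> u *m (1%:M - A) = u].
Proof.
move=> xy0 xy1; have [N1 [X hX]] := P_fg x; have [N2 [Y hY]] := P_fg y.
have [z hz] := fg_P (col_mx X Y).
have zt : lle top z.
  rewrite -xy1 ljoinP; apply/andP; split; apply/P_le => u.
    by move/hX=> [t ->]; apply/hz; exists (row_mx t 0); rewrite mul_row_col mul0mx addr0.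
  by move/hY=> [t ->]; apply/hz; exists (row_mx 0 t); rewrite mul_row_col mul0mx add0r.
have h1 i : exists t, row i (1%:M : 'M[R]_n) = t *m col_mx X Y.
  exact/hz/(proj1 (P_le _ _) zt)/P_top.
have [T hT] := choice h1.
pose T' : 'M_(n, N1 + N2) := \matrix_i T i.
have eT : 1%:M = T' *m col_mx X Y.
  by apply/row_matrixP => i; rewrite row_mul rowK -hT.
pose A := lsubmx T' *m X.
have eA : 1%:M - A = rsubmx T' *m Y.
  by rewrite eT -{1}[T']hsubmxK mul_row_col addrC addKr.
have xA u : P x (u *m A) by apply/hX; exists (u *m lsubmx T'); rewrite mulmxA.
have yA u : P y (u *m (1%:M - A)) by apply/hY; exists (u *m rsubmx T'); rewrite eA mulmxA.
have uE (u : 'rV_n) : u *m (1%:M - A) = u - u *m A by rewrite mulmxBr mulmx1.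
have fixx u : P x u -> u *m A = u.
  move=> hu; apply/eqP; rewrite eq_sym -subr_eq0 -uE; apply/eqP/P_bot.
  by rewrite -xy0; apply: P_meet => //; rewrite uE; apply: P_add => //; apply: P_opp.
have fixy u : P y u -> u *m (1%:M - A) = u.
  move=> hu; rewrite uE; suff -> : u *m A = 0 by rewrite subr0.
  apply: P_bot; rewrite -xy0; apply: P_meet => //.
  have -> : u *m A = u - u *m (1%:M - A) by rewrite uE subKr.
  by apply: P_add => //; apply: P_opp.
exists A; split=> [|u|u].
- by apply/row_matrixP => i; rewrite row_mul fixx // rowE.
- by split=> [/fixx//|<-].
- by split=> [/fixy//|<-].
Qed.

Lemma idem_compl (A : 'M[R]_n) : A *m A = A -> exists x y, [/\ lmeet x y = bot,
  ljoin x y = top, forall u, P x u <-> u *m A = u & forall u, P y u <-> u *m (1%:M - A) = u].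
Proof.
move=> AA; have BB : (1%:M - A) *m (1%:M - A) = 1%:M - A.
  by rewrite mulmxBl mul1mx mulmxBr mulmx1 AA subrr subr0.
have fixE B : B *m B = B -> forall u : 'rV[R]_n, (exists t, u = t *m B) <-> u *m B = u.
  by move=> h u; split=> [[t ->]|<-]; [rewrite -mulmxA h|exists u].
have [x hx] := fg_P A; have [y hy] := fg_P (1%:M - A).
have hx' u : P x u <-> u *m A = u by rewrite hx fixE.
have hy' u : P y u <-> u *m (1%:M - A) = u by rewrite hy fixE.
exists x, y; split=> //; apply: lle_anti; try exact: lbotP; try exact: ltopP.
- apply/P_le => u hu.
  have /hx' ux : P x u by apply: (proj1 (P_le _ _) _ _ hu); apply: lat_Il; apply: lle_refl.
  have /hy' uy : P y u by apply: (proj1 (P_le _ _) _ _ hu); apply: lat_Ir; apply: lle_refl.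
  by rewrite -uy mulmxBr mulmx1 ux subrr; apply: P0.
apply/P_le => u _; have -> : u = u *m A + u *m (1%:M - A) by rewrite mulmxBr mulmx1 subrKC.
apply: P_add.
  apply: (proj1 (P_le x _)); first by apply: lat_Ul; apply: lle_refl.
  by apply/hx'; rewrite -mulmxA AA.
apply: (proj1 (P_le y _)); first by apply: lat_Ur; apply: lle_refl.
by apply/hy'; rewrite -mulmxA BB.
Qed.

Variables (S : Type) (mul : S -> S -> S) (pr : idem mul -> idem mul) (lam : idem mul -> L).
Local Notation "x ** y" := (mul x y) (at level 40, left associativity).
Local Notation "# e" := (proj1_sig e) (at level 2, format "# e").
Hypothesis prK : forall e, pr (pr e) = e.
Hypothesis bwr_pr : forall e f, bwr f e <-> bwl (pr e) (pr f).
Hypothesis lamP : forall e f, lle (lam e) (lam f) <-> bwl e f.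
Hypothesis lam_meet : forall e, lmeet (lam e) (lam (pr e)) = bot.
Hypothesis lam_join : forall e, ljoin (lam e) (lam (pr e)) = top.
Hypothesis lam_ex : forall x y, lmeet x y = bot -> ljoin x y = top ->
  exists e, lam e = x /\ lam (pr e) = y.
Hypothesis mul_l : forall e f g : idem mul, bwl e f -> bwl g e -> bwl e g -> bwr g f ->
  (forall u, bwl u f -> bwl u (pr e) -> bwl u (pr g)) -> #g = #f ** #e.
Hypothesis mul_r : forall e f g : idem mul, bwr e f -> bwr g e -> bwr e g -> bwl g f ->
  (forall u, bwr u f -> bwr u (pr e) -> bwr u (pr g)) -> #g = #e ** #f.
Local Notation M := (idem (@mulmx R n n n)).

Lemma lam_inj e f : lam e = lam f -> lam (pr e) = lam (pr f) -> e = f.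
Proof.
move=> h1 h2; apply: idem_inj; have <- : bwl e f by apply/lamP; rewrite h1 lle_refl.
by apply/bwr_pr/lamP; rewrite h2 lle_refl.
Qed.

Lemma P_inj x y : (forall u, P x u <-> P y u) -> x = y.
Proof. by move=> h; apply: lle_anti; apply/P_le => u /h. Qed.

Lemma mx_compl (A : M) : {B : M | #B = 1%:M - #A}.
Proof.
apply: idemE; have AA := idm A.
by rewrite mulmxBl mul1mx mulmxBr mulmx1 AA subrr subr0.
Qed.

Theorem idempotent_iso : exists th : M -> idem mul, biset_iso th.
Proof.
have /choice[th hth] : forall a : M, exists e,
    (forall u, P (lam e) u <-> u *m #a = u) /\
    (forall u, P (lam (pr e)) u <-> u *m (1%:M - #a) = u).
  move=> a; have [x [y [h1 h2 h3 h4]]] := idem_compl (idm a).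
  by have [e [h5 h6]] := lam_ex h1 h2; exists e; rewrite h5 h6.
have thl a u := (hth a).1 u; have thr a u := (hth a).2 u.
have bwl_th a b : bwl (th a) (th b) <-> bwl a b.
  rewrite -lamP P_le /bwl /wlT -mulmx_fix; last exact: idm.
  by split=> h u; have := h u; rewrite !thl.
have th_pr a b : #b = 1%:M - #a -> pr (th a) = th b.
  move=> ba; apply: lam_inj; apply: P_inj => u; first by rewrite thr thl ba.
  by rewrite prK thl thr ba subKr.
have bwr_th a b : bwr (th a) (th b) <-> bwr a b.
  have [a' ea] := mx_compl a; have [b' eb] := mx_compl b.
  rewrite bwr_pr (th_pr _ _ ea) (th_pr _ _ eb) bwl_th /bwl /bwr /wlT /wrT ea eb.
  rewrite mulmxBr mulmx1 mulmxBl mul1mx; split=> [/eqP|->]; last by rewrite subrr subr0.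
  by rewrite -subr_eq0 addrC addKr oppr_eq0 subr_eq0 => /eqP.
have th_surj e : exists a, th a = e.
  have [A [AA A1 A2]] := compl_idem (lam_meet e) (lam_join e).
  have [a ea] := idemE AA; exists a; apply: lam_inj; apply: P_inj => u.
    by rewrite thl A1 ea.
  by rewrite thr A2 ea.
have th_inj : injective th.
  move=> a b ab; apply: idem_inj; have <- : bwl a b by apply/bwl_th; rewrite ab; apply: idm.
  by apply/bwr_th; rewrite ab; apply: idm.
have /choice[g gK] := th_surj.
have bdefE (T : Type) (m : T -> T -> T) (e f : idem m) :
    bdef e f <-> (bwl e f \/ bwr f e \/ bwr e f \/ bwl f e) by [].
exists th; split=> [|a b]; first by exists g => // a; apply: th_inj.
rewrite !bdefE !bwl_th !bwr_th; split=> // ab c cE.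
have annr (d b' : M) : bwr (th d) (pr (th b')) <-> #b' *m #d = 0.
  have [b1 eb] := mx_compl b'.
  rewrite (th_pr _ _ eb) bwr_th /bwr /wrT eb mulmxBl mul1mx; split=> [/eqP|->]; last first.
    by rewrite subr0.
  by rewrite -subr_eq0 addrC addKr oppr_eq0 => /eqP.
have annl (d b' : M) : bwl (th d) (pr (th b')) <-> #d *m #b' = 0.
  have [b1 eb] := mx_compl b'.
  rewrite (th_pr _ _ eb) bwl_th /bwl /wlT eb mulmxBr mulmx1; split=> [/eqP|->]; last first.
    by rewrite subr0.
  by rewrite -subr_eq0 addrC addKr oppr_eq0 => /eqP.
(* In the first two cases the product is one of the factors; in the last two it is determined by the
   preorders, through [mul_r] and [mul_l]. *)
case: ab => [ab|[ba|[ab|ba]]].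
- by rewrite (_ : c = a); [symmetry; apply/bwl_th|apply: idem_inj; rewrite cE].
- by rewrite (_ : c = b); [symmetry; apply/bwr_th|apply: idem_inj; rewrite cE].
- have {}ab : #b *m #a = #a := ab.
  apply: mul_r; rewrite ?bwr_th ?bwl_th //; rewrite /bwl /bwr /wlT /wrT ?cE.
  + by rewrite mulmxA idm.
  + by rewrite -mulmxA ab idm.
  + by rewrite -mulmxA idm.
  move=> u; have [d <-] := th_surj u => /bwr_th bd /annr ad; apply/annr.
  by rewrite cE -mulmxA [#b *m _]bd.
have {}ba : #b *m #a = #b := ba.
apply: mul_l; rewrite ?bwr_th ?bwl_th //; rewrite /bwl /bwr /wlT /wrT ?cE.
+ by rewrite -mulmxA idm.
+ by rewrite mulmxA ba idm.
+ by rewrite mulmxA idm.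
move=> u; have [d <-] := th_surj u => /bwl_th da /annl db; apply/annl.
by rewrite cE mulmxA [#d *m #a]da.
Qed.
End IdempotentPairs.

Theorem theorem5p1
  (S : Type) (mul : S -> S -> S) (HS : regular_semigroup mul)
  (* (E1) *)
  (zero : idem mul) (HE1 : forall e, bw zero e)
  (* (E2) *)
  (pr : idem mul -> idem mul)
  (HE2i : forall e, pr (pr e) = e)
  (HE2ii : forall e f, bwl f e <-> bwr (pr e) (pr f))
  (HE2iii : forall e f, bwl f (pr e) <-> (forall g, bM f e g <-> g = zero))
  (* (E3) *)
  (HE3 : forall e f, bw f (pr e) ->
           exists h, bS (pr e) (pr f) h /\ bS (pr f) (pr e) h)
  (* (E4) *)
  (n : nat) (hn : 4 <= n) (es : 'I_n -> idem mul)
  (HE4i : forall i j, i <> j -> forall g, bM (es i) (es j) g <-> g = zero)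
  (HE4ii : forall e, (forall i, bw (es i) e) -> e = pr zero)
  (HE4iii : forall i j, i <> j -> dl_is (es i) (es j) 3) :
  exists (R : nzRingType) (th : idem (@mulmx R n n n) -> idem mul),
    regular_ring R /\ biset_iso th.
Proof.
(* One frame member becomes [a]; the other [m >= 3] provide a target, an auxiliary member and a
   third index. *)
case: n hn es HE4i HE4ii HE4iii => // m m3 es HE4i HE4ii HE4iii.
have [L [lam [lamP lamS]]] := left_lattice HS HE1 HE2i HE2ii HE2iii HE3.
have lm := lam_meet_pr HS HE1 HE2iii lamP lamS.
have lj := lam_join_pr HS HE1 HE2i HE2ii HE2iii lamP lamS.
have [] := @coordinatization_mx L m (fun i => lam (es (inord i))) m3.
- exact: (frame_indep HS HE1 HE2i HE2ii HE2iii lamP lamS).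
- exact: (frame_top HS HE1 HE2i HE2ii HE2iii HE3 lamP lamS).
- exact: (frame_perspective HS HE1 HE2i HE2ii HE2iii lamP lamS).
- exact: (frame_neq0 HS HE1 lamP HE4iii (ltnW (ltnW m3))).
move=> R [P [regR P_le P_fg fg_P]]; exists R.
have [e|e|x y xy0 xy1|||th hth] :=
  @idempotent_iso L R m.+1 P P_le P_fg fg_P S mul pr lam HE2i (bwr_pr HE2i HE2ii) lamP.
- by apply: lle_anti; [apply: lm|apply: lbotP].
- by apply: lle_anti; [apply: ltopP|apply: lj].
- have [e ex] := lamS x; have [f fy] := lamS y.
  have [u h1 h2|w h1 h2|q [q1 q2 q3 q4]] :=
    complementary HS HE1 HE2i HE2ii HE2iii HE3 (e := e) (f := f).
  + have /lamP uz : lle (lam u) (lam zero).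
      apply: lle_trans (lbotP _); rewrite -xy0 lmeetP -ex -fy.
      by rewrite (proj2 (lamP _ _) h1) (proj2 (lamP _ _) h2).
    by apply: idem_inj; rewrite -uz (HE1 u).2.
  + have /lamP/HE2ii : lle (lam (pr zero)) (lam w).
      apply: lle_trans (ltopP _) _; rewrite -xy1 ljoinP -ex -fy.
      by rewrite (proj2 (lamP _ _) h1) (proj2 (lamP _ _) h2).
    by rewrite HE2i => h; rewrite -[w]HE2i; congr pr; apply: idem_inj; rewrite -h (HE1 _).1.
  exists q; split; rewrite -?ex -?fy; apply: lle_anti; exact/lamP.
- exact: (basic_product HS HE1 HE2i HE2ii HE2iii HE3).
- exact: (basic_product_dual HS HE1 HE2i HE2ii HE2iii HE3).
by exists th.
Qed.
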